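(* Let $T_1$ and $T_2$ be very small cyclic trees for $F_k$ that fill, with edge stabilizers (generated by) $c_1$ and $c_2$ and associated Dehn twist automorphisms $\delta_1$ and $\delta_2$. Let $N \geq 0$ be such that for all $n \geq N$ the element $\delta_1^n\delta_2^{-n}$ is a hyperbolic fully irreducible outer automorphism, with stable and unstable currents $[\mu_+^n]$ and $[\mu_-^n]$ in $\mathbb{P}Curr(F_k)$. Then $$\lim_{n \to \infty} [\mu_+^n] = [\eta_{c_1}] \quad\text{and}\quad \lim_{n \to \infty} [\mu_-^n] = [\eta_{c_2}].$$
   Context: $F_k$ is a nonabelian free group of rank $k$. Fully irreducible/hyperbolic: $\phi\in\mathrm{Out}(F_k)$ is fully irreducible if no conjugacy class of a proper nontrivial free factor of $F_k$ is periodic under $\phi$, and hyperbolic if no conjugacy class of a nontrivial element of $F_k$ is periodic under $\phi$. Cyclic trees and Dehn twists: a cyclic tree is the Bass–Serre tree $T$ of a splitting of $F_k$ over $\mathbb{Z}$, either an amalgamated free product $F_k = A *_{\langle c\rangle} B$ or an HNN-extension $F_k = A*_{\mathbb{Z}} = \langle A,t \mid t^{-1}a_0t = a_1\rangle$ with $a_0,a_1\in A$. The edge stabilizer is $\langle c\rangle$, resp. $\langle a_0\rangle$ (write $c=a_0$), up to conjugacy. The tree is very small if the stabilizer of each arc is trivial or maximal cyclic and the stabilizer of each tripod is trivial. The associated Dehn twist automorphism $\delta$ is: in the amalgam case, $\delta(a)=a$ for $a\in A$ and $\delta(b)=cbc^{-1}$ for $b \in B$; in the HNN case, $\delta(a)=a$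 for $a\in A$ and $\delta(t)=a_0t$. The same symbol denotes its class in $\mathrm{Out}(F_k)$. Filling: for a finitely generated free group $X$ acting on a simplicial tree $T$ with trivial or cyclic edge stabilizers, the free volume $\mathrm{vol}_T(X)$ is the number of edges with trivial stabilizer in the graph of groups decomposition $T^X/X$, where $T^X$ is the smallest $X$-invariant subtree (a fixed vertex, giving volume $0$, if $X$ fixes a point). For $X=\langle x\rangle$ this is the translation length $\ell_T(x)$. Two cyclic trees $T_1,T_2$ fill if $\mathrm{vol}_{T_1}(X)+\mathrm{vol}_{T_2}(X)>0$ for every nontrivial subgroup $X\subset F_k$ that is a proper free factor or cyclic. Currents: let $\partial^2F_k=\{(x_1,x_2)\in\partial F_k\times\partial F_k : x_1\neq x_2\}$ and let $\sigma(x_1,x_2)=(x_2,x_1)$. $Curr(F_k)$ is the set of $F_k$-invariant positive Radon measures on $\partial^2F_k/\sigma$ with the weak topology; $\mathbb{P}Curr(F_k)$ is the quotient of $Curr(F_k)-\{0\}$ by scaling by $\mathbb{R}_{>0}$. $\mathrm{Out}(F_k)$ acts on the left by $\phi\nu(S)=\nu(\phi^{-1}(S))$. For a basis $\mathcal{A}$ of $F_k$, $\partial^2F_k/\sigma$ is identified with unoriented bi-infinite geodesics in the Cayley tree $T_{\mathcal{A}}$; for nontrivial $g$, $Cyl_{\mathcal{A}}(g)$ is the set of geodesics containing the vertices $1$ and $g$, and $\langle g,\nu\rangle_{\mathcal{A}}=\nu(Cyl_{\mathcal{A}}(g))$. A current is determined by these values. Counting currents: for nontrivial $h\in F_k$ not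 a proper power, $\eta_h$ is the current with $\langle g,\eta_h\rangle_{\mathcal{A}}=$ the number of times the reduced words $g$ or $g^{-1}$ in $\mathcal{A}$ occur in the cyclic word in $\mathcal{A}$ determined by $h$ (starting positions on the cyclic word, wrapping around allowed); $\eta_{f^m}=m\eta_f$ for $m\ge1$. This depends only on the conjugacy class of $h$ and not on $\mathcal{A}$. Stable/unstable currents: a hyperbolic fully irreducible $\phi$ acts on $\mathbb{P}Curr(F_k)$ with exactly two fixed points $[\mu_+]$ (stable) and $[\mu_-]$ (unstable), characterized by $\lim_{m\to\infty}[\phi^m\eta_h]=[\mu_+]$ and $\lim_{m\to\infty}[\phi^{-m}\eta_h]=[\mu_-]$ for every nontrivial $h\in F_k$. *)

(* Defs.v *)
From Stdlib Require List.
From HB Require Import structures.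
From mathcomp Require Import all_boot all_order all_algebra finmap.
From mathcomp Require Import all_classical all_reals all_analysis.
Import Order.TTheory GRing.Theory Num.Theory numFieldNormedType.Exports.

Set Implicit Arguments.
Unset Strict Implicit.
Unset Printing Implicit Defensive.

Local Open Scope classical_set_scope.
Local Open Scope quotient_scope.
Local Open Scope group_scope.

Section Subgroups.
Context {F : groupType}.
Implicit Types (A B H X S : set F) (g h t c z : F).

Definition is_subgroup H := group_closed (mem H : {pred F}).

Definition cyc z : set F :=
  [set g | exists n : nat, g = z ^+ n \/ g = z ^- n].

Definition trivial_subgroup H := H = [set 1].

Definition maximal_cyclic H :=
  (exists z, H = cyc z) /\ forall z, H `<=` cyc z -> H = cyc z.

Definition left_mul g S : set F := [set g * x | x in S].

Definition set_mul S S' : set F := [set x * y | x in S & y in S'].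

Definition morph_on A (G : groupType) (f : F -> G) :=
  forall x y, A x -> A y -> f (x * y) = f x * f y.

(* F = A *_<c> B, by the universal property of the pushout of A <- <c> -> B. *)
Definition is_amalgam A B c :=
  [/\ is_subgroup A, is_subgroup B, A c, B c &
   forall (G : groupType) (fA fB : F -> G),
     morph_on A fA -> morph_on B fB -> fA c = fB c ->
     exists! f : F -> G, [/\ morph_on setT f,
       forall a, A a -> f a = fA a & forall b, B b -> f b = fB b]].

(* F = <A, t | t^-1 a0 t = a1>, by the universal property. *)
Definition is_hnn A t (a0 a1 : F) :=
  [/\ is_subgroup A, A a0, A a1, t^-1 * a0 * t = a1 &
   forall (G : groupType) (fA : F -> G) (s : G),
     morph_on A fA -> s^-1 * fA a0 * s = fA a1 ->
     exists! f : F -> G, [/\ morph_on setT f,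
       forall a, A a -> f a = fA a & f t = s]].

Definition free_factor A := exists B, is_amalgam A B 1.

Definition proper_free_factor A := free_factor A /\ A <> setT.

Definition not_proper_power h := forall g (n : nat), h = g ^+ n -> (n <= 1)%N.

End Subgroups.

Section Automorphisms.
Context (F : groupType).

(* An automorphism is stored together with its inverse. *)
Definition is_aut (p : (F -> F) * (F -> F)) :=
  [/\ {morph p.1 : x y / x * y}, cancel p.1 p.2 & cancel p.2 p.1].

Definition aut := {p : (F -> F) * (F -> F) | `[< is_aut p >]}.

HB.instance Definition _ := SubType.on aut.
HB.instance Definition _ := Choice.on aut.

Definition aut_fun (f : aut) : F -> F := (val f).1.
Coercion aut_fun : aut >-> Funclass.

Lemma autP (f : aut) : is_aut (val f).
Proof. exact: asboolW (valP f). Qed.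

Lemma autM (f : aut) : {morph f : x y / x * y}.
Proof. by case: (autP f). Qed.

Lemma autV (f : aut) x : f x^-1 = (f x)^-1.
Proof.
have f1 : f 1 = 1 by apply: (mulgI (f 1)); rewrite -autM !mulg1.
by apply: (mulgI (f x)); rewrite -autM !mulgV.
Qed.

Lemma aut_eq (f g : aut) : f =1 g -> f = g.
Proof.
move=> fg; apply: val_inj.
case: (autP f) (autP g) (fg); rewrite /aut_fun.
case: (val f) (val g) => [a a'] [b b'] /= _ aK a'K [_ bK _] {}fg.
have ab : a = b by apply/funext.
have E x : a' x = b' x by rewrite -[LHS]bK /= -ab a'K.
by rewrite ab (funext E).
Qed.

Lemma is_aut_id : is_aut (id, id).
Proof. by []. Qed.

Lemma is_aut_comp (f g : aut) :
  is_aut ((val f).1 \o (val g).1, (val g).2 \o (val f).2).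
Proof.
case: (autP f) (autP g) => fM fK f'K [gM gK g'K]; split => /=.
- by move=> x y /=; rewrite gM fM.
- exact: can_comp.
- exact: can_comp.
Qed.

Lemma is_aut_inv (f : aut) : is_aut ((val f).2, (val f).1).
Proof.
case: (autP f) => fM fK f'K; split => //= x y.
by apply: (can_inj fK); rewrite fM !f'K.
Qed.

Definition mk_aut p (h : is_aut p) : aut :=
  exist (fun p => `[< is_aut p >]) p (asboolT h).
Definition aut1 : aut := mk_aut is_aut_id.
Definition aut_mul (f g : aut) : aut := mk_aut (is_aut_comp f g).
Definition aut_inv (f : aut) : aut := mk_aut (is_aut_inv f).

Lemma aut_mulA : associative aut_mul.
Proof. by move=> f g h; apply: aut_eq. Qed.
Lemma aut_mul1g : left_id aut1 aut_mul.
Proof. by move=> f; apply: aut_eq. Qed.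
Lemma aut_mulg1 : right_id aut1 aut_mul.
Proof. by move=> f; apply: aut_eq. Qed.
Lemma aut_mulVg : left_inverse aut1 aut_inv aut_mul.
Proof. by move=> f; apply: aut_eq => x; case: (autP f) => _ + _; exact. Qed.
Lemma aut_mulgV : right_inverse aut1 aut_inv aut_mul.
Proof. by move=> f; apply: aut_eq => x; case: (autP f) => _ _; exact. Qed.

(* The product of aut is composition: (f * g) x = f (g x). *)
HB.instance Definition _ := isGroup.Build aut
  aut_mulA aut_mul1g aut_mulg1 aut_mulVg aut_mulgV.

Definition outer_eq (f g : aut) : bool :=
  `[< exists h : F, forall x, g x = h * f x * h^-1 >].

Lemma outer_eq_refl : reflexive outer_eq.
Proof.
by move=> f; apply/asboolP; exists 1 => x; rewrite mul1g invg1 mulg1.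
Qed.

Lemma outer_eq_symW f g : outer_eq f g -> outer_eq g f.
Proof.
move=> /asboolP[h fg]; apply/asboolP; exists h^-1 => x.
by rewrite fg invgK !mulgA mulVg mul1g mulgVK.
Qed.

Lemma outer_eq_sym : symmetric outer_eq.
Proof. by move=> f g; apply/idP/idP; exact: outer_eq_symW. Qed.

Lemma outer_eq_trans : transitive outer_eq.
Proof.
move=> g f k /asboolP[h fg] /asboolP[h' gk]; apply/asboolP; exists (h' * h) => x.
by rewrite gk fg invgM !mulgA.
Qed.

Canonical outer_equiv :=
  EquivRel outer_eq outer_eq_refl outer_eq_sym outer_eq_trans.

Definition out := {eq_quot outer_equiv}.
HB.instance Definition _ := Choice.on out.
HB.instance Definition _ := EqQuotient.on out.

Definition out_class (f : aut) : out := \pi_out f.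

Lemma out_classP f g : out_class f = out_class g <-> outer_eq f g.
Proof. by split=> [/eqmodP|h]; [|apply/eqmodP]. Qed.

Lemma outer_eq_mul f f' g g' :
  outer_eq f f' -> outer_eq g g' -> outer_eq (f * g) (f' * g').
Proof.
move=> /asboolP[a ff'] /asboolP[b gg']; apply/asboolP; exists (a * f b) => x.
rewrite -[LHS]/(f' (g' x)) -[X in a * f b * X]/(f (g x)).
by rewrite gg' ff' !autM autV invgM !mulgA.
Qed.

Definition out_mul (p q : out) : out := out_class (repr p * repr q).
Definition out_inv (p : out) : out := out_class (repr p)^-1.

Lemma outer_eq_repr f : outer_eq (repr (out_class f)) f.
Proof. by apply/out_classP; rewrite /out_class reprK. Qed.

Lemma out_classM f g : out_mul (out_class f) (out_class g) = out_class (f * g).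
Proof.
by apply/out_classP; apply: outer_eq_mul; exact: outer_eq_repr.
Qed.

Lemma out_classK (P : out -> Prop) : (forall f, P (out_class f)) -> forall p, P p.
Proof. by move=> Pf p; rewrite -[p]reprK; exact: Pf. Qed.

Lemma out_mulA : associative out_mul.
Proof.
elim/out_classK => f; elim/out_classK => g; elim/out_classK => h.
by rewrite !out_classM mulgA.
Qed.
Lemma out_mul1g : left_id (out_class 1) out_mul.
Proof. by elim/out_classK => f; rewrite out_classM mul1g. Qed.
Lemma out_mulg1 : right_id (out_class 1) out_mul.
Proof. by elim/out_classK => f; rewrite out_classM mulg1. Qed.
Lemma out_mulVg : left_inverse (out_class 1) out_inv out_mul.
Proof.
move=> p; have {2}-> : p = out_class (repr p) by rewrite /out_class reprK.
by rewrite out_classM mulVg.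
Qed.
Lemma out_mulgV : right_inverse (out_class 1) out_inv out_mul.
Proof.
move=> p; have {1}-> : p = out_class (repr p) by rewrite /out_class reprK.
by rewrite out_classM mulgV.
Qed.

HB.instance Definition _ := isGroup.Build out
  out_mulA out_mul1g out_mulg1 out_mulVg out_mulgV.

(* Changing the representative of p changes x only, so the next two conditions
   depend on p and on the conjugacy class of g, resp. H. *)
Definition out_fixes_elt (p : out) (g : F) :=
  exists x, repr p g = x * g * x^-1.

Definition out_fixes_subgroup (p : out) (H : set F) :=
  exists x, repr p @` H = [set x * h * x^-1 | h in H].

Definition fully_irreducible (p : out) :=
  forall A : set F, proper_free_factor A -> ~ trivial_subgroup A ->
  forall m : nat, (0 < m)%N -> ~ out_fixes_subgroup (p ^+ m) A.

Definition hyperbolic (p : out) :=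
  forall g : F, g <> 1 ->
  forall m : nat, (0 < m)%N -> ~ out_fixes_elt (p ^+ m) g.

End Automorphisms.

(* Simplicial F-trees without inversions: the action preserves the orientation
   of the edges given by org and trm. *)
Record ftree (F : groupType) := FTree {
  vtx : Type;
  edg : Type;
  vertices : set vtx;
  edges : set edg;
  org : edg -> vtx;
  trm : edg -> vtx;
  vact : F -> vtx -> vtx;
  eact : F -> edg -> edg }.

Arguments vertices {F} f.
Arguments edges {F} f.

Section Splittings.
Context (F : groupType).

(* Amalgam A B c stands for A *_<c> B, and HNN A t a0 a1 for
   <A, t | t^-1 a0 t = a1>. *)
Inductive splitting :=
| Amalgam of set F & set F & F
| HNN of set F & F & F & F.

Definition edge_generator (s : splitting) : F :=
  match s with Amalgam _ _ c => c | HNN _ _ a0 _ => a0 end.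

Definition is_cyclic_splitting (s : splitting) :=
  edge_generator s <> 1 /\
  match s with
  | Amalgam A B c => is_amalgam A B c
  | HNN A t a0 a1 => is_hnn A t a0 a1
  end.

(* Vertices and edges are left cosets. The edge g<c> joins gA to gB (amalgam,
   with a boolean separating the two kinds of vertices), resp. the edge g<a0>
   joins gA to gtA. *)
Definition bass_serre (s : splitting) : ftree F :=
  match s with
  | Amalgam A B c =>
    @FTree F (bool * set F) (set F)
      [set v | exists g, v = (true, left_mul g A) \/ v = (false, left_mul g B)]
      [set e | exists g, e = left_mul g (cyc c)]
      (fun e => (true, set_mul e A))
      (fun e => (false, set_mul e B))
      (fun g v => (v.1, left_mul g v.2))
      left_mul
  | HNN A t a0 a1 =>
    @FTree F (set F) (set F)
      [set v | exists g, v = left_mul g A]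
      [set e | exists g, e = left_mul g (cyc a0)]
      (fun e => set_mul e A)
      (fun e => set_mul (set_mul e [set t]) A)
      left_mul
      left_mul
  end.

Definition is_dehn_twist (s : splitting) (d : aut F) :=
  match s with
  | Amalgam A B c =>
    (forall a, A a -> d a = a) /\ (forall b, B b -> d b = c * b * c^-1)
  | HNN A t a0 a1 => (forall a, A a -> d a = a) /\ d t = a0 * t
  end.

End Splittings.

Section Trees.
Context (F : groupType) (T : ftree F).
Implicit Types (X : set F) (SV : set (vtx T)) (SE : set (edg T)).

(* An edge, traversed forwards (true) or backwards (false). *)
Definition dart := (edg T * bool)%type.
Definition dart_src (d : dart) := if d.2 then org d.1 else trm d.1.
Definition dart_tgt (d : dart) := if d.2 then trm d.1 else org d.1.
Definition dart_rev (d : dart) : dart := (d.1, ~~ d.2).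

Fixpoint is_path (SE : set (edg T)) (u : vtx T) (p : seq dart) (v : vtx T) :=
  if p is d :: q then
    [/\ SE d.1, u = dart_src d & is_path SE (dart_tgt d) q v]
  else u = v.

Definition no_backtracking (p : seq dart) :=
  forall p1 d1 d2 p2, p = p1 ++ [:: d1, d2 & p2] -> d2 <> dart_rev d1.

Definition is_arc (u : vtx T) (p : seq dart) :=
  [/\ p <> [::], no_backtracking p & exists v, is_path (edges T) u p v].

Definition arc_stab (p : seq dart) : set F :=
  [set g | forall d, List.In d p -> eact g d.1 = d.1].

(* In a tree, three arcs issued from a vertex u with distinct first darts meet
   pairwise in u only. *)
Definition is_tripod (u : vtx T) (p1 p2 p3 : seq dart) :=
  [/\ is_arc u p1, is_arc u p2, is_arc u p3 &
      [/\ ohead p1 <> ohead p2, ohead p1 <> ohead p3 & ohead p2 <> ohead p3]].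

Definition very_small :=
  (forall u p, is_arc u p ->
     trivial_subgroup (arc_stab p) \/ maximal_cyclic (arc_stab p)) /\
  (forall u p1 p2 p3, is_tripod u p1 p2 p3 ->
     trivial_subgroup (arc_stab p1 `&` arc_stab p2 `&` arc_stab p3)).

Definition is_subtree SV SE :=
  [/\ SV `<=` vertices T, SE `<=` edges T, SV !=set0,
      forall e, SE e -> SV (org e) /\ SV (trm e) &
      forall u v, SV u -> SV v -> exists p, is_path SE u p v].

Definition is_invariant X SV SE :=
  forall x, X x -> (forall v, SV v -> SV (vact x v)) /\
                   (forall e, SE e -> SE (eact x e)).

(* The edges of T^X. If X fixes a vertex then this vertex is an invariant
   subtree, so that the intersection below contains no edge; otherwise (for X
   finitely generated) the intersection of the X-invariant subtrees is the
   smallest one. *)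
Definition min_subtree_edges X : set (edg T) :=
  [set e | edges T e /\
     forall SV SE, is_subtree SV SE -> is_invariant X SV SE -> SE e].

(* The edges of T^X / X with trivial stabilizer, as X-orbits in T^X; there are
   finitely many of them when X is finitely generated. *)
Definition free_edge_orbits X : set (set (edg T)) :=
  [set O | exists e, [/\ min_subtree_edges X e,
     forall x, X x -> eact x e = e -> x = 1 &
     O = [set eact x e | x in X]]].

Definition free_volume X : nat := #|` fset_set (free_edge_orbits X) |.

End Trees.

Definition fill (F : groupType) (T1 T2 : ftree F) :=
  forall X : set F, is_subgroup X -> ~ trivial_subgroup X ->
    proper_free_factor X \/ (exists x, X = cyc x) ->
    (0 < free_volume T1 X + free_volume T2 X)%N.

(* Free groups of rank k+2 (that is, nonabelian): the letter (i, true) stands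
   for the i-th basis element and (i, false) for its inverse. *)
Definition letter (k : nat) := ('I_k.+2 * bool)%type.
HB.instance Definition _ k := Finite.on (letter k).

Definition letter_inv k (a : letter k) : letter k := (a.1, ~~ a.2).
Definition can_follow k (a b : letter k) : bool := b != letter_inv a.
Definition reduced k (w : seq (letter k)) : bool := sorted (@can_follow k) w.
Definition cyc_reduced k (w : seq (letter k)) : bool := cycle (@can_follow k) w.
Definition word_inv k (w : seq (letter k)) := rev (map (@letter_inv k) w).

Section Words.
Context (F : groupType) (k : nat) (A : 'I_k.+2 -> F).

Definition letter_val (a : letter k) : F := if a.2 then A a.1 else (A a.1)^-1.
Definition word_val (w : seq (letter k)) : F :=
  foldr (fun a g => letter_val a * g) 1 w.

Definition is_basis :=
  forall g : F, exists! w : seq (letter k), reduced w /\ word_val w = g.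

End Words.

Definition occurs_at k (u w : seq (letter k)) (i : nat) : bool :=
  [forall j : 'I_(size u), onth u j == onth w ((i + j) %% size w)].

Definition occurrences k (u w : seq (letter k)) : nat :=
  count (fun i => occurs_at u w i || occurs_at (word_inv u) w i)
        (iota 0 (size w)).

Section Boundary.
Context (k : nat).

Definition rays : set {ptws nat -> discrete_topology (letter k)} :=
  [set x | forall n, can_follow (x n : letter k) (x n.+1)].
Definition boundary := set_type rays.
HB.instance Definition _ := Topological.on boundary.

Definition prefix_word (x : boundary) (n : nat) : seq (letter k) :=
  mkseq (fun i => val x i : letter k) n.

Definition distinct_pairs : set (boundary * boundary) :=
  [set p | p.1 <> p.2].
Definition boundary2 := set_type distinct_pairs.
HB.instance Definition _ := Topological.on boundary2.

Definition end1 (p : boundary2) : boundary := (val p).1.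
Definition end2 (p : boundary2) : boundary := (val p).2.

Lemma const_ray_subproof (b : bool) :
  (fun=> (ord0, b)) \in rays.
Proof. by rewrite inE => n; rewrite /can_follow xpair_eqE eqxx /=; case: b. Qed.
Definition const_ray b : boundary := SigSub (const_ray_subproof b).

Lemma const_rays_subproof : (const_ray true, const_ray false) \in distinct_pairs.
Proof.
by rewrite inE /distinct_pairs /= => /(congr1 (fun x => (val x 0%N).2)).
Qed.
HB.instance Definition _ :=
  isPointed.Build boundary2 (SigSub const_rays_subproof).

Definition same_line (p q : boundary2) : bool :=
  `[< (end1 p = end1 q /\ end2 p = end2 q) \/
      (end1 p = end2 q /\ end2 p = end1 q) >].

Lemma same_line_refl : reflexive same_line.
Proof. by move=> p; apply/asboolP; left. Qed.

Lemma same_line_sym : symmetric same_line.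
Proof.
have W p q : same_line p q -> same_line q p.
  by move=> /asboolP h; apply/asboolP; case: h => -[-> ->]; [left|right].
by move=> p q; apply/idP/idP; exact: W.
Qed.

Lemma same_line_trans : transitive same_line.
Proof.
move=> q p r /asboolP[[h1 h2]|[h1 h2]] /asboolP[[h3 h4]|[h3 h4]]; apply/asboolP.
- by left; rewrite h1 h2.
- by right; rewrite h1 h2.
- by right; rewrite h1 h2.
- by left; rewrite h1 h2.
Qed.

Canonical same_line_equiv :=
  EquivRel same_line same_line_refl same_line_sym same_line_trans.

Definition lines := quotient_topology {eq_quot same_line_equiv}.
HB.instance Definition _ := PointedTopological.on lines.

Definition line_of (p : boundary2) : lines := \pi_lines p.

Definition borel_lines := g_sigma_algebraType (@open lines).
HB.instance Definition _ := Measurable.on borel_lines.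

End Boundary.

Section FreeGroupOnLines.
Context (F : groupType) (k : nat) (A : 'I_k.+2 -> F).

Definition ray_val (x : boundary k) (n : nat) : F := word_val A (prefix_word x n).

(* The sequence u of elements of F converges to x in the compactification of F
   by its boundary. *)
Definition converges_to (u : nat -> F) (x : boundary k) :=
  forall m : nat, \forall n \near \oo, exists w : seq (letter k),
    [/\ reduced w, word_val A w = u n & take m w = prefix_word x m].

(* The map induced on lines by f : F -> F. It is used when f is a left
   translation or an automorphism: f then extends to a homeomorphism of the
   boundary, and the line in question exists and is unique. *)
Definition line_map (f : F -> F) (l : lines k) : lines k :=
  xget l [set l' | exists p p' : boundary2 k,
    [/\ line_of p = l, line_of p' = l',
        converges_to (f \o ray_val (end1 p)) (end1 p') &
        converges_to (f \o ray_val (end2 p)) (end2 p')]].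

Definition is_geodesic (c : int -> F) :=
  (forall i : int, exists a : letter k, c (i + 1)%R = c i * letter_val A a) /\
  (forall i : int, c (i + 2)%R <> c i).

Definition geodesic_of (c : int -> F) (l : lines k) :=
  is_geodesic c /\
  exists p : boundary2 k,
    [/\ line_of p = l,
        converges_to (fun n : nat => c (Posz n)) (end1 p) &
        converges_to (fun n : nat => c (- Posz n)%R) (end2 p)].

Definition Cyl (g : F) : set (lines k) :=
  [set l | exists c, [/\ geodesic_of c l, exists i, c i = 1 & exists j, c j = g]].

End FreeGroupOnLines.

Definition line_measure (R : realType) (k : nat) : Type :=
  {measure set (borel_lines k) -> \bar R}%R.

Section Radon.
Context (R : realType) (k : nat).
Local Open Scope ereal_scope.

(* Finite on compact sets, outer regular, inner regular on open sets. *)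
Definition is_radon (nu : line_measure R k) :=
  [/\ forall K : set (lines k), compact K -> nu K < +oo,
      forall S : set (borel_lines k), measurable S ->
        nu S = ereal_inf [set nu U | U in [set U : set (lines k) |
                                            open U /\ S `<=` U]] &
      forall U : set (lines k), open U ->
        nu U = ereal_sup [set nu K | K in [set K : set (lines k) |
                                            compact K /\ K `<=` U]]].

Definition test_fun := {f : lines k -> R^o | continuous f /\
  exists2 K : set (lines k), compact K & forall l, ~ K l -> f l = 0%R}.

End Radon.

Section Currents.
Context (R : realType) (F : groupType) (k : nat) (A : 'I_k.+2 -> F).

Definition is_current (nu : line_measure R k) :=
  is_radon nu /\
  forall (g : F) (S : set (borel_lines k)), measurable S ->
    nu (line_map A (fun x => g * x) @^-1` S) = nu S.

Definition current_ := {nu : line_measure R k | is_current nu}.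
HB.instance Definition _ := gen_eqMixin current_.
HB.instance Definition _ := gen_choiceMixin current_.

Definition pairing (nu : current_) : test_fun R k -> R^o :=
  fun f => (\int[sval nu]_(l in setT) (sval f l : R))%R.

Definition Curr := initial_topology (pairing : current_ -> {ptws test_fun R k -> R^o}).
HB.instance Definition _ := Topological.on Curr.

Definition meas (nu : Curr) : line_measure R k := sval nu.

Definition nonzero_set : set Curr := [set nu | meas nu setT <> 0%E].
Definition nonzero_Curr := set_type nonzero_set.
HB.instance Definition _ := Topological.on nonzero_Curr.

Definition nmeas (nu : nonzero_Curr) := meas (val nu).

(* Measures are functions on all sets; two of them that agree on the Borel sets
   are the same current, and have the same class in PCurr. *)
Definition proportional (nu nu' : nonzero_Curr) : bool :=
  `[< exists2 c : R, (0 < c)%R &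
      forall S : set (borel_lines k), measurable S ->
        nmeas nu' S = (c%:E * nmeas nu S)%E >].

Lemma proportional_refl : reflexive proportional.
Proof. by move=> nu; apply/asboolP; exists 1%R => // S _; rewrite mul1e. Qed.

Lemma proportional_sym : symmetric proportional.
Proof.
have W nu nu' : proportional nu nu' -> proportional nu' nu.
  move=> /asboolP[c c0 h]; apply/asboolP; exists c^-1%R.
    by rewrite invr_gt0.
  by move=> S mS; rewrite (h _ mS) muleA -EFinM mulVf ?gt_eqF// mul1e.
by move=> p q; apply/idP/idP; exact: W.
Qed.

Lemma proportional_trans : transitive proportional.
Proof.
move=> b a c /asboolP[x x0 h] /asboolP[y y0 h']; apply/asboolP.
exists (y * x)%R; first by rewrite mulr_gt0.
by move=> S mS; rewrite (h' _ mS) (h _ mS) muleA -EFinM.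
Qed.

Canonical proportional_equiv :=
  EquivRel proportional proportional_refl proportional_sym proportional_trans.

Definition PCurr := quotient_topology {eq_quot proportional_equiv}.
HB.instance Definition _ := Topological.on PCurr.

Definition pclass (nu : nonzero_Curr) : PCurr := \pi_PCurr nu.

(* f^-1 S is a preimage under f, so this is the push-forward of nu by f, which
   exists and is unique since f acts on lines by a homeomorphism. *)
Definition aut_act (f : aut F) (nu : nonzero_Curr) : nonzero_Curr :=
  xget nu [set nu' | forall S : set (borel_lines k), measurable S ->
                      nmeas nu' S = nmeas nu (line_map A f @^-1` S)].

Definition out_act (p : out F) (x : PCurr) : PCurr :=
  pclass (aut_act (repr p) (repr x)).

(* nu is the current eta_h; here h = f^m with f not a proper power, and w is
   the cyclic word determined by f. *)
Definition is_counting_current (h : F) (nu : nonzero_Curr) :=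
  exists (f : F) (m : nat) (w : seq (letter k)),
    [/\ h = f ^+ m, (0 < m)%N, not_proper_power f,
        cyc_reduced w /\ (exists x, word_val A w = x * f * x^-1) &
        forall u : seq (letter k), reduced u -> u <> [::] ->
          nmeas nu (Cyl A (word_val A u)) = ((m * occurrences u w)%N%:R)%:E].

Definition is_stable_current (p : out F) (x : PCurr) :=
  out_act p x = x /\
  forall (h : F) (eta : nonzero_Curr), h <> 1 -> is_counting_current h eta ->
    (fun m : nat => out_act (p ^+ m) (pclass eta)) @ \oo --> x.

Definition is_unstable_current (p : out F) (x : PCurr) :=
  out_act p x = x /\
  forall (h : F) (eta : nonzero_Curr), h <> 1 -> is_counting_current h eta ->
    (fun m : nat => out_act (p ^- m) (pclass eta)) @ \oo --> x.

End Currents.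

Arguments PCurr R {F k} A.
Arguments nonzero_Curr R {F k} A.

(* Main.v *)
From HB Require Import structures.
Require Import Defs.
From mathcomp Require Import finmap.
From mathcomp Require Import all_boot all_order all_algebra.
From mathcomp Require Import all_classical all_reals all_analysis measurable_realfun.
From mathcomp Require Import zify ring lra.

Set Implicit Arguments.
Unset Strict Implicit.
Unset Printing Implicit Defensive.

Local Open Scope classical_set_scope.
Local Open Scope group_scope.

(* Let c1, c2 generate the edge stabilizers and phi = delta1^n delta2^-n. An
   element X of F that is hyperbolic in the Bass-Serre tree T of a splitting over
   <c> is conjugate to a product of r elements joining consecutive edges of its
   axis, where r is a translation length, and the twist inserts c^(+-n) at each of
   the r edges. No cancellation of long powers of c takes place, so that for a
   quasi-additive count L (the length, or the number of occurrences of a word)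
   the homogenization of L at delta^n X is n r L(c) + O(|X|).
   Since the trees fill, c1 is hyperbolic in T2 and c2 in T1; hence for n large
   the iterates of c1 under delta2^-n and delta1^n stay hyperbolic in the next
   tree, with a number of edges comparable to their length, and the number of
   occurrences of u in the cyclic word of phi^m c1 is n r (occ u c1 + O(1/n))
   with r independent of u. As phi^m eta_c1 is the counting current of phi^m c1,
   the cylinder masses of mu_+^n, normalized by the total mass of the cylinders
   of letters, are within O(1/n) of those of eta_c1; these masses determine the
   topology. Exchanging the twists gives the statement on mu_-^n. *)

(** * Reduced words *)

(** The obstacle is the iteration. A twist by n multiplies lengths by about n, so an error
    proportional to the length of the next input is harmless only if its number of edges in the
    other tree has grown as much. This is tested with a fixed power p of the other twist d': the
    length of d'^p X is itself quasi-additive in X, so on d^n x it is about n r |d'^p c|, and p is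
    chosen so large that an element crossing few edges of the other tree could not be stretched that
    much. The resulting constant does not depend on the one of the preceding step, which is what
    closes the induction on m. No normal form theorem for splittings is invoked. The universal
    properties give generation, hence expressions that can be reduced cyclically; that a reduced
    product is not a power of c follows by comparing it with its own twist by a large N. The
    estimates compare homogenized counts, which are natural numbers here and do not see additive
    constants. *)

Section WordCombinatorics.
Context {k : nat}.
Implicit Types (a b : letter k) (u v w : seq (letter k)).

Lemma letter_invK : involutive (@letter_inv k).
Proof. by case=> i []. Qed.

Lemma can_followV a b : can_follow (letter_inv b) (letter_inv a) = can_follow a b.
Proof.
rewrite /can_follow; congr (~~ _).
by rewrite (can2_eq letter_invK letter_invK) letter_invK eq_sym (can2_eq letter_invK letter_invK).
Qed.

Lemma can_follow_refl a : can_follow a a.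
Proof. by case: a => i []; rewrite /can_follow /letter_inv /= xpair_eqE eqxx. Qed.

Lemma can_followN a b : ~~ can_follow a b -> b = letter_inv a.
Proof. by rewrite negbK => /eqP. Qed.

Lemma word_invK : involutive (@word_inv k).
Proof.
by move=> w; rewrite /word_inv map_rev revK mapK //; exact: letter_invK.
Qed.

Lemma size_word_inv w : size (word_inv w) = size w.
Proof. by rewrite size_rev size_map. Qed.

Lemma word_inv_cat u v : word_inv (u ++ v) = word_inv v ++ word_inv u.
Proof. by rewrite /word_inv map_cat rev_cat. Qed.

Lemma reducedV w : reduced (word_inv w) = reduced w.
Proof.
rewrite /reduced /word_inv rev_sorted sorted_map.
by apply: eq_sorted => a b /=; rewrite /relpre /= can_followV.
Qed.

Lemma reduced_catl u v : reduced (u ++ v) -> reduced u.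
Proof. by rewrite /reduced; case: u => //= a u; rewrite cat_path => /andP[]. Qed.

Lemma reduced_catr u v : reduced (u ++ v) -> reduced v.
Proof.
rewrite /reduced; case: u => //= a u; rewrite cat_path => /andP[_].
by case: v => //= b v /andP[].
Qed.

Lemma reduced_glue u m v :
  m != [::] -> reduced (u ++ m) -> reduced (m ++ v) -> reduced (u ++ m ++ v).
Proof.
case: m => // b m _; rewrite /reduced.
case: u => //= a u; rewrite !cat_path /= => /andP[-> /andP[-> _]] /=.
by rewrite cat_path.
Qed.

Lemma reduced_cat_lasthead a u b v :
  reduced (rcons u a) -> reduced (b :: v) -> can_follow a b ->
  reduced (rcons u a ++ b :: v).
Proof.
move=> Hu Hv Hab; rewrite cat_rcons -cat1s; apply: reduced_glue => //.
- by rewrite cats1.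
- by move: Hv; rewrite /reduced /= Hab.
Qed.

(** The letters that cancel are peeled off at the seam one at a time, and [p] collects them. Through
    [nf_mul], cancellation arguments in the group start from this triple. *)
Lemma reduced_cancel u v : reduced u -> reduced v ->
  exists p u' v', [/\ u = u' ++ p, v = word_inv p ++ v' & reduced (u' ++ v')].
Proof.
elim/last_ind: u v => [|u a IH] v Hu Hv.
  by exists [::], [::], v.
case: v Hv => [|b v] Hv.
  by exists [::], (rcons u a), [::]; rewrite cats0.
have [Hab|/can_followN Hab] := boolP (can_follow a b).
  by exists [::], (rcons u a), (b :: v); split; rewrite ?cats0 //;
     exact: reduced_cat_lasthead.
have Hu' : reduced u by apply: (@reduced_catl _ [:: a]); rewrite cats1.
have Hv' : reduced v by apply: (@reduced_catr [:: b]).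
have [p [u' [v' [-> -> Huv]]]] := IH v Hu' Hv'.
exists (rcons p a), u', v'; split=> //; first by rewrite rcons_cat.
by rewrite Hab /word_inv map_rcons rev_rcons.
Qed.

Fixpoint wpow w n : seq (letter k) := if n is n'.+1 then w ++ wpow w n' else [::].

Lemma size_wpow w n : size (wpow w n) = (n * size w)%N.
Proof. by elim: n => //= n IH; rewrite size_cat IH mulSn. Qed.

Lemma wpowD w m n : wpow w (m + n) = wpow w m ++ wpow w n.
Proof. by elim: m => //= m ->; rewrite catA. Qed.

Lemma wpow1 w : wpow w 1 = w.
Proof. exact: cats0. Qed.

Lemma wpowSr w n : wpow w n.+1 = wpow w n ++ w.
Proof. by rewrite -addn1 wpowD /= cats0. Qed.

Lemma word_inv_wpow w n : word_inv (wpow w n) = wpow (word_inv w) n.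
Proof. by elim: n => //= n IH; rewrite word_inv_cat IH -wpowSr. Qed.

(** Doubling the word turns the cyclic condition into one on linear words, to which [reduced_glue]
    applies. *)
Lemma cyc_reducedE w : cyc_reduced w = reduced (w ++ w).
Proof.
case: w => // a w; rewrite /cyc_reduced /reduced /= rcons_path cat_path /=.
by case: (path _ a w); rewrite //= andbT.
Qed.

Lemma cyc_reducedV w : cyc_reduced (word_inv w) = cyc_reduced w.
Proof. by rewrite !cyc_reducedE -word_inv_cat reducedV. Qed.

Lemma cyc_reduced_reduced w : cyc_reduced w -> reduced w.
Proof. by rewrite cyc_reducedE => /reduced_catl. Qed.

Lemma reduced_wpow w n : cyc_reduced w -> reduced (wpow w n).
Proof.
case: w => [|a w] H; first by elim: n.
elim: n => // -[|n] IH; first by rewrite wpow1 cyc_reduced_reduced.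
have -> : n.+2 = (1 + (1 + n))%N by [].
rewrite !wpowD wpow1; apply: reduced_glue => //; by rewrite -cyc_reducedE.
Qed.

(** The Euclidean algorithm on the lengths: the shorter word is a prefix of the longer one, and what
    remains of the longer still commutes with it. *)
Lemma comm_words u v : u ++ v = v ++ u ->
  exists z i j, u = wpow z i /\ v = wpow z j.
Proof.
have [n] := ubnP (size u + size v); elim: n u v => // n IH u v ltn E.
wlog lesz : u v ltn E / size u <= size v.
  move=> W; case: (leqP (size u) (size v)) => [|/ltnW] le; first exact: W.
  by have [|z [i [j [-> ->]]]] := W v u _ (esym E) le; [rewrite addnC|exists z, j, i].
case: u E ltn lesz => [|a u] E ltn lesz.
  by exists v, 0%N, 1%N; rewrite /= cats0.
have Ev : v = (a :: u) ++ drop (size (a :: u)) v.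
  have := congr1 (take (size (a :: u))) E.
  rewrite take_size_cat // takel_cat // => Eu.
  by rewrite {1}Eu cat_take_drop.
set v' := drop _ v in Ev.
have E' : (a :: u) ++ v' = v' ++ (a :: u).
  move: E; rewrite Ev -catA => /eqP; rewrite eqseq_cat // => /andP[_ /eqP //].
have [|z [i [j [E1 E2]]]] := IH _ _ _ E'.
  by move: ltn; rewrite Ev size_cat /=; lia.
by exists z, i, (i + j)%N; rewrite wpowD -E1 -E2.
Qed.

End WordCombinatorics.

(** * Integer powers *)

Section IntegerPowers.
Context {F : groupType}.
Implicit Types (c g h : F) (m n : int).

Definition zpow c n : F := match n with Posz i => c ^+ i | Negz i => c ^- i.+1 end.

Lemma zpow0 c : zpow c 0 = 1. Proof. by []. Qed.
Lemma zpow1 c : zpow c 1 = c. Proof. exact: expg1. Qed.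

Lemma zpowN c n : zpow c (- n)%R = (zpow c n)^-1.
Proof. by case: n => [[|n]|n] /=; rewrite ?invg1 ?invgK. Qed.

Lemma zpowS c n : zpow c (n + 1)%R = zpow c n * c.
Proof.
case: n => [n|[|n]].
- have -> : (Posz n + 1 = Posz n.+1)%R by lia.
  exact: expgSr.
- by rewrite /= mulVg.
- have -> : (Negz n.+1 + 1 = Negz n)%R by lia.
  by rewrite /= (expgS c n.+1) invgM mulgVK.
Qed.

Lemma zpowD c m n : zpow c (m + n)%R = zpow c m * zpow c n.
Proof.
have pos x (i : nat) : zpow c (x + Posz i)%R = zpow c x * zpow c i.
  elim: i => [|i IH]; first by rewrite GRing.addr0 mulg1.
  have -> : (x + i.+1 = (x + i) + 1)%R by lia.
  have -> : (Posz i.+1 = Posz i + 1)%R by lia.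
  by rewrite !zpowS IH mulgA.
case: n => i; first exact: pos.
apply: (mulIg (zpow c (Posz i.+1))); rewrite -pos NegzE GRing.subrK zpowN.
by rewrite -mulgA mulVg mulg1.
Qed.

End IntegerPowers.

(** * Normal forms, torsion and centralizers in a free group *)

Section FreeGroup.
Context {F : groupType} {k : nat} {A : 'I_k.+2 -> F} (A_basis : is_basis A).
Implicit Types (g h x y z : F) (u v w : seq (letter k)).
Local Notation wv := (word_val A).

Lemma word_val_cat u v : wv (u ++ v) = wv u * wv v.
Proof. by elim: u => [|a u IH] /=; rewrite ?mul1g // IH mulgA. Qed.

Lemma letter_valV (a : letter k) : letter_val A (letter_inv a) = (letter_val A a)^-1.
Proof. by case: a => i []; rewrite /letter_val //= invgK. Qed.

Lemma word_valV w : wv (word_inv w) = (wv w)^-1.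
Proof.
elim: w => [|a w IH]; first by rewrite invg1.
by rewrite -cat1s word_inv_cat !word_val_cat IH invgM /= !mulg1 letter_valV.
Qed.

Lemma word_val_wpow w n : wv (wpow w n) = wv w ^+ n.
Proof. by elim: n => //= n IH; rewrite word_val_cat IH expgS. Qed.

Definition nf g := sval (cid (A_basis g)).
Definition len g := size (nf g).

Lemma lenE g : len g = size (nf g). Proof. by []. Qed.

Lemma nf_reduced g : reduced (nf g).
Proof. by rewrite /nf; case: cid => w [[]]. Qed.

Lemma nfK g : wv (nf g) = g.
Proof. by rewrite /nf; case: cid => w [[]]. Qed.

Lemma nf_val w : reduced w -> nf (wv w) = w.
Proof. by move=> rw; rewrite /nf; case: cid => w' [H U] /=; apply: U. Qed.

Lemma nf1 : nf 1 = [::]. Proof. exact: (@nf_val [::]). Qed.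

Lemma nf_inj : injective nf.
Proof. by move=> g h E; rewrite -(nfK g) E nfK. Qed.

Lemma nfV g : nf g^-1 = word_inv (nf g).
Proof. by rewrite -{1}(nfK g) -word_valV nf_val // reducedV nf_reduced. Qed.

Lemma lenV g : len g^-1 = len g.
Proof. by rewrite /len nfV size_word_inv. Qed.

Lemma len1 : len 1 = 0%N. Proof. by rewrite /len nf1. Qed.

Lemma nf_mul g h : exists p u v,
  [/\ nf g = u ++ p, nf h = word_inv p ++ v & nf (g * h) = u ++ v].
Proof.
have [p [u [v [Eg Eh ruv]]]] := reduced_cancel (nf_reduced g) (nf_reduced h).
exists p, u, v; split=> //; rewrite -(nf_val ruv); congr nf.
rewrite -[in LHS](nfK g) -[in LHS](nfK h) Eg Eh !word_val_cat word_valV.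
by rewrite -!mulgA mulVKg.
Qed.

Lemma lenM g h : len (g * h) <= len g + len h.
Proof.
have [p [u [v [Eg Eh E]]]] := nf_mul g h.
by rewrite /len Eg Eh E !size_cat; lia.
Qed.

Lemma len_val w : len (wv w) <= size w.
Proof.
elim: w => [|a w IH] /=; first by rewrite len1.
apply: leq_trans (lenM _ _) _; rewrite -add1n leq_add //.
have -> : letter_val A a = wv [:: a] by rewrite /= mulg1.
by rewrite /len nf_val.
Qed.

Lemma lenMl g h : len h <= len (g * h) + len g.
Proof. by have := lenM g^-1 (g * h); rewrite mulKg lenV; lia. Qed.

Lemma lenX g n : len (g ^+ n) <= n * len g.
Proof.
elim: n => [|n IH]; first by rewrite len1.
by rewrite expgS mulSn; apply: leq_trans (lenM _ _) _; rewrite leq_add2l.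
Qed.

(** As long as the first and the last letter of the word cancel around the cycle, they are
    conjugated away, which shortens the word by two letters. *)
Lemma cyc_conj g : exists z w,
  [/\ cyc_reduced w, g = z * wv w * z^-1 & size w <= len g].
Proof.
have [n] := ubnP (len g); elim: n g => // n IH g ltn.
have [cw|ncw] := boolP (cyc_reduced (nf g)).
  by exists 1, (nf g); rewrite mul1g invg1 mulg1 nfK.
case E : (nf g) ncw => [|a w] // ncw.
case: (lastP w) E ncw => [|w' b] E ncw.
  by move: ncw; rewrite /cyc_reduced /= can_follow_refl.
have rg := nf_reduced g; rewrite E in rg.
have Eb : a = letter_inv b.
  apply: can_followN; apply: contra ncw => ab.
  rewrite /cyc_reduced /= rcons_path last_rcons ab andbT.
  by move: rg; rewrite /reduced.
have Eg : g = (letter_val A b)^-1 * wv w' * letter_val A b.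
  rewrite -(nfK g) E -cat1s -cats1 !word_val_cat /= !mulg1 Eb letter_valV.
  by rewrite mulgA.
have lw' : len (wv w') = size w'.
  rewrite /len nf_val //; apply: (@reduced_catr _ [:: a]).
  by apply: (@reduced_catl _ _ [:: b]); rewrite cat1s cat_cons cats1.
clear w; have [|z [w [cw Ew sw]]] := IH (wv w').
  by move: ltn; rewrite lw' /len E /= size_rcons; lia.
exists ((letter_val A b)^-1 * z), w; split=> //.
  by rewrite {1}Eg Ew invgM invgK !mulgA.
by rewrite /len E /= size_rcons; move: sw; rewrite lw'; lia.
Qed.

Lemma expg_conj z x n : (z * x * z^-1) ^+ n = z * x ^+ n * z^-1.
Proof.
elim: n => [|n IH]; first by rewrite mulg1 mulgV.
by rewrite !expgS IH !mulgA mulgVK.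
Qed.

(** For a cyclically reduced conjugate the powers are literal concatenations, so that lengths are
    multiplied by [n]. *)
Lemma expg_eq1 g n : (0 < n)%N -> g ^+ n = 1 -> g = 1.
Proof.
have [z [w [cw -> _]]] := cyc_conj g => n0; rewrite expg_conj => /divg1_eq.
rewrite -[RHS]mulg1 => /mulgI; rewrite -word_val_wpow => /(congr1 nf).
rewrite nf1 nf_val ?reduced_wpow // => /(congr1 size); rewrite size_wpow /=.
case: w cw => [|a w] _; last by case: n n0.
by rewrite mulg1 mulgV.
Qed.

(* The centralizer argument: for N large, the reduced words of g c^N and c^N g
   end, resp. begin, with C, so that they commute with C as words. *)
Section Root.
Context {C : seq (letter k)} (C_cyc : cyc_reduced C).
Context (C_prim : not_proper_power (wv C)).
Local Notation c := (wv C).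
Local Notation l := (size C).

Lemma root_neq1 : c <> 1.
Proof. by move=> E; have := C_prim (n := 2) (g := 1); rewrite expg1n => /(_ E). Qed.

Lemma root_size : (0 < l)%N.
Proof. by case: C root_neq1 => // []. Qed.

Lemma commute_root g : g * c = c * g -> exists m, g = zpow c m.
Proof.
(* At most [len g] letters cancel between [g] and a power of [c]; the extra period survives at each
   end. *)
move=> gc; set N := (len g).+1.
have gcN n : g * c ^+ n = c ^+ n * g by apply/commuteX.
have l0 := root_size.
have nfX n : nf (c ^+ n) = wpow C n by rewrite -word_val_wpow nf_val ?reduced_wpow.
have [W0 EW0] : exists W0, nf (g * c ^+ N) = W0 ++ C.
  have [p [u [v [Eg Eh ->]]]] := nf_mul g (c ^+ N).
  rewrite nfX wpowSr in Eh.
  have sp : size (word_inv p) <= size (wpow C (len g)).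
    by rewrite size_word_inv size_wpow /len Eg size_cat; nia.
  exists (u ++ drop (size (word_inv p)) (wpow C (len g))).
  move/(congr1 (drop (size (word_inv p)))): Eh; rewrite (drop_size_cat v erefl) => <-.
  by rewrite -catA drop_cat; case: ltngtP sp => // E _; rewrite ?E ?subnn ?drop0 ?drop_size.
have [W1 EW1] : exists W1, nf (g * c ^+ N) = C ++ W1.
  rewrite gcN; have [p [u [v [Eg Eh ->]]]] := nf_mul (c ^+ N) g.
  rewrite nfX in Eg.
  have su : l <= size u.
    have := congr1 size Eg; rewrite size_wpow size_cat.
    have := congr1 size Eh; rewrite size_cat size_word_inv -/(len g) /N; nia.
  move: Eg; rewrite /N /= => /(congr1 (take l)); rewrite take_size_cat // takel_cat // => Ec.
  by exists (drop l u ++ v); rewrite -[in LHS](cat_take_drop l u) -Ec catA.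
have CC : reduced (C ++ C) by rewrite -cyc_reducedE.
have Cn : C != [::] by rewrite -size_eq0 -lt0n.
have rWC : reduced (nf (g * c ^+ N) ++ C).
  by rewrite EW0 -catA; apply: reduced_glue => //; rewrite -EW0 nf_reduced.
have rCW : reduced (C ++ nf (g * c ^+ N)).
  by rewrite EW1; apply: reduced_glue => //; rewrite -EW1 nf_reduced.
have : nf (g * c ^+ N) ++ C = C ++ nf (g * c ^+ N).
  rewrite -[LHS]nf_val // -[RHS]nf_val //; congr nf.
  by rewrite !word_val_cat nfK mulgA -gc -!mulgA -expgSr -expgS.
move=> /comm_words[z [i [j [EW EC]]]].
have j1 : j = 1%N.
  have := C_prim (n := j) (g := wv z); rewrite -word_val_wpow -EC => /(_ erefl).
  by case: j EC => [EC|[]] //; move: Cn; rewrite EC.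
have Eg : g * c ^+ N = c ^+ i.
  by rewrite -[LHS]nfK EW word_val_wpow; congr (wv _ ^+ _); rewrite EC j1 wpow1.
exists (Posz i - Posz N)%R; rewrite zpowD zpowN /= -Eg.
by rewrite mulgK.
Qed.

(** The square of such a [g] would commute with [c], hence be some c^m. Conjugation by [g] fixes
    this square and inverts c^m, so g^2 = 1; then g = 1 by absence of torsion, and c = c^-1 is
    impossible. *)
Lemma root_conjV g : g * c * g^-1 <> c^-1.
Proof.
move=> E; have gc : g * c = c^-1 * g by rewrite -E mulgVK.
have gcV : g * c^-1 = c * g.
  by apply: (mulIg c); rewrite mulgVK -mulgA gc mulVKg.
have [|m Em] := @commute_root (g * g).
  by rewrite -mulgA gc mulgA gcV mulgA.
have Em' : g * zpow c m * g^-1 = zpow c (- m)%R.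
  have X n : g * c ^+ n * g^-1 = c ^- n by rewrite -expg_conj E expVgn.
  case: m {Em} => n; first by rewrite zpowN /= X.
  rewrite NegzE GRing.opprK zpowN /=; apply: invg_inj.
  by rewrite !invgM !invgK mulgA X.
have : zpow c m = zpow c (- m)%R by rewrite -Em' -Em mulgA mulgK.
move=> E2; have : zpow c (m + m)%R = 1 by rewrite zpowD {2}E2 zpowN mulgV.
have g1 : g <> 1 by move=> g1; move: E; rewrite g1 mul1g invg1 mulg1 => E;
  apply: root_neq1; apply: (@expg_eq1 _ 2) => //; rewrite expg2 {1}E mulVg.
move=> Emm; apply: g1; apply: (@expg_eq1 _ 2) => //; rewrite expg2 Em.
case: m {Em Em' E2} Emm => [[|n]|n] // .
- have -> : (Posz n.+1 + n.+1 = Posz (n.+1 + n.+1))%R by lia.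
  by move=> /expg_eq1 => /(_ isT) /root_neq1.
- have -> : (Negz n + Negz n = - Posz (n.+1 + n.+1))%R by lia.
  by rewrite zpowN => /(congr1 (fun x => x^-1)) /=; rewrite invgK invg1 => /expg_eq1 => /(_ isT) /root_neq1.
Qed.

Definition in_root g := exists m, g = zpow c m.

Lemma in_rootV g : in_root g -> in_root g^-1.
Proof. by move=> [m ->]; exists (- m)%R; rewrite zpowN. Qed.

(* The booleans e stand for the signs of exponents of C. *)
Definition csig (e : bool) := if e then c else c^-1.
Definition Cw (e : bool) := if e then C else word_inv C.

Lemma wv_Cw e : wv (Cw e) = csig e.
Proof. by case: e; rewrite //= word_valV. Qed.

Lemma size_Cw e : size (Cw e) = l.
Proof. by case: e; rewrite //= size_word_inv. Qed.

Lemma Cw_neq0 e : Cw e != [::].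
Proof. by rewrite -size_eq0 size_Cw -lt0n root_size. Qed.

Lemma Cw_cyc e : cyc_reduced (Cw e).
Proof. by case: e; rewrite /= ?cyc_reducedV. Qed.

Lemma word_inv_Cw e : word_inv (Cw e) = Cw (~~ e).
Proof. by case: e; rewrite //= word_invK. Qed.

Lemma csigV e : (csig e)^-1 = csig (~~ e).
Proof. by case: e; rewrite //= invgK. Qed.

Lemma root_conj g e e' : g * csig e' * g^-1 = csig e -> in_root g.
Proof.
have comm : g * c * g^-1 = c -> in_root g.
  by move=> E; apply: commute_root; rewrite -{2}E mulgVK.
case: e e' => [] [] /=.
- exact: comm.
- by move/(congr1 (fun x => x^-1)) => /=; rewrite !invgM !invgK mulgA => /root_conjV.
- by move/root_conjV.
- by move/(congr1 (fun x => x^-1)) => /=; rewrite !invgM !invgK mulgA; exact: comm.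
Qed.

Lemma nf_csigX e i : nf (csig e ^+ i) = wpow (Cw e) i.
Proof. by rewrite -wv_Cw -word_val_wpow nf_val // reduced_wpow // Cw_cyc. Qed.

Lemma csig_zpow e i : csig e ^+ i = zpow c (if e then Posz i else - Posz i)%R.
Proof. by case: e; rewrite ?zpowN //= expVgn. Qed.

End Root.

End FreeGroup.

(** * Bounded cancellation between powers of a root *)

Section Tight.
Context {F : groupType} {k : nat} {A : 'I_k.+2 -> F} (A_basis : is_basis A).
Implicit Types (g h x y z : F) (u v w : seq (letter k)) (e : bool).
Local Notation wv := (word_val A).
Local Notation nf := (nf A_basis).
Local Notation len := (len A_basis).

(* A translate of the D'-axis that follows the D-axis for a whole period (past
   the first len g letters) is the D-axis, with the periods matching. *)
Lemma fellow_travel g (D D' : seq (letter k)) j : size D = size D' -> D != [::] ->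
  prefix (wpow D (len g).+1) (nf (g * wv (wpow D' j))) ->
  cyc_reduced D' -> g * wv D' * g^-1 = wv D.
Proof.
move=> sD Dn pre cD'; set t := len g in pre *.
have lD : (0 < size D)%N by rewrite lt0n size_eq0.
have [p [u [v [Eg Eh E]]]] := nf_mul A_basis g (wv (wpow D' j)).
move: pre; rewrite E => /prefixP[s Es].
rewrite nf_val ?reduced_wpow // in Eh.
have su : size u <= size (wpow D t).
  have st : size u <= t by rewrite /t /len Eg size_cat leq_addr.
  by rewrite size_wpow; apply: leq_trans st _; rewrite leq_pmulr.
rewrite wpowSr -catA in Es.
have Eu : u = take (size u) (wpow D t).
  by have := congr1 (take (size u)) Es; rewrite (take_size_cat v erefl) (takel_cat _ su).
set x := drop (size u) (wpow D t).
have Ex : wpow D t = u ++ x by rewrite /x {1}Eu cat_take_drop.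
have Ev : v = x ++ D ++ s.
  by move: Es; rewrite Ex -catA => /eqP; rewrite eqseq_cat // => /andP[_ /eqP].
set y := word_inv p ++ x.
have Ey : wpow D' j = y ++ D ++ s by rewrite Eh Ev /y catA.
case: j Ey {Eh E} => [|j] Ey.
  by have := congr1 size Ey; rewrite !size_cat /=; lia.
have sy : size y <= size (wpow D' j).
  by have := congr1 size Ey; rewrite !size_cat !size_wpow; nia.
have Eyt : y = take (size y) (wpow D' j).
  by have := congr1 (take (size y)) Ey; rewrite wpowSr takel_cat // take_size_cat.
have EyD : y ++ D = D' ++ y.
  have := congr1 (take (size D' + size y)) Ey.
  rewrite /= takeD take_size_cat // drop_size_cat // -Eyt => ->.
  by rewrite addnC -sD -size_cat catA take_size_cat.
have gy : g * wv y = wv D ^+ t.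
  by rewrite -word_val_wpow Ex -(nfK A_basis g) Eg !word_val_cat word_valV -!mulgA mulVKg.
have E1 : wv D ^+ t.+1 = g * wv D' * wv y.
  by rewrite -mulgA -word_val_cat -EyD word_val_cat mulgA gy expgSr.
move: E1; rewrite expgS -gy mulgA => /mulIg <-.
by rewrite mulgK.
Qed.

Section Root.
Context {C : seq (letter k)} (C_cyc : cyc_reduced C).
Context (C_prim : not_proper_power (wv C)).
Local Notation l := (size C).
Local Notation in_root := (@in_root F k A C).
Local Notation csig := (@csig F k A C).
Local Notation Cw := (@Cw k C).

(** No period of [C] or of its inverse can be stripped from either end of [g]. Powers of [c] placed
    next to [g] then cancel only boundedly, unless [g] itself is a power of [c]. *)
Definition tight g :=
  forall e, ~~ prefix (Cw e) (nf g) /\ ~~ suffix (Cw e) (nf g).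

Lemma suffix_Cw_inv e w : suffix (Cw e) (word_inv w) = prefix (Cw (~~ e)) w.
Proof.
apply/suffixP/prefixP => -[s Es].
  by exists (word_inv s); rewrite -(word_invK w) Es word_inv_cat word_inv_Cw.
by exists (word_inv s); rewrite Es word_inv_cat word_inv_Cw negbK.
Qed.

Lemma prefix_Cw_inv e w : prefix (Cw e) (word_inv w) = suffix (Cw (~~ e)) w.
Proof. by rewrite -(word_invK w) suffix_Cw_inv negbK word_invK. Qed.

Lemma tightV g : tight g -> tight g^-1.
Proof.
move=> tg e; rewrite nfV prefix_Cw_inv suffix_Cw_inv.
by split; case: (tg (~~ e)).
Qed.

Lemma in_rootV' g : ~ in_root g -> ~ in_root g^-1.
Proof. by move=> ng /in_rootV; rewrite invgK. Qed.

(** [cancel_bound] allows the loss of 2 l^2 letters, that is of 2 l periods, at one end of a power;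
    one more period is to survive. *)
Definition margin := (2 * l).+1.

(** If [g] is short, a longer cancellation makes the axis of [C] and its translate by [g] run
    together for [(len g).+1] periods, and [fellow_travel] makes [g] a power of [c]. If [g] is long,
    tightness on the right leaves at least [l] initial letters of [g] intact, and the power on the
    left would cancel a whole period among them, against tightness on the left. *)
Lemma cancel_bound g e e' i j p u v : tight g -> ~ in_root g ->
  nf (csig e ^+ i) = u ++ p ->
  nf (g * csig e' ^+ j) = word_inv p ++ v -> size p <= 2 * l * l.
Proof.
move=> tg ng Ei Ej.
have l0 := root_size C_prim.
have [//|ltp] := leqP (size p) (2 * l * l).
rewrite nf_csigX // in Ei.
have Ep n : (n * l <= size p)%N -> prefix (wpow (Cw (~~ e)) n) (word_inv p).
  move=> ln; rewrite prefixE size_wpow size_Cw.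
  have := congr1 (@word_inv k) Ei; rewrite word_inv_wpow word_inv_Cw word_inv_cat.
  move=> /(congr1 (take (n * l))); rewrite (takel_cat _ (s1 := word_inv p)) ?size_word_inv // => <-.
  have ni : (n <= i)%N.
    have := congr1 size Ei; rewrite size_wpow size_Cw size_cat; nia.
  by rewrite -(subnKC ni) wpowD take_size_cat // size_wpow size_Cw.
have [lg|lg] := ltnP (len g) (2 * l).
  exfalso; apply: ng; apply: (@root_conj _ _ _ A_basis C C_cyc C_prim g (~~ e) e').
  rewrite -!wv_Cw; apply: (@fellow_travel g _ _ j); rewrite ?size_Cw ?Cw_cyc //.
    exact: (@Cw_neq0 _ _ A).
  rewrite word_val_wpow wv_Cw Ej; apply: prefix_catl; apply: Ep; nia.
have [q [u' [v' [Eg Eh E]]]] := nf_mul A_basis g (csig e' ^+ j).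
rewrite nf_csigX // in Eh.
have lq : (size q < l)%N.
  rewrite ltnNge; apply/negP => lq; case: (tg (~~ e')) => _ /negP; apply.
  rewrite Eg; apply: suffix_trans (suffix_suffix _ _).
  rewrite -(word_invK q) suffix_Cw_inv negbK prefixE size_Cw.
  have lj : (0 < j)%N.
    by have := congr1 size Eh; rewrite size_wpow size_cat size_word_inv; nia.
  move: Eh; rewrite -(prednK lj) /= => /(congr1 (take l)).
  rewrite take_size_cat ?size_Cw // => ->.
  by rewrite takel_cat // size_word_inv.
case: (tg (~~ e)) => /negP[]; rewrite Eg.
apply: prefix_catl; rewrite prefixE size_Cw.
have su' : l <= size u' by have := congr1 size Eg; rewrite -/(len g) size_cat; nia.
have : prefix (wpow (Cw (~~ e)) 1) (u' ++ v').
  by rewrite -E Ej; apply: prefix_catl; apply: Ep; nia.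
by rewrite wpow1 prefixE size_Cw takel_cat.
Qed.

Lemma tight_prefix g e e' i j : tight g -> ~ in_root g -> (margin <= i)%N ->
  prefix (Cw e) (nf (csig e ^+ i * (g * csig e' ^+ j))).
Proof.
move=> tg ng li; have l0 := root_size C_prim.
have [p [u [v [Ei Ej ->]]]] := nf_mul A_basis (csig e ^+ i) (g * csig e' ^+ j).
have lp := cancel_bound tg ng Ei Ej.
apply: prefix_catl; rewrite nf_csigX // in Ei.
have lu : l <= size u.
  have := congr1 size Ei; rewrite size_wpow size_Cw size_cat; rewrite /margin in li; nia.
rewrite prefixE size_Cw -(takel_cat p lu) -Ei.
by case: i li {Ei} => //= i _; rewrite take_size_cat ?size_Cw.
Qed.

(** The periods that survive at both ends are what allows consecutive products of this kind to be
    glued without cancellation. The end follows from the beginning by inversion. *)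
Lemma tight_ends g e e' i j : tight g -> ~ in_root g ->
  (margin <= i)%N -> (margin <= j)%N ->
  prefix (Cw e) (nf (csig e ^+ i * g * csig e' ^+ j)) /\
  suffix (Cw e') (nf (csig e ^+ i * g * csig e' ^+ j)).
Proof.
move=> tg ng li lj; split; first by rewrite -mulgA tight_prefix.
have -> : csig e ^+ i * g * csig e' ^+ j =
  (csig (~~ e') ^+ j * (g^-1 * csig (~~ e) ^+ i))^-1.
  by rewrite !invgM -!expVgn !csigV !negbK invgK.
rewrite nfV suffix_Cw_inv; apply: tight_prefix => //; first exact: tightV.
exact: in_rootV'.
Qed.

End Root.
End Tight.

(** * Homogenization *)

Section QuasiAdditive.
Context {F : groupType} {k : nat} {A : 'I_k.+2 -> F} (A_basis : is_basis A).
Implicit Types (g h x y z : F) (L : F -> nat).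
Local Notation len := (len A_basis).

(** Additivity is required only up to a constant and only for products without cancellation. This
    covers word length, the count of a subword, and word length composed with an automorphism. *)
Definition quasi_add L (B : nat) :=
  (forall g, L g^-1 = L g) /\
  forall g h, len (g * h) = (len g + len h)%N ->
    (L (g * h)%g <= L g + L h + B)%N /\ (L g + L h <= L (g * h)%g + B)%N.

(** One letter at a time: appending a letter is controlled by quasi-additivity, and if the letter
    cancels, the same inequality is read backwards. *)
Lemma quasi_add_lip L B : quasi_add L B ->
  exists K, forall g h, (L (g * h)%g <= L g + K * len h)%N /\
                        (L g <= L (g * h)%g + K * len h)%N.
Proof.
move=> [LV qa]; pose K := (B + \max_(a : letter k) L (letter_val A a))%N.
have letterK (a : letter k) : (L (letter_val A a) + B <= K)%N.
  by rewrite /K addnC leq_add2l (leq_bigmax a).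
have nfa (a : letter k) : nf A_basis (letter_val A a) = [:: a].
  by rewrite -[RHS](nf_val A_basis) //= mulg1.
have step g (a : letter k) : (L (g * letter_val A a)%g <= L g + K)%N /\
                 (L g <= L (g * letter_val A a)%g + K)%N.
  have [p [u [v [Eg Ea E]]]] := nf_mul A_basis g (letter_val A a).
  have Ka := letterK a.
  case: p Eg Ea => [|b p] Eg Ea.
    have [] := qa g (letter_val A a); last by lia.
    by rewrite /len E Ea Eg !size_cat addn0.
  have Es := congr1 size Ea; rewrite nfa !size_cat size_word_inv /= in Es.
  have v0 : v = [::] by case: v Es {Ea E} => //= b' v'; lia.
  have [] := qa (g * letter_val A a)%g (letter_val A a)^-1; last by rewrite mulgK LV; lia.
  by rewrite mulgK lenV /len E Eg nfa v0 cats0 size_cat /=; lia.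
exists K => g h; rewrite -{1 3}(nfK A_basis h) /len.
elim: (nf A_basis h) g => [|a w IH] g /=; first by rewrite mulg1 muln0 addn0.
rewrite mulgA; have [] := step g a; have [] := IH (g * letter_val A a)%g.
move=> h1 h2 h3 h4; rewrite mulnS; split.
  by apply: leq_trans h1 _; rewrite addnA leq_add2r.
apply: leq_trans h4 _; rewrite [(K + _)%N]addnC addnA leq_add2r //.
Qed.

Definition conj x y := exists z, y = z * x * z^-1.

Lemma conj_refl x : conj x x.
Proof. by exists 1; rewrite mul1g invg1 mulg1. Qed.

Lemma conj_sym x y : conj x y -> conj y x.
Proof. by move=> [z ->]; exists z^-1; rewrite invgK !mulgA mulVg mul1g mulgVK. Qed.

Lemma conj_trans y x z : conj x y -> conj y z -> conj x z.
Proof. by move=> [a ->] [b ->]; exists (b * a); rewrite invgM !mulgA. Qed.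

Lemma conj_rot x y : conj (x * y) (y * x).
Proof. by exists y; rewrite !mulgA mulgK. Qed.

(* lam is lim L (g ^+ m) / m, with an error O(1/m). *)
Definition homog L g (lam : nat) := exists D : nat, forall m : nat,
  (L (g ^+ m)%g <= m * lam + D)%N /\ (m * lam <= L (g ^+ m)%g + D)%N.

Lemma quasi_add_conj L B : quasi_add L B -> exists K, forall z x,
  (L (z * x * z^-1)%g <= L x + K * len z)%N /\ (L x <= L (z * x * z^-1)%g + K * len z)%N.
Proof.
move=> qa; have [K HK] := quasi_add_lip qa; have [LV _] := qa; exists (2 * K)%N => z x.
have [h1 h2] := HK (z * x) z^-1; have [h3 h4] := HK x^-1 z^-1.
rewrite -invgM !LV !lenV in h1 h2 h3 h4.
rewrite -mulnA mul2n -addnn; split.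
  apply: leq_trans h1 _; rewrite addnA leq_add2r //.
by apply: leq_trans h4 _; rewrite addnA leq_add2r.
Qed.

Lemma homog_conj L B x y lam : quasi_add L B -> conj x y -> homog L x lam ->
  homog L y lam.
Proof.
move=> qa [z ->] [D HD]; have [K HK] := quasi_add_conj qa.
exists (D + K * len z)%N => m; rewrite expg_conj.
have [h1 h2] := HK z (x ^+ m); have [h3 h4] := HD m; lia.
Qed.

Lemma homogX L x lam n : homog L x lam -> homog L (x ^+ n) (n * lam).
Proof.
move=> [D HD]; exists D => m; have := HD (n * m)%N.
by rewrite expgnA mulnA (mulnC n m).
Qed.

Lemma linear_le (a b D : nat) : (forall m : nat, (m * a <= m * b + D)%N) -> (a <= b)%N.
Proof. by move=> /(_ D.+1) H; rewrite leqNgt; apply/negP => ?; nia. Qed.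

(** Both sides grow linearly in [m], so the constant terms drop out and only the slopes are
    compared. *)
Lemma homog_close L x mu S E D : homog L x mu ->
  (forall m : nat, (L (x ^+ m)%g <= m * S + m * E + D)%N /\
                   (m * S <= L (x ^+ m)%g + m * E + D)%N) ->
  (mu <= S + E)%N /\ (S <= mu + E)%N.
Proof.
move=> [D' HD'] HS; split; apply: (@linear_le _ _ (D + D')) => m;
  have [h1 h2] := HD' m; have [h3 h4] := HS m; rewrite mulnDr; lia.
Qed.

Lemma homog_uniq L x lam mu : homog L x lam -> homog L x mu -> lam = mu.
Proof.
move=> h1 [D h2].
have [|] := @homog_close L x lam mu 0 D h1; last by lia.
by move=> m; have := h2 m; rewrite muln0; lia.
Qed.

Lemma quasi_add_len : quasi_add len 0.
Proof. by split=> [g|g h ->]; [exact: lenV|rewrite addn0]. Qed.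

Lemma homog_len w : cyc_reduced w -> homog len (word_val A w) (size w).
Proof.
move=> cw; exists 0%N => m.
by rewrite -word_val_wpow /len nf_val ?reduced_wpow // size_wpow !addn0.
Qed.

End QuasiAdditive.

(** * Products of powers of c *)

Section Core.
Context {F : groupType} {k : nat} {A : 'I_k.+2 -> F} (A_basis : is_basis A).
Implicit Types (g h x y z : F) (u v w : seq (letter k)) (e : bool).
Local Notation wv := (word_val A).
Local Notation nf := (nf A_basis).
Local Notation len := (len A_basis).

(* A list [:: (g_1, m_1); ...; (g_r, m_r)] stands for the product
   g_1 c^m_1 ... g_r c^m_r. *)
Local Notation block := (F * int)%type.
Implicit Types (s : seq block).

Definition block_val c s : F := foldr (fun p x => p.1 * zpow c p.2 * x) 1 s.
Definition block_len s : nat := sumn [seq len p.1 | p <- s].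
Definition block_exp s : nat := sumn [seq `|p.2|%N | p <- s].

Lemma block_val_cons c p s : block_val c (p :: s) = p.1 * zpow c p.2 * block_val c s.
Proof. by []. Qed.

Lemma block_val_cat c s1 s2 :
  block_val c (s1 ++ s2) = block_val c s1 * block_val c s2.
Proof. by elim: s1 => [|p s1 IH] /=; rewrite ?mul1g // IH !mulgA. Qed.

Lemma block_len_cat s1 s2 : block_len (s1 ++ s2) = (block_len s1 + block_len s2)%N.
Proof. by rewrite /block_len map_cat sumn_cat. Qed.

Lemma block_exp_cat s1 s2 : block_exp (s1 ++ s2) = (block_exp s1 + block_exp s2)%N.
Proof. by rewrite /block_exp map_cat sumn_cat. Qed.

Section Root.
Context {C : seq (letter k)} (C_cyc : cyc_reduced C).
Context (C_prim : not_proper_power (wv C)).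
Local Notation c := (wv C).
Local Notation l := (size C).
Local Notation in_root := (@in_root F k A C).
Local Notation csig := (@csig F k A C).
Local Notation Cw := (@Cw k C).
Local Notation tight := (@tight F k A A_basis C).
Local Notation margin := (@margin k C).
Local Notation threshold := (2 * margin)%N.

Section Estimate.
Context {L : F -> nat} {B : nat} (qaL : quasi_add A_basis L B).
Context {lam : nat} (homL : homog L c lam).

Definition zsign (m : int) : bool := if m is Posz _ then true else false.

Lemma zpow_sign m : zpow c m = csig (zsign m) ^+ `|m|%N.
Proof. by case: m => n //=; rewrite expVgn. Qed.

Definition good_block (p : block) :=
  [/\ tight p.1, ~ in_root p.1 & (threshold <= `|p.2|)%N].

(** An exponent of absolute value at least [threshold] is cut into [margin] copies for the seam on
    either side and a remainder; all cancellation then stays inside the seams. *)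
Definition seam e g e' := csig e ^+ margin * g * csig e' ^+ margin.

(** [e] is the sign of the exponent that precedes [s]; the seam of the first block borrows [margin]
    copies from it. *)
Fixpoint block_word e s : seq (letter k) :=
  if s is p :: s' then
    nf (seam e p.1 (zsign p.2)) ++ wpow (Cw (zsign p.2)) (`|p.2| - threshold)
      ++ block_word (zsign p.2) s'
  else [::].

Lemma block_word_cons e p s : block_word e (p :: s) =
  nf (seam e p.1 (zsign p.2)) ++ wpow (Cw (zsign p.2)) (`|p.2| - threshold)
      ++ block_word (zsign p.2) s.
Proof. by []. Qed.

(** The copies borrowed at the front are missing at the end. If [e] is the sign of the last
    exponent, the word thus represents a conjugate of the block product. *)
Lemma block_word_val e s p : (forall q, List.In q (p :: s) -> good_block q) ->
  wv (block_word e (p :: s)) * csig (zsign (last p s).2) ^+ margin =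
  csig e ^+ margin * block_val c (p :: s).
Proof.
elim: s e p => [|q s IH] e p good.
  have [_ _ lp] := good p (or_introl erefl).
  rewrite /= cats0 mulg1 word_val_cat nfK word_val_wpow wv_Cw zpow_sign.
  rewrite /seam -!mulgA -!expgnDr; congr (_ * (_ * _ ^+ _)).
  by lia.
have [_ _ lp] := good p (or_introl erefl).
have IHs : wv (block_word (zsign p.2) (q :: s)) * csig (zsign (last q s).2) ^+ margin =
   csig (zsign p.2) ^+ margin * block_val c (q :: s).
  by apply: IH => r Hr; apply: good; right.
have -> : last p (q :: s) = last q s by [].
rewrite block_word_cons word_val_cat word_val_cat -mulgA -mulgA IHs.
rewrite nfK word_val_wpow wv_Cw (block_val_cons c p (q :: s)) (zpow_sign p.2).
move: (block_val c (q :: s)) => V; rewrite !mulgA.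
congr (_ * _); rewrite /seam -!mulgA -!expgnDr; congr (_ * (_ * _ ^+ _)).
by lia.
Qed.

Lemma block_word_prefix e p s : good_block p -> prefix (Cw e) (block_word e (p :: s)).
Proof.
move=> [tp np _] /=; apply: prefix_catl.
by have [] := tight_ends C_cyc C_prim e (zsign p.2) tp np (leqnn _) (leqnn _).
Qed.

Lemma reduced_Cw_glue e u v : reduced u -> reduced v ->
  suffix (Cw e) u -> prefix (Cw e) v -> reduced (u ++ v).
Proof.
move=> + + /suffixP[u' Eu] /prefixP[v' Ev]; rewrite Eu Ev => ru rv.
have n0 := Cw_neq0 C_prim e.
rewrite -catA; apply: reduced_glue => //.
rewrite catA; rewrite -catA; apply: reduced_glue => //.
by rewrite -cyc_reducedE Cw_cyc.
Qed.

Lemma suffix_cat_wpow e u n : suffix (Cw e) u -> suffix (Cw e) (u ++ wpow (Cw e) n).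
Proof.
case: n => [|n]; first by rewrite cats0.
by move=> _; rewrite wpowSr catA suffix_suffix.
Qed.

Lemma reduced_head e p : good_block p ->
  let w := nf (seam e p.1 (zsign p.2)) ++ wpow (Cw (zsign p.2)) (`|p.2| - threshold) in
  reduced w /\ suffix (Cw (zsign p.2)) w.
Proof.
move=> [tp np _] /=.
have [_ suf] := tight_ends C_cyc C_prim e (zsign p.2) tp np (leqnn _) (leqnn _).
split; last exact: suffix_cat_wpow.
case: (_ - _)%N => [|n]; first by rewrite cats0 nf_reduced.
apply: (@reduced_Cw_glue (zsign p.2)) => //; first exact: nf_reduced.
  by apply: reduced_wpow; exact: Cw_cyc.
by rewrite /= prefix_prefix.
Qed.

(** Every piece ends with the signed period with which the next one begins, and a signed period may
    follow itself. *)
Lemma block_word_reduced e s : (forall q, List.In q s -> good_block q) ->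
  reduced (block_word e s).
Proof.
elim: s e => // p s IH e good.
have [r1 s1] := @reduced_head e p (good p (or_introl erefl)).
rewrite [block_word _ _]/= catA.
case: s IH good => [|q s] IH good; first by rewrite cats0.
apply: (@reduced_Cw_glue (zsign p.2)) => //.
  by apply: IH => r Hr; apply: good; right.
by apply: block_word_prefix; apply: good; right; left.
Qed.

Lemma quasi_add_word u v : reduced (u ++ v) ->
  (L (wv (u ++ v)) <= L (wv u) + L (wv v) + B)%N /\
  (L (wv u) + L (wv v) <= L (wv (u ++ v)) + B)%N.
Proof.
move=> r; rewrite word_val_cat; apply: qaL.2.
rewrite -word_val_cat ?lenE !nf_val ?size_cat //.
  exact: reduced_catr r.
exact: reduced_catl r.
Qed.

Lemma block_word_estimate : exists K, forall e s,
  (forall q, List.In q s -> good_block q) ->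
  (L (wv (block_word e s)) <= block_exp s * lam + K * (block_len s + size s).+1 /\
  block_exp s * lam <= L (wv (block_word e s)) + K * (block_len s + size s).+1)%N.
Proof.
have [D HD] := homL; have [K0 HK0] := quasi_add_lip qaL; have [LV _] := qaL.
(* One [L 1] serves the empty list and the other the seam; [2 * B] pays for the two concatenations,
   [D] for the middle power of [c], [K0] for the length of the group element, and the terms in
   [margin] and [threshold] for the periods hidden in the seams. *)
pose K := (L 1 + 2 * B + K0 + D + K0 * (2 * margin * l) + L 1 + threshold * lam)%N.
exists K => e s; elim: s e => [|p s IH] e good.
  by rewrite /block_exp /= /K; split; lia.
have gp := good p (or_introl erefl); have [_ _ lp] := gp.
have red := block_word_reduced e good.
move: red; rewrite [block_word _ _]/= catA => red.
have [h1 h2] := quasi_add_word red.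
have [r2 _] := @reduced_head e p gp.
have [h3 h4] := quasi_add_word r2.
have good' q : List.In q s -> good_block q by move=> Hq; apply: good; right.
have [h5 h6] := IH (zsign p.2) good'.
have [h7 h8] : (L (wv (nf (seam e p.1 (zsign p.2)))) <= L 1 + K0 * (2 * margin * l + len p.1))%N /\ True.
  split=> //; rewrite nfK; have [h _] := HK0 1 (seam e p.1 (zsign p.2)).
  rewrite mul1g in h; apply: leq_trans h _; rewrite leq_add2l leq_mul2l; apply/orP; right.
  have lc e1 : (len (csig e1 ^+ margin) = margin * l)%N.
    by rewrite ?lenE nf_csigX // size_wpow size_Cw.
  have := lenM A_basis (csig e ^+ margin * p.1) (csig (zsign p.2) ^+ margin).
  have := lenM A_basis (csig e ^+ margin) p.1.
  have E2 : (2 * margin * l = margin * l + margin * l)%N by rewrite -mulnA mul2n addnn.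
  by rewrite !lc /seam E2 => j1 j2; apply: leq_trans j2 _; rewrite addnAC leq_add2r.
set d := (`|p.2| - threshold)%N in h3 h4 red r2 h1 h2 *.
have [h9 h10] : (L (wv (wpow (Cw (zsign p.2)) d)) <= d * lam + D)%N /\
   (d * lam <= L (wv (wpow (Cw (zsign p.2)) d)) + D)%N.
  rewrite word_val_wpow wv_Cw; case: (zsign p.2) => /=; first exact: HD.
  by rewrite expVgn LV; exact: HD.
have Ed : (`|p.2| * lam = d * lam + threshold * lam)%N by rewrite -mulnDl subnK.
have -> : block_exp (p :: s) = (`|p.2| + block_exp s)%N by [].
have -> : block_len (p :: s) = (len p.1 + block_len s)%N by [].
have EK : (K * (len p.1 + block_len s + size (p :: s)).+1 =
   K * (block_len s + size s).+1 + K * len p.1 + K)%N.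
  by rewrite /=; nia.
have EK1 : (K0 * len p.1 <= K * len p.1)%N.
  by rewrite leq_mul2r; apply/orP; right; rewrite /K; lia.
rewrite EK mulnDl Ed.
move: h7; rewrite mulnDr => h7.
have EK2 : (L 1 + 2 * B + K0 + D + K0 * (2 * margin * l) + L 1 + threshold * lam <= K)%N by [].
clearbody K.
split; lia.
Qed.

End Estimate.
End Root.
End Core.

(** * Normalization of cyclic products *)

Section Normalization.
Context {F : groupType} {k : nat} {A : 'I_k.+2 -> F} (A_basis : is_basis A).
Implicit Types (g h x y z : F) (u v w : seq (letter k)) (e : bool).
Local Notation block := (F * int)%type.
Implicit Types (s : seq block).
Local Notation wv := (word_val A).
Local Notation nf := (nf A_basis).
Local Notation len := (len A_basis).
Local Notation block_len := (block_len A_basis).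
Context {C : seq (letter k)} (C_cyc : cyc_reduced C).
Context (C_prim : not_proper_power (wv C)).
Local Notation c := (wv C).
Local Notation l := (size C).
Local Notation in_root := (@in_root F k A C).
Local Notation csig := (@csig F k A C).
Local Notation Cw := (@Cw k C).
Local Notation tight := (@tight F k A A_basis C).
Local Notation margin := (@margin k C).
Local Notation threshold := (2 * margin)%N.
Local Notation good_block := (@good_block F k A A_basis C).

(* In E e g e', the booleans are the signs with which the twist inserts powers of c
   before and after g. *)
Context {E : bool -> F -> bool -> Prop}.
Context (E_root : forall e g e', E e g e' -> ~ in_root g).
Context (E_mull : forall e g e' m, E e g e' -> E e (zpow c m * g) e').
Context (E_mulr : forall e g e' m, E e g e' -> E e (g * zpow c m) e').
Context (E_mul : forall e g e' h e'', E e g e' -> E e' h e'' -> E e (g * h) e'').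

Fixpoint chain e s e' : Prop :=
  if s is p :: s' then exists2 e1, E e p.1 e1 & chain e1 s' e' else e = e'.

Lemma chain_cat e s1 s2 e' :
  chain e (s1 ++ s2) e' <-> exists2 e1, chain e s1 e1 & chain e1 s2 e'.
Proof.
elim: s1 e => [|p s1 IH] e /=; first by split=> [|[e1 -> //]]; exists e.
split=> [[e1 Ep /IH[e2 h1 h2]]|[e2 [e1 Ep h1] h2]].
  by exists e2 => //; exists e1.
by exists e1 => //; apply/IH; exists e2.
Qed.

Definition cyc_chain s := exists e, chain e s e.

Lemma cyc_chain_rot s1 s2 : cyc_chain (s1 ++ s2) -> cyc_chain (s2 ++ s1).
Proof.
move=> [e /chain_cat[e1 h1 h2]]; exists e1; apply/chain_cat; by exists e.
Qed.

(** A merge absorbs an exponent below [threshold] into a group element: the length may rise by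
    [threshold * l], and the exponents, counted in letters, may fall by as much. The disappearance
    of one block has to pay for both. *)
Definition weight := (2 * threshold * l).+1.
Definition pot s := (block_len s + weight * size s)%N.

Definition descends s s' :=
  (l * block_exp s' + pot s' <= l * block_exp s + pot s /\
   l * block_exp s + pot s' <= l * block_exp s' + pot s)%N.

(* Every unit of exponent that a step moves out of a block, or loses, is paid
   for by a drop of the potential. *)
Definition normalizes s := exists s',
  [/\ cyc_chain s', s' <> [::], conj (block_val c s) (block_val c s'),
      descends s s' &
      (forall p, List.In p s' -> tight p.1) /\
      ((exists p, s' = [:: p]) \/ forall p, List.In p s' -> threshold <= `|p.2|)%N].

Lemma normalizes_step s s1 : conj (block_val c s) (block_val c s1) ->
  descends s s1 -> normalizes s1 -> normalizes s.
Proof.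
move=> cj [d1 d2] [s' [ch n0 cj' [d3 d4] H]]; exists s'; split=> //.
  exact: conj_trans cj cj'.
by rewrite /descends; split; lia.
Qed.

Lemma normalizes_rot s1 s2 : normalizes (s2 ++ s1) -> normalizes (s1 ++ s2).
Proof.
apply: normalizes_step; first by rewrite !block_val_cat; exact: conj_rot.
by rewrite /descends /pot !block_len_cat !block_exp_cat !size_cat; split; lia.
Qed.

Lemma not_tight g : tight g \/ exists e, prefix (Cw e) (nf g) \/ suffix (Cw e) (nf g).
Proof.
have [p1|p1] := boolP (prefix (Cw true) (nf g)); first by right; exists true; left.
have [p2|p2] := boolP (prefix (Cw false) (nf g)); first by right; exists false; left.
have [p3|p3] := boolP (suffix (Cw true) (nf g)); first by right; exists true; right.
have [p4|p4] := boolP (suffix (Cw false) (nf g)); first by right; exists false; right.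
by left; case.
Qed.

Definition sg e : int := if e then 1%R else (-1)%R.

Lemma zpow_sg e : zpow c (sg e) = csig e.
Proof. by case: e; rewrite /= ?expg1. Qed.

Lemma zpow_sgN e : zpow c (- sg e)%R = (csig e)^-1.
Proof. by rewrite zpowN zpow_sg. Qed.

Lemma abs_sg (m : int) e :
  (`|(m + sg e)%R| <= `|m| + 1 /\ `|m| <= `|(m + sg e)%R| + 1)%N.
Proof. by case: e => /=; split; lia. Qed.

Lemma shift_exp (m : int) e : exists m' : int,
  [/\ zpow c m' = zpow c m * csig e, zpow c m' = csig e * zpow c m,
      (`|m'| <= `|m| + 1)%N & (`|m| <= `|m'| + 1)%N].
Proof.
have [a1 a2] := abs_sg m e; exists (m + sg e)%R; split=> //.
  by rewrite zpowD zpow_sg.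
by rewrite GRing.addrC zpowD zpow_sg.
Qed.

Lemma strip_prefix e g : prefix (Cw e) (nf g) ->
  exists g', [/\ g = csig e * g', len g = (len g' + l)%N &
    forall e1 e2, E e1 g e2 -> E e1 g' e2].
Proof.
move=> /prefixP[w Ew]; exists (wv w).
have Eg : g = csig e * wv w by rewrite -wv_Cw -word_val_cat -Ew nfK.
have rw : reduced w by apply: (@reduced_catr _ (Cw e)); rewrite -Ew nf_reduced.
split=> //; first by rewrite ?lenE Ew size_cat size_Cw (nf_val A_basis rw) addnC.
move=> e1 e2 Hg; have -> : wv w = zpow c (- sg e)%R * g by rewrite zpow_sgN Eg mulKg.
exact: E_mull.
Qed.

Lemma strip_suffix e g : suffix (Cw e) (nf g) ->
  exists g', [/\ g = g' * csig e, len g = (len g' + l)%N &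
    forall e1 e2, E e1 g e2 -> E e1 g' e2].
Proof.
move=> /suffixP[w Ew]; exists (wv w).
have Eg : g = wv w * csig e by rewrite -wv_Cw -word_val_cat -Ew nfK.
have rw : reduced w by apply: (@reduced_catl _ _ (Cw e)); rewrite -Ew nf_reduced.
split=> //; first by rewrite ?lenE Ew size_cat size_Cw (nf_val A_basis rw).
move=> e1 e2 Hg; have -> : wv w = g * zpow c (- sg e)%R by rewrite zpow_sgN Eg mulgK.
exact: E_mulr.
Qed.

Lemma len_zpow (m : int) : (len (zpow c m) <= `|m| * l)%N.
Proof.
have h n : (len (c ^+ n) <= n * l)%N.
  by apply: leq_trans (lenX _ _ _) _; rewrite leq_mul2l len_val orbT.
by case: m => n; rewrite /= ?lenV; apply: leq_trans (h _) _; rewrite leq_mul2r; apply/orP; right; lia.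
Qed.

Lemma descends_strip s s' :
  (block_exp s' <= block_exp s + 1)%N -> (block_exp s <= block_exp s' + 1)%N ->
  block_len s = (block_len s' + l)%N -> size s = size s' ->
  descends s s' /\ (pot s' < pot s)%N.
Proof.
have l0 := root_size C_prim; rewrite /descends /pot => h1 h2 -> ->.
move: (weight * _)%N (block_exp s) (block_exp s') (block_len s') h1 h2 => a b b' d h1 h2.
have h3 : (l * b' <= l * b + l)%N by nia.
have h4 : (l * b <= l * b' + l)%N by nia.
by split; lia.
Qed.

Lemma descends_merge s s' :
  (block_exp s' <= block_exp s)%N -> (block_exp s <= block_exp s' + threshold)%N ->
  (block_len s' <= block_len s + threshold * l)%N -> size s = (size s').+1 ->
  descends s s' /\ (pot s' < pot s)%N.
Proof.
have l0 := root_size C_prim; rewrite /descends /pot => h1 h2 h5 ->.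
have Ew : weight = (2 * (threshold * l)).+1 by rewrite /weight -mulnA.
rewrite mulnS; move: (weight * size s')%N => a.
move: h1 h2 h5 Ew; move: threshold weight (block_exp s) (block_exp s') => T W b b' h1 h2.
have h3 : (l * b' <= l * b)%N by nia.
have h4 : (l * b <= l * b' + T * l)%N by nia.
by move: (block_len s) (block_len s') (T * l)%N h4 => d d' f h4 h5 ->; split; lia.
Qed.

Lemma block_len_nil : block_len [::] = 0%N. Proof. by []. Qed.

Lemma block_lenE g (m : int) s : block_len ((g, m) :: s) = (len g + block_len s)%N.
Proof. by []. Qed.
Lemma block_expE g (m : int) s : block_exp ((g, m) :: s) = (`|m| + block_exp s)%N.
Proof. by []. Qed.
Lemma block_valE g (m : int) s : block_val c ((g, m) :: s) = g * zpow c m * block_val c s.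
Proof. by []. Qed.

(** Induction on the potential. A period at an end of a non-tight element is moved into the
    neighbouring exponent; once all elements are tight, a block with a short exponent is merged with
    its successor. Rotations bring the block concerned to the front. *)
Lemma normalize s : cyc_chain s -> s <> [::] -> normalizes s.
Proof.
have l0 := root_size C_prim.
have [n] := ubnP (pot s); elim: n s => // n IH s ltn ch n0.
have [[p [inp ntp]]|allt] : (exists p, List.In p s /\ ~ tight p.1) \/
    (forall p, List.In p s -> tight p.1).
- have [|H] := pselect (exists p, List.In p s /\ ~ tight p.1); first by left.
  right=> p inp; have [//|nt] := pselect (tight p.1).
  by case: H; exists p.
- have [s1 [s2 Es0]] := List.in_split _ _ inp.
  have {Es0} Es : s = s1 ++ p :: s2 := Es0.
  rewrite Es; apply: normalizes_rot => /=.
  have {ch} [e0 ch] : cyc_chain ((p :: s2) ++ s1) by apply: cyc_chain_rot; rewrite -Es.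
  have {ltn} ltn : pot ((p :: s2) ++ s1) < n.+1.
    by move: ltn; rewrite Es /pot !block_len_cat !size_cat; lia.
  move: ch ltn; rewrite cat_cons; set t := s2 ++ s1 => ch ltn.
  case: p ntp ch ltn {inp Es} => g m /= ntg ch ltn.
  case: ch => e1 Hg ch.
  have [//|[e [pre|suf]]] := not_tight g.
  + have [g' [Eg lg Eg']] := strip_prefix pre.
    (* The prefix moves into the exponent before it, which cyclically is that of the last block, or
       the block's own if there is no other. *)
    case: (lastP t) ch ltn => [|t0 [h j]] ch ltn.
      have [m' [Em1 Em2 a1 a2]] := shift_exp m e.
      apply: (@normalizes_step _ [:: (g', m')]).
      * rewrite !block_valE /= !mulg1 Em1 Eg [g' * _]mulgA -[csig e * g' * _]mulgA.
        exact: conj_rot.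
      * by apply: (proj1 (descends_strip _ _ _ _)); rewrite ?block_expE ?block_lenE ?lg //=; lia.
      * apply: IH => //; last by exists e0, e1 => //; exact: Eg'.
        apply: leq_trans _ (ltnSE ltn); apply: (proj2 (descends_strip _ _ _ _));
          by rewrite ?block_expE ?block_lenE ?lg //=; lia.
    have [j' [Ej1 Ej2 a1 a2]] := shift_exp j e.
    apply: (@normalizes_step _ ((g', m) :: rcons t0 (h, j'))).
    * rewrite -!cats1 !block_valE !block_val_cat !block_valE /= !mulg1 Ej1 Eg.
      rewrite -2!mulgA; apply: conj_trans (conj_rot _ _) _.
      by rewrite !mulgA; exact: conj_refl.
    * by apply: (proj1 (descends_strip _ _ _ _));
        rewrite -!cats1 ?(block_expE, block_exp_cat, block_lenE, block_len_cat, lg) //= ?size_cat //=; lia.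
    * apply: IH => //.
        apply: leq_trans _ (ltnSE ltn); apply: (proj2 (descends_strip _ _ _ _));
        by rewrite -!cats1 ?(block_expE, block_exp_cat, block_lenE, block_len_cat, lg) //= ?size_cat //=; lia.
      exists e0, e1; first exact: Eg'.
      move: ch; rewrite -!cats1 => /chain_cat[e2 h1 [e3 h2 h3]].
      by apply/chain_cat; exists e2 => //; exists e3.
  + have [g' [Eg lg Eg']] := strip_suffix suf.
    have [m' [Em1 Em2 a1 a2]] := shift_exp m e.
    apply: (@normalizes_step _ ((g', m') :: t)).
    * rewrite !block_valE Em2 Eg !mulgA; exact: conj_refl.
    * by apply: (proj1 (descends_strip _ _ _ _));
        rewrite ?block_expE ?block_lenE ?lg //=; lia.
    * apply: IH => //; last by exists e0, e1 => //; exact: Eg'.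
      apply: leq_trans _ (ltnSE ltn); apply: (proj2 (descends_strip _ _ _ _));
        by rewrite ?block_expE ?block_lenE ?lg //=; lia.
have [[p [inp ltp]]|allm] : (exists p, List.In p s /\ (`|p.2| < threshold)%N) \/
    (forall p, List.In p s -> threshold <= `|p.2|)%N.
- have [|H] := pselect (exists p, List.In p s /\ (`|p.2| < threshold)%N); first by left.
  right=> p inp; rewrite leqNgt; apply/negP => lt; apply: H; by exists p.
- have [s1 [s2 Es0]] := List.in_split _ _ inp.
  have {Es0} Es : s = s1 ++ p :: s2 := Es0.
  have {ch} [e0 ch] : cyc_chain ((p :: s2) ++ s1) by apply: cyc_chain_rot; rewrite -Es.
  case Et : (s2 ++ s1) => [|[h j] t].
    (* A single block has no successor to be merged with, so its short exponent is kept. *)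
    case: s2 s1 Et Es ch => // -[] // _ Es ch.
    exists s; split=> //; [by exists e0; rewrite Es|exact: conj_refl|].
    by split=> //; left; exists p.
  rewrite Es; apply: normalizes_rot => /=; rewrite Et.
  have {ltn} ltn : pot ((p :: s2) ++ s1) < n.+1.
    by move: ltn; rewrite Es /pot !block_len_cat !size_cat; lia.
  rewrite cat_cons Et in ltn ch.
  case: p ltp ltn ch {inp Es} => g m /= ltm ltn [e1 Hg [e2 Hh ch]].
  have lgh : (len (g * zpow c m * h) <= len g + threshold * l + len h)%N.
    apply: leq_trans (lenM _ _ _) _; rewrite leq_add2r.
    apply: leq_trans (lenM _ _ _) _; rewrite leq_add2l.
    by apply: leq_trans (len_zpow _) _; rewrite leq_mul2r ltnW ?orbT.
  have [d1 d2] : descends ((g, m) :: (h, j) :: t) ((g * zpow c m * h, j) :: t) /\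
      pot ((g * zpow c m * h, j) :: t) < pot ((g, m) :: (h, j) :: t).
    by apply: descends_merge; rewrite ?block_expE ?block_lenE //=; lia.
  apply: (@normalizes_step _ ((g * zpow c m * h, j) :: t)) => //.
  + by rewrite !block_valE !mulgA; exact: conj_refl.
  + apply: IH => //; first exact: leq_trans d2 (ltnSE ltn).
    by exists e0, e2 => //; apply: E_mul Hh; exact: E_mulr.
- by exists s; split=> //; [exact: conj_refl|split => //; right].
Qed.

Fixpoint block_rep n s : seq block := if n is n'.+1 then s ++ block_rep n' s else [::].

Lemma block_exp_rep n s : block_exp (block_rep n s) = (n * block_exp s)%N.
Proof. by elim: n => //= n IH; rewrite block_exp_cat IH mulSn. Qed.

Lemma block_len_rep n s : block_len (block_rep n s) = (n * block_len s)%N.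
Proof. by elim: n => //= n IH; rewrite block_len_cat IH mulSn. Qed.

Lemma size_block_rep n s : size (block_rep n s) = (n * size s)%N.
Proof. by elim: n => //= n IH; rewrite size_cat IH mulSn. Qed.

Lemma block_val_rep n s : block_val c (block_rep n s) = block_val c s ^+ n.
Proof. by elim: n => //= n IH; rewrite block_val_cat IH expgS. Qed.

Lemma in_block_rep n s p : List.In p (block_rep n s) -> List.In p s.
Proof. by elim: n => //= n IH /List.in_app_iff[]. Qed.

Lemma last_block_rep n p s : last (last p s) (block_rep n (p :: s)) = last p s.
Proof. by elim: n => //= n IH; rewrite last_cat. Qed.

(* [mu] is the value on X, and [lam] the value on c, of the homogenization of L. *)
Theorem homog_twist_estimate (L : F -> nat) B lam : quasi_add A_basis L B ->
  homog L c lam -> exists K, forall s X mu, cyc_chain s -> s <> [::] ->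
    conj X (block_val c s) -> homog L X mu ->
    (mu <= block_exp s * lam + K * (block_len s + size s))%N /\
    (block_exp s * lam <= mu + K * (block_len s + size s))%N.
Proof.
move=> qaL homL; have l0 := root_size C_prim.
have [K1 HK1] := block_word_estimate C_cyc C_prim qaL homL.
have [K0 HK0] := quasi_add_lip qaL.
pose K2 := (K1 + K0 * (1 + threshold * l) + threshold * lam)%N.
exists ((K2 + lam) * weight)%N => s X mu ch n0 cj hX.
have [s' [[e ch'] n0' cj' [d1 d2] [allt alt]]] := normalize ch n0.
have hs' : homog L (block_val c s') mu.
  by apply: homog_conj qaL _ hX; exact: conj_trans cj cj'.
have ns' : (0 < size s')%N by case: s' n0' {ch' cj' d1 d2 allt alt hs'}.
suff [e1 e2] : (mu <= block_exp s' * lam + K2 * (block_len s' + size s'))%N /\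
    (block_exp s' * lam <= mu + K2 * (block_len s' + size s'))%N.
  have p1 : (pot s <= weight * (block_len s + size s))%N by rewrite /pot mulnDr leq_add2r leq_pmull.
  have p2 : (block_len s' + size s' <= pot s')%N by rewrite /pot leq_add2l leq_pmull.
  have {}e1 : (mu <= block_exp s' * lam + K2 * pot s')%N.
    by apply: leq_trans e1 _; rewrite leq_add2l leq_mul2l p2 orbT.
  have {}e2 : (block_exp s' * lam <= mu + K2 * pot s')%N.
    by apply: leq_trans e2 _; rewrite leq_add2l leq_mul2l p2 orbT.
  move: (block_exp s) (block_exp s') d1 d2 e1 e2 p1 => b b' d1 d2 e1 e2 p1.
  have p3 : (pot s' <= pot s)%N by lia.
  have b1 : (b' <= b + pot s)%N by nia.
  have b2 : (b <= b' + pot s)%N by nia.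
  have q1 : (K2 * pot s' <= K2 * pot s)%N by rewrite leq_mul2l p3 orbT.
  have q2 : (b' * lam <= b * lam + lam * pot s)%N by rewrite [(lam * _)%N]mulnC -mulnDl leq_mul2r b1 orbT.
  have q3 : (b * lam <= b' * lam + lam * pot s)%N by rewrite [(lam * _)%N]mulnC -mulnDl leq_mul2r b2 orbT.
  have q4 : ((K2 + lam) * pot s <= (K2 + lam) * weight * (block_len s + size s))%N.
    by rewrite -mulnA leq_mul2l p1 orbT.
  by rewrite mulnDl in q4; split; lia.
have [allg|[p [Es' ltp]]] : (forall p, List.In p s' -> threshold <= `|p.2|)%N \/
    (exists p, s' = [:: p] /\ (`|p.2| < threshold)%N).
- case: alt => [[p Es']|H]; last by left.
  have [le|lt] := leqP threshold `|p.2|%N; last by right; exists p.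
  by left=> q; rewrite Es' => -[<-|[]].
- have good q : List.In q s' -> good_block q.
    move=> inq; split; [exact: allt| |exact: allg].
    have [t1 [t2 Et]] := List.in_split _ _ inq.
    have {}Et : s' = t1 ++ q :: t2 := Et.
    by move: ch'; rewrite Et => /chain_cat[e1 _ [e2 /E_root]].
  case: s' ns' ch' n0' cj' d1 d2 allt alt hs' allg good => // p s' _ _ _ _ _ _ _ _ hs' _ good.
  pose z := zsign (last p s').2.
  (* After conjugation by [margin] copies of the last sign, the powers are represented exactly by
     the reduced words of the repeated list. *)
  have hY : homog L (csig z ^+ margin * block_val c (p :: s') * (csig z ^+ margin)^-1) mu.
    by apply: homog_conj qaL _ hs'; exists (csig z ^+ margin).
  have := @homog_close _ L _ mu (block_exp (p :: s') * lam) (K1 * (block_len (p :: s') + size (p :: s'))) (K1 + L 1) hY.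
  case.
    case=> [|n]; first by rewrite !mul0n expg0 !add0n leq_addl.
    have goodn q : List.In q (block_rep n.+1 (p :: s')) -> good_block q.
      by move=> /in_block_rep; exact: good.
    have EY : (csig z ^+ margin * block_val c (p :: s') * (csig z ^+ margin)^-1) ^+ n.+1
      = wv (@block_word F k A A_basis C z (block_rep n.+1 (p :: s'))).
      have := @block_word_val F k A A_basis C C_cyc z (s' ++ block_rep n (p :: s')) p goodn.
      rewrite last_cat last_block_rep -/z => Ew.
      rewrite expg_conj -block_val_rep; apply: (mulIg (csig z ^+ margin)).
      by rewrite mulgVK -Ew.
    have [h1 h2] := HK1 z _ goodn.
    rewrite block_exp_rep block_len_rep size_block_rep -mulnDr -EY in h1 h2.
    have E3 : (K1 * (n.+1 * (block_len (p :: s') + size (p :: s'))).+1 =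
      n.+1 * (K1 * (block_len (p :: s') + size (p :: s'))) + K1)%N.
      by rewrite mulnS mulnCA addnC.
    rewrite E3 -mulnA in h1 h2.
    by split; lia.
  move=> f1 f2; have f3 : (K1 <= K2)%N by rewrite /K2; lia.
  have f4 : (K1 * (block_len (p :: s') + size (p :: s')) <= K2 * (block_len (p :: s') + size (p :: s')))%N.
    by rewrite leq_mul2r f3 orbT.
  by split; lia.
(* For a single short block both quantities are at most linear in its length, and the crude
   Lipschitz bound is enough. *)
- have := @homog_close _ L _ mu 0 (K0 * len (block_val c s')) (L 1) hs'.
  case.
    move=> n; rewrite muln0; split=> //.
    have [h _] := HK0 1 (block_val c s' ^+ n); rewrite mul1g in h.
    have h2 := lenX A_basis (block_val c s') n.
    have h3 : (K0 * len (block_val c s' ^+ n) <= n * (K0 * len (block_val c s')))%N.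
      by rewrite mulnCA leq_mul2l h2 orbT.
    by lia.
  move=> f1 _; rewrite Es'; case: p Es' ltp => g m Es' /= ltm.
  have lg : (len (block_val c s') <= len g + threshold * l)%N.
    rewrite Es' /= mulg1; apply: leq_trans (lenM _ _ _) _; rewrite leq_add2l.
    by apply: leq_trans (len_zpow _) _; rewrite leq_mul2r ltnW ?orbT.
  rewrite block_lenE block_expE /block_exp block_len_nil /= !addn0.
  have f2 : (K0 * len (block_val c s') <= K0 * len g + K0 * (threshold * l))%N.
    by rewrite -mulnDr leq_mul2l lg orbT.
  have f3 : (`|m| * lam <= threshold * lam)%N by rewrite leq_mul2r ltnW ?orbT.
  have f4 : (K0 * len g <= K2 * len g)%N.
    by rewrite leq_mul2r /K2 mulnDr muln1; apply/orP; right; lia.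
  have f5 : (K0 * (threshold * l) + threshold * lam <= K2)%N.
    by rewrite /K2 mulnDr muln1; lia.
  rewrite !mulnDr muln1.
  by split; lia.
Qed.

End Normalization.

(** * Products with large exponents are not powers of the root *)

Section Baumslag.
Context {F : groupType} {k : nat} {A : 'I_k.+2 -> F} (A_basis : is_basis A).
Implicit Types (g h x y z : F) (u v w : seq (letter k)) (e : bool).
Local Notation block := (F * int)%type.
Implicit Types (s : seq block).
Local Notation wv := (word_val A).
Local Notation nf := (nf A_basis).
Local Notation len := (len A_basis).

Definition zs e (n : int) : int := if e then n else (- n)%R.

Definition twisted c (n : int) (t : seq (F * bool)) : F :=
  foldr (fun p x => p.1 * zpow c (zs p.2 n) * x) 1 t.

Section Root.
Context {C : seq (letter k)} (C_cyc : cyc_reduced C).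
Context (C_prim : not_proper_power (wv C)).
Local Notation c := (wv C).
Local Notation in_root := (@in_root F k A C).
Local Notation csig := (@csig F k A C).
Local Notation Cw := (@Cw k C).
Local Notation tight := (@tight F k A A_basis C).
Local Notation margin := (@margin k C).
Local Notation threshold := (2 * margin)%N.
Local Notation good_block := (@good_block F k A A_basis C).

Lemma strip_tight g : exists p q g', g = zpow c p * g' * zpow c q /\ tight g'.
Proof.
have l0 := root_size C_prim.
have [n] := ubnP (len g); elim: n g => // n IH g ltn.
have [tg|[e [pre|suf]]] := @not_tight _ _ _ A_basis C g.
- by exists 0%R, 0%R, g; rewrite mul1g mulg1.
- have [g' [Eg lg _]] := @strip_prefix _ _ _ A_basis C (fun _ _ _ => True) (fun _ _ _ _ => id) e g pre.
  have [|p [q [g2 [Eg' tg]]]] := IH g'; first by lia.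
  by exists (sg e + p)%R, q, g2; rewrite Eg Eg' zpowD zpow_sg !mulgA.
- have [g' [Eg lg _]] := @strip_suffix _ _ _ A_basis C (fun _ _ _ => True) (fun _ _ _ _ => id) e g suf.
  have [|p [q [g2 [Eg' tg]]]] := IH g'; first by lia.
  by exists p, (q + sg e)%R, g2; rewrite Eg Eg' zpowD zpow_sg !mulgA.
Qed.

Lemma in_root_mid p q g : in_root (zpow c p * g * zpow c q) <-> in_root g.
Proof.
split=> [[m Em]|[m ->]]; last first.
  by exists (p + m + q)%R; rewrite !zpowD.
exists (- p + m + - q)%R; rewrite !zpowD -Em !zpowN !mulgA mulVg mul1g.
by rewrite mulgK.
Qed.

Lemma prefix_zpow e m : prefix (Cw e) (nf (zpow c m)) -> if e then (0 < m)%R else (m < 0)%R.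
Proof.
have l0 := root_size C_prim.
rewrite zpow_sign nf_csigX // prefixE size_Cw.
case E : (absz m) => [|n] /=.
  by move=> /eqP /(congr1 size); rewrite size_Cw /=; lia.
rewrite take_size_cat ?size_Cw // => /eqP Ee.
have : csig e = csig (zsign m) by rewrite -!wv_Cw Ee.
have c2 : c <> c^-1.
  move=> Ec; apply: (root_neq1 C_prim); apply: (expg_eq1 A_basis (n := 2)) => //.
  by rewrite expg2 {2}Ec mulgV.
case: m E {Ee} => m /= E; case: e => //=; try lia.
by move=> /esym /c2.
Qed.

(** The powers of [c] stripped off the elements depend on [t] only, so that for large [n] they do
    not spoil the exponents. The power stripped off at the front is compensated by [p0], and [j]
    makes the last exponent large. *)
Lemma twisted_good (t : seq (F * bool)) : t <> [::] ->
  (forall p, List.In p t -> ~ in_root p.1) ->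
  exists p0 n0, forall n : nat, (n0 <= n)%N -> exists T, forall j : int, (T <= `|j|)%N ->
  exists b s, (forall q, List.In q (b :: s) -> good_block q) /\
    block_val c (b :: s) = zpow c p0 * twisted c n t * zpow c j.
Proof.
elim: t => // [[g e] t] IH _ ng.
have [p [q [g' [Eg tg]]]] := strip_tight g.
have ng' : ~ in_root g'.
  by move=> rg; apply: (ng (g, e)); [left|rewrite /= Eg; apply/in_root_mid].
have pg y : zpow c (- p)%R * (g * y) = g' * (zpow c q * y).
  by rewrite Eg zpowN -!mulgA mulKg.
case: t IH ng => [|[h e'] t] IH ng.
  exists (- p)%R, 0%N => n _; exists (threshold + `|q| + n)%N => j lj.
  exists (g', q + (zs e n + j))%R, [::]; split.
    move=> _ [<-|[]] //; split=> //=.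
    by move: lj; case: e {ng}; rewrite /zs; lia.
  by rewrite block_valE /= !mulg1 -!mulgA pg !zpowD.
have [//||p0 [n0 H]] := IH; first by move=> r Hr; apply: ng; right.
exists (- p)%R, (n0 + threshold + `|q| + `|p0|)%N => n ln.
have [|T HT] := H n; first by lia.
exists T => j /HT[b [s [good Eb]]].
exists (g', q + (zs e n - p0))%R, (b :: s); split.
  move=> r [<-|]; last exact: good.
  by split=> //=; move: ln; case: e {ng}; rewrite /zs; lia.
have ET : twisted c n [:: (g, e), (h, e') & t] =
  g * (zpow c (zs e n) * twisted c n ((h, e') :: t)) by rewrite mulgA.
rewrite ET block_valE Eb; move: (twisted c n ((h, e') :: t)) => V.
have -> : zpow c (- p)%R * (g * (zpow c (zs e n) * V)) * zpow c j =
  zpow c (- p)%R * (g * (zpow c (zs e n) * (V * zpow c j))) by rewrite !mulgA.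
by rewrite pg !zpowD zpowN -!mulgA mulKg.
Qed.

(* For large n all the exponents of the normalized product are large, so that it
   is a reduced word that follows C, whichever the power of c that precedes it;
   this is impossible for a power of c. *)
Lemma baumslag (t : seq (F * bool)) : t <> [::] ->
  (forall p, List.In p t -> ~ in_root p.1) ->
  exists n0 : nat, forall n : nat, (n0 <= n)%N -> ~ in_root (twisted c n t).
Proof.
move=> t0 ng; have [p0 [n0 H]] := twisted_good t0 ng; exists n0 => n ln [m Em].
have [T HT] := H n ln.
(* With a positive [j] of this size the product, margins included, is a power of [c] with
   nonnegative exponent, while the word built with the sign [false] begins with the inverse of
   [C]. *)
pose j : int := (T + `|p0| + `|m| + threshold)%N.
have [|b [s [good Eb]]] := HT j; first by rewrite /j; lia.
have Ew := @block_word_val _ _ _ A_basis C C_cyc false s b good.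
have pre := @block_word_prefix _ _ _ A_basis C C_cyc C_prim false b s (good b (or_introl erefl)).
have red := @block_word_reduced _ _ _ A_basis C C_cyc C_prim false (b :: s) good.
rewrite Eb Em -2!zpowD in Ew.
set z := zsign _ in Ew.
have csX e : csig e ^+ margin = zpow c (zs e margin) by rewrite csig_zpow.
rewrite !csX in Ew.
move: pre; rewrite -(nf_val A_basis red).
have -> : wv (@block_word F k A A_basis C false (b :: s)) = zpow c (zs false margin + (p0 + m + j) - zs z margin)%R.
  apply: (mulIg (zpow c (zs z margin))); rewrite Ew -!zpowD; congr zpow; lia.
by move/prefix_zpow => /=; rewrite /j /zs; case: z {Ew}; lia.
Qed.

End Root.
End Baumslag.

(** * Twists *)

Section TwistSystem.
Context {F : groupType} {k : nat} {A : 'I_k.+2 -> F} (A_basis : is_basis A).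
Implicit Types (g h x y z : F) (e : bool) (t : seq (F * bool)).
Local Notation wv := (word_val A).
Local Notation len := (len A_basis).

Lemma int_step (P : int -> Prop) : P 0%R ->
  (forall n, P n <-> P (n + 1)%R) -> forall n, P n.
Proof.
move=> P0 PS; have Pp (n : nat) : P n.
  elim: n => // n /PS; have -> : (Posz n + 1 = n.+1)%R by lia.
  by [].
case=> [//|n]; elim: n => [|n IH]; apply/PS.
  have -> : (Negz 0 + 1 = 0)%R by lia.
  by [].
have -> : (Negz n.+1 + 1 = Negz n)%R by lia.
by [].
Qed.

Lemma aut_mulE (f g : aut F) x : (f * g : aut F) x = f (g x). Proof. by []. Qed.

Lemma aut1E x : (1 : aut F) x = x. Proof. by []. Qed.

Definition itr (f : aut F) (n : int) : aut F := zpow f n.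

Lemma itrS (f : aut F) (n : int) x : itr f (n + 1)%R x = itr f n (f x).
Proof. by rewrite /itr zpowS. Qed.

Lemma autX (f : aut F) x n : f (x ^+ n) = f x ^+ n.
Proof.
elim: n => [|n IH]; last by rewrite !expgS autM IH.
by apply: (mulgI (f 1)); rewrite -autM !mulg1.
Qed.

Lemma aut_zpow (f : aut F) x (m : int) : f (zpow x m) = zpow (f x) m.
Proof. by case: m => n /=; rewrite ?autV autX. Qed.

Lemma zpow_conj z x (m : int) : zpow (z * x * z^-1) m = z * zpow x m * z^-1.
Proof. by case: m => n /=; rewrite expg_conj // !invgM invgK mulgA. Qed.

Lemma zpow_conjV z x (m : int) : zpow (z^-1 * x * z) m = z^-1 * zpow x m * z.
Proof. by have := zpow_conj z^-1 x m; rewrite invgK. Qed.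

Context {c0 : F} (c0_prim : not_proper_power c0) {d : aut F}.
(** [basic e g e'] models a step from one edge of an axis to the next, with the signs of the two
    crossings. By [b_twist], at a crossing of sign [e] the twist adds [c0] to the step after it if
    [e] holds, and the inverse of [c0] to the step before it otherwise. *)
Context {basic : bool -> F -> bool -> Prop}.
Context (b_root : forall e g e', basic e g e' -> ~ exists m, g = zpow c0 m).
Context (b_mull : forall e g e' m, basic e g e' -> basic e (zpow c0 m * g) e').
Context (b_mulr : forall e g e' m, basic e g e' -> basic e (g * zpow c0 m) e').
Context (d_c0 : d c0 = c0).
Context (b_twist : forall e g e', basic e g e' ->
  d g = zpow c0 (if e then 1 else 0)%R * g * zpow c0 (if e' then 0 else -1)%R).

Lemma twist_c0 (n m : int) : itr d n (zpow c0 m) = zpow c0 m.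
Proof.
by elim/int_step: n => // n; rewrite itrS [d _]aut_zpow d_c0.
Qed.

Lemma twist_basic (n : int) e g e' : basic e g e' ->
  itr d n g = zpow c0 (if e then n else 0)%R * g * zpow c0 (if e' then 0 else - n)%R.
Proof.
move=> bg; elim/int_step: n => [|n].
  by rewrite aut1E; case: e bg; case: e' => _; rewrite mul1g mulg1.
rewrite itrS (b_twist bg) !autM !twist_c0.
have -> : zpow c0 (if e then n + 1 else 0)%R =
    zpow c0 (if e then 1 else 0)%R * zpow c0 (if e then n else 0)%R.
  by rewrite -zpowD; case: (e) => //; rewrite GRing.addrC.
have -> : zpow c0 (if e' then 0 else - (n + 1))%R =
    zpow c0 (if e' then 0 else - n)%R * zpow c0 (if e' then 0 else -1)%R.
  by rewrite -zpowD; case: (e') => //; rewrite GRing.opprD.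
split=> [->|]; first by rewrite !mulgA.
by rewrite !mulgA => /mulIg; rewrite -!mulgA => /mulgI.
Qed.

Fixpoint tchain e t e' : Prop :=
  if t is p :: t' then basic e p.1 p.2 /\ tchain p.2 t' e' else e = e'.

Definition tprod t : F := foldr (fun p x => p.1 * x) 1 t.

Definition tlen t : nat := sumn [seq len p.1 | p <- t].

Lemma tchain_cat e t1 t2 e' e'' : tchain e t1 e' -> tchain e' t2 e'' ->
  tchain e (t1 ++ t2) e''.
Proof.
elim: t1 e => [|p t1 IH] e /=; first by move=> ->.
by move=> [bp ch] ch'; split=> //; exact: IH.
Qed.

Lemma tprod_cat t1 t2 : tprod (t1 ++ t2) = tprod t1 * tprod t2.
Proof. by elim: t1 => [|p t1 IH] /=; rewrite ?mul1g // IH mulgA. Qed.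

(** At each crossing the contributions of the two adjacent steps combine into one signed power; the
    outer factors come from the initial and the final sign, and disappear up to conjugation when
    these agree. *)
Lemma twist_tprod (n : int) e t e' : tchain e t e' ->
  itr d n (tprod t) =
  zpow c0 (if e then n else 0)%R * twisted c0 n t * zpow c0 (if e' then - n else 0)%R.
Proof.
elim: t e => [|[g e1] t IH] e /=.
  move=> <-; rewrite mulg1 -zpowD (twist_c0 n 0%R).
  by case: e; rewrite ?GRing.subrr.
move=> [bg ch]; rewrite autM (IH _ ch) (twist_basic n bg).
have -> : zpow c0 (zs e1 n) =
    zpow c0 (if e1 then 0 else - n)%R * zpow c0 (if e1 then n else 0)%R.
  by rewrite -zpowD; case: (e1); rewrite /= ?GRing.add0r ?GRing.addr0.
by rewrite !mulgA.
Qed.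

(** Merging blocks multiplies steps, and a product of steps need not be a step; this closure is the
    relation to which the normalization applies. *)
Definition edge_path e g e' := exists t, [/\ t <> [::], tchain e t e' & g = tprod t].

Lemma edge_path_mull e g e' m : edge_path e g e' -> edge_path e (zpow c0 m * g) e'.
Proof.
move=> [[|[h e1] t] [// _ [bh ch] ->]]; exists ((zpow c0 m * h, e1) :: t).
by split=> //=; [split=> //; exact: b_mull|rewrite !mulgA].
Qed.

Lemma edge_path_mul e g e' h e'' : edge_path e g e' -> edge_path e' h e'' ->
  edge_path e (g * h) e''.
Proof.
move=> [t1 [n1 ch1 ->]] [t2 [n2 ch2 ->]]; exists (t1 ++ t2); split.
- by case: t1 n1 {ch1}.
- exact: tchain_cat ch1 ch2.
- by rewrite tprod_cat.
Qed.

Lemma edge_path_mulr e g e' m : edge_path e g e' -> edge_path e (g * zpow c0 m) e'.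
Proof.
move=> [t [n0 ch ->]]; elim: t e n0 ch => // [[h e1] t] IH e _ [bh ch].
case: t IH ch => [|q t] IH ch.
  exists [:: (h * zpow c0 m, e1)]; split=> //=; last by rewrite !mulg1.
  by split=> //; exact: b_mulr.
have [//|t' [n' ch' E]] := IH _ _ ch; exists ((h, e1) :: t'); split=> //.
by rewrite [RHS]/= -/(tprod t') -E [RHS]mulgA.
Qed.

Lemma twisted_conj z (n : int) c t :
  twisted (z^-1 * c * z) n [seq (z^-1 * p.1 * z, p.2) | p <- t] = z^-1 * twisted c n t * z.
Proof.
elim: t => [|[g e] t IH] /=; first by rewrite mulg1 mulVg.
by rewrite IH zpow_conjV !mulgA !mulgK.
Qed.

Section Conjugated.
Context {C : seq (letter k)} (C_cyc : cyc_reduced C) {z : F}.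
Context (z_C : c0 = z * wv C * z^-1).

Lemma wv_C_prim : not_proper_power (wv C).
Proof.
move=> g n E; apply: (c0_prim (g := z * g * z^-1)).
by rewrite z_C E expg_conj.
Qed.

Lemma wv_C_conj : wv C = z^-1 * c0 * z.
Proof. by rewrite z_C !mulgA mulVg mul1g mulgVK. Qed.

Lemma in_root_conj g : @in_root F k A C (z^-1 * g * z) <-> exists m, g = zpow c0 m.
Proof.
split=> -[m E]; exists m.
  by rewrite z_C zpow_conj -E !mulgA mulgV mul1g mulgK.
by rewrite wv_C_conj E zpow_conjV.
Qed.

(** The twist would fix such a power, and then the twisted product would be a power of [c0] for
    every [N], against [baumslag]. *)
Lemma edge_path_root e g e' : edge_path e g e' -> ~ exists m, g = zpow c0 m.
Proof.
move=> [t [n0 ch ->]] [m Em].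
pose t' := [seq (z^-1 * p.1 * z, p.2) | p <- t].
have t'0 : t' <> [::] by move: n0; rewrite /t'; case: (t).
have [|N HN] := baumslag A_basis C_cyc wv_C_prim t'0.
  rewrite /t' => p; elim: (t) e ch {n0 Em} => // [[h e1] s] IH e [bh ch] [<-|inp].
    by move=> /in_root_conj; exact: b_root bh.
  exact: IH ch inp.
apply: (HN N) => //; rewrite wv_C_conj twisted_conj; apply/in_root_conj.
have := twist_tprod N ch; rewrite Em twist_c0 => E.
exists (- (if e then Posz N else 0) + m - (if e' then - Posz N else 0))%R.
by rewrite !zpowD !zpowN E -!mulgA mulKg mulgV mulg1.
Qed.

(** The estimate for a cyclically reduced root is transported by conjugation by [z], at the price of
    [2 * len z] letters per block. *)
Theorem twist_estimate_conj (L : F -> nat) B lam : quasi_add A_basis L B ->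
  homog L c0 lam -> exists K, forall e t X (n : int) mu, tchain e t e -> t <> [::] ->
    conj X (tprod t) -> homog L (itr d n X) mu ->
    (mu <= `|n| * size t * lam + K * (tlen t + size t))%N /\
    (`|n| * size t * lam <= mu + K * (tlen t + size t))%N.
Proof.
move=> qaL homL; pose E e g e' := edge_path e (z * g * z^-1) e'.
have homC : homog L (wv C) lam.
  by apply: homog_conj qaL _ homL; exists z^-1; rewrite invgK wv_C_conj.
have zK g : z^-1 * (z * g * z^-1) * z = g by rewrite !mulgA mulVg mul1g mulgVK.
have zK' g : z * (z^-1 * g * z) * z^-1 = g by rewrite !mulgA mulgV mul1g mulgK.
have [||||K HK] := @homog_twist_estimate _ _ _ A_basis C C_cyc wv_C_prim E _ _ _ _ L B lam qaL homC.
- move=> e g e' Eg; rewrite -(zK g) => /in_root_conj; exact: edge_path_root Eg.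
- move=> e g e' m Eg; rewrite /E; have -> : z * (zpow (wv C) m * g) * z^-1 =
     zpow c0 m * (z * g * z^-1) by rewrite z_C zpow_conj !mulgA mulgVK.
  exact: edge_path_mull.
- move=> e g e' m Eg; rewrite /E; have -> : z * (g * zpow (wv C) m) * z^-1 =
     (z * g * z^-1) * zpow c0 m by rewrite z_C zpow_conj !mulgA mulgVK.
  exact: edge_path_mulr.
- move=> e g e' h e'' Eg Eh; rewrite /E.
  have -> : z * (g * h) * z^-1 = (z * g * z^-1) * (z * h * z^-1) by rewrite !mulgA mulgVK.
  exact: edge_path_mul Eg Eh.
exists (K * (2 * len z + 1))%N => e t X n mu ch t0 cj hX.
pose s := [seq (z^-1 * p.1 * z, zs p.2 n) | p <- t].
have sE : block_exp s = (`|n| * size t)%N.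
  rewrite /s; elim: (t) => [|[g e1] t' IH]; first by rewrite muln0.
  rewrite /= block_expE IH mulnS; congr (_ + _)%N.
  by case: e1; rewrite //=; lia.
have sL : (block_len A_basis s <= tlen t + 2 * len z * size t)%N.
  rewrite /s; elim: (t) => [|[g e1] t' IH] //.
  rewrite /= block_lenE mulnS /tlen /= -/(tlen t').
  have := lenM A_basis (z^-1 * g) z; have := lenM A_basis z^-1 g; rewrite lenV.
  move: (2 * len z * size t')%N (block_len _ _) IH => M D IH h1 h2.
  apply: leq_trans (leq_add (leq_trans h2 (leq_add h1 (leqnn _))) IH) _.
  by rewrite mul2n -addnn; lia.
have sV : conj (itr d n X) (block_val (wv C) s).
  have h1 : conj (itr d n X) (itr d n (tprod t)).
    by case: cj => y ->; exists (itr d n y); rewrite !autM autV.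
  apply: conj_trans h1 _; rewrite (twist_tprod n ch).
  have -> : block_val (wv C) s = z^-1 * twisted c0 n t * z.
    rewrite -twisted_conj -wv_C_conj /s.
    by elim: (t) => //= p t' ->.
  apply: (@conj_trans _ (twisted c0 n t)); last by exists z^-1; rewrite invgK.
  exists (zpow c0 (if e then n else 0)%R)^-1; rewrite invgK.
  by rewrite -!mulgA mulKg -zpowD; case: (e); rewrite ?GRing.addNr ?mulg1.
have sC : @cyc_chain _ E s.
  exists e; rewrite /s; elim: (t) {1 3}e ch => //= -[g e1] t' IH e2 [bg ch].
  exists e1; last exact: IH.
  by exists [:: (g, e1)]; split=> //=; rewrite mulg1 zK'.
have s0 : s <> [::] by rewrite /s; case: (t) t0.
have [h1 h2] := HK s _ mu sC s0 sV hX.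
rewrite sE /s size_map -/s in h1 h2.
have h3 : (K * (block_len A_basis s + size t) <= K * (2 * len z + 1) * (tlen t + size t))%N.
  by rewrite -mulnA leq_mul2l; apply/orP; right; nia.
by split; [apply: leq_trans h1 _|apply: leq_trans h2 _]; rewrite leq_add2l.
Qed.

End Conjugated.

Theorem twist_estimate (L : F -> nat) B lam : quasi_add A_basis L B ->
  homog L c0 lam -> exists K, forall e t X (n : int) mu, tchain e t e -> t <> [::] ->
    conj X (tprod t) -> homog L (itr d n X) mu ->
    (mu <= `|n| * size t * lam + K * (tlen t + size t))%N /\
    (`|n| * size t * lam <= mu + K * (tlen t + size t))%N.
Proof.
by have [z [C [cC EC _]]] := cyc_conj A_basis c0; exact: twist_estimate_conj cC z EC L B lam.
Qed.

End TwistSystem.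

(** * Splittings *)

Section Generation.
Context {F : groupType}.

Record subgrp := Subgrp {
  sg_set : set F;
  sg_1 : sg_set 1;
  sg_M : forall x y, sg_set x -> sg_set y -> sg_set (x * y);
  sg_V : forall x, sg_set x -> sg_set x^-1 }.

(** The universal properties speak of maps into group types, so a subgroup is made one before it
    serves as a target. *)
Definition sub_of (S : subgrp) := {x : F | `[< sg_set S x >]}.
HB.instance Definition _ S := SubType.on (sub_of S).
HB.instance Definition _ S := Choice.on (sub_of S).

Section Operations.
Context (S : subgrp).
Implicit Types x y : sub_of S.

Definition sub_in g (h : sg_set S g) : sub_of S :=
  exist (fun x : F => `[< sg_set S x >]) g (asboolT h).
Lemma sub_valP x : sg_set S (val x). Proof. exact: asboolW (valP x). Qed.
Definition sub_one := sub_in (sg_1 S).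
Definition sub_mul x y := sub_in (sg_M (sub_valP x) (sub_valP y)).
Definition sub_inv x := sub_in (sg_V (sub_valP x)).

Lemma sub_mulA : associative sub_mul.
Proof. by move=> x y z; apply: val_inj; rewrite /= mulgA. Qed.
Lemma sub_mul1g : left_id sub_one sub_mul.
Proof. by move=> x; apply: val_inj; rewrite /= mul1g. Qed.
Lemma sub_mulg1 : right_id sub_one sub_mul.
Proof. by move=> x; apply: val_inj; rewrite /= mulg1. Qed.
Lemma sub_mulVg : left_inverse sub_one sub_inv sub_mul.
Proof. by move=> x; apply: val_inj; rewrite /= mulVg. Qed.
Lemma sub_mulgV : right_inverse sub_one sub_inv sub_mul.
Proof. by move=> x; apply: val_inj; rewrite /= mulgV. Qed.
End Operations.

HB.instance Definition _ S := isGroup.Build (sub_of S)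
  (@sub_mulA S) (@sub_mul1g S) (@sub_mulg1 S) (@sub_mulVg S) (@sub_mulgV S).

Definition corestrict (S : subgrp) (g : F) : sub_of S := insubd (1 : sub_of S) g.

Lemma val_corestrict S g : sg_set S g -> val (corestrict S g) = g.
Proof. by move=> Sg; rewrite val_insubd asboolT. Qed.

Lemma corestrict_morph S (A : set F) : A `<=` sg_set S ->
  (forall x y, A x -> A y -> A (x * y)) -> morph_on A (corestrict S).
Proof.
move=> AS AM x y Ax Ay; apply: val_inj.
by rewrite [RHS]/= !val_corestrict; [|exact: AS|exact: AS|apply: AS; exact: AM].
Qed.

Lemma morph_on_val S (f : F -> sub_of S) :
  morph_on setT f -> morph_on setT (fun x => val (f x)).
Proof. by move=> fM x y Tx Ty; rewrite fM. Qed.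

Lemma is_subgroup1 (A : set F) : is_subgroup A -> A 1.
Proof. by case; rewrite inE. Qed.

Lemma is_subgroupM (A : set F) x y : is_subgroup A -> A x -> A y -> A (x * y).
Proof.
move=> sA Ax Ay; have /(_ x y) := group_closedM sA; rewrite !inE; exact.
Qed.

Lemma is_subgroupV (A : set F) x : is_subgroup A -> A x -> A x^-1.
Proof. by move=> sA Ax; have /(_ x) := group_closedV sA; rewrite !inE; exact. Qed.

Lemma is_subgroup_zpow (A : set F) x m : is_subgroup A -> A x -> A (zpow x m).
Proof.
move=> sA Ax; have Xn n : A (x ^+ n).
  elim: n => [|n IH]; first exact: is_subgroup1.
  by rewrite expgS; exact: is_subgroupM.
by case: m => n /=; [|apply: is_subgroupV].
Qed.

(** The inclusions of the factors into [S] extend to a homomorphism, which followed by the inclusion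
    of [S] is the identity by uniqueness. *)
Lemma amalgam_generated (A B : set F) c (S : subgrp) : is_amalgam A B c ->
  A `<=` sg_set S -> B `<=` sg_set S -> forall x, sg_set S x.
Proof.
move=> [sA sB Ac Bc U] AS BS x.
have fA := corestrict_morph AS (fun x y => is_subgroupM sA).
have fB := corestrict_morph BS (fun x y => is_subgroupM sB).
have [f [[fM fa fb] _]] := U _ _ _ fA fB erefl.
have [g [_ gU]] := U F id id (fun _ _ _ _ => erefl) (fun _ _ _ _ => erefl) erefl.
have E1 : g = id by apply: gU.
have E2 : g = (fun x => val (f x)).
  apply: gU; split; first exact: morph_on_val.
  - by move=> a Aa; rewrite fa // val_corestrict //; exact: AS.
  - by move=> b Bb; rewrite fb // val_corestrict //; exact: BS.
have -> : x = val (f x) by rewrite -[LHS]/(id x) -E1 E2.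
exact: sub_valP.
Qed.

Lemma hnn_generated (A : set F) t a0 a1 (S : subgrp) : is_hnn A t a0 a1 ->
  A `<=` sg_set S -> sg_set S t -> forall x, sg_set S x.
Proof.
move=> [sA Aa0 Aa1 Et U] AS St x.
have fA := corestrict_morph AS (fun x y => is_subgroupM sA).
have [|f [[fM fa ft] _]] := U _ _ (corestrict S t) fA.
  apply: val_inj; rewrite [LHS]/= !val_corestrict //; exact: AS.
have [g [_ gU]] := U F id t (fun _ _ _ _ => erefl) Et.
have E1 : g = id by apply: gU.
have E2 : g = (fun x => val (f x)).
  apply: gU; split; first exact: morph_on_val.
  - by move=> a Aa; rewrite fa // val_corestrict //; exact: AS.
  - by rewrite ft val_corestrict.
have -> : x = val (f x) by rewrite -[LHS]/(id x) -E1 E2.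
exact: sub_valP.
Qed.

End Generation.

Lemma In_cat (T : Type) (p : T) s1 s2 : List.In p (s1 ++ s2) <-> List.In p s1 \/ List.In p s2.
Proof. exact: List.in_app_iff. Qed.

Section CyclicAdjacency.
Context {T : Type} (e : rel T).
Implicit Types (l s : seq T).

Lemma not_path x s : ~~ path e x s -> exists s1 y z s2,
  x :: s = s1 ++ [:: y, z & s2] /\ ~~ e y z.
Proof.
elim: s x => //= y s IH x; rewrite negb_and.
have [exy /IH[s1 [z [w [s2 [-> nzw]]]]]|nexy _] := boolP (e x y).
  by exists (x :: s1), z, w, s2.
by exists [::], x, y, s.
Qed.

(** A failure between cyclic neighbours is rotated to the front, where the reductions act. A single
    entry is its own neighbour and forms a case apart. *)
Lemma not_cycle l : ~~ cycle e l -> exists p q m, ~~ e p q /\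
  ((l = [:: p] /\ q = p) \/ exists l1 l2, l = l1 ++ l2 /\ l2 ++ l1 = [:: p, q & m]).
Proof.
case: l => // x s /not_path[s1 [y [z [s2 [E nyz]]]]]; rewrite -rcons_cons in E.
exists y, z; case: (lastP s2) E => [|s2' x'] E.
  have {}E : rcons (x :: s) x = rcons (rcons s1 y) z by rewrite E -cats1 -!cats1 -catA.
  move/rcons_inj: E => [E Ez].
  case: s1 E => [|x1 s1] [].
    by move=> Ey Es; exists [::]; split=> //; left; rewrite Es -Ez Ey.
  move=> Ex Es; exists s1; split=> //; right; exists (x :: s1), [:: y].
  by rewrite Es -Ez /= cats1.
have {}E : rcons (x :: s) x = rcons (s1 ++ [:: y, z & s2']) x' by rewrite E rcons_cat.
move/rcons_inj: E => [E _]; exists (s2' ++ s1); split=> //; right.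
by exists s1, [:: y, z & s2'].
Qed.

End CyclicAdjacency.

(** * Cyclic reduction in amalgams and HNN-extensions *)

Section Splittings.
Context {F : groupType} {k : nat} {A0 : 'I_k.+2 -> F} (A_basis : is_basis A0).
Implicit Types (g h x y z : F) (e : bool).
Local Notation len := (len A_basis).

(** Expressions of the finitely many letters are fixed once and concatenated, so that the weight is
    linear in the length of the word. *)
Lemma weighted_syllables (T : Type) (tval : T -> F) (valid : T -> Prop) (wt : T -> nat) :
  (forall x, exists l : seq T, (forall p, List.In p l -> valid p) /\
     foldr (fun p y => tval p * y) 1 l = x) ->
  exists K, forall w, exists l : seq T, [/\ forall p, List.In p l -> valid p,
     foldr (fun p y => tval p * y) 1 l = word_val A0 w &
     (sumn (map wt l) <= K * size w)%N].
Proof.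
move=> H; pose f (a : letter k) := sval (cid (H (letter_val A0 a))).
exists (\max_(a : letter k) sumn (map wt (f a)))%N; elim=> [|a w [l [vl El wl]]].
  by exists [::]; rewrite muln0.
have := svalP (cid (H (letter_val A0 a))); rewrite -/(f a) => -[vf Ef].
exists (f a ++ l); split.
- by move=> p /In_cat[]; [exact: vf|exact: vl].
- by rewrite foldr_cat El /= -Ef; elim: (f a) => [|p s IH] /=; rewrite ?mul1g // IH mulgA.
- by rewrite map_cat sumn_cat /= mulnS leq_add // (leq_bigmax a).
Qed.

Section AmalgamCase.
Context {A B : set F} {c : F} (am : is_amalgam A B c).
Local Notation in_c g := (exists m, g = zpow c m).

(* The signs alternate since the twist conjugates B by c and fixes A. *)
Definition am_basic e g e' := e = ~~ e' /\ (if e' then A g else B g) /\ ~ in_c g.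

Definition am_valid (p : bool * F) := if p.1 then A p.2 else B p.2.
Definition am_val (l : seq (bool * F)) : F := foldr (fun p y => p.2 * y) 1 l.
Definition am_weight (l : seq (bool * F)) : nat := sumn [seq (len p.2).+1 | p <- l].

Lemma am_subgroup (b : bool) : is_subgroup (if b then A else B).
Proof. by case: am => sA sB _ _ _; case: b. Qed.

Lemma am_c (b : bool) : (if b then A else B) c.
Proof. by case: am => _ _ Ac Bc _; case: b. Qed.

Lemma am_validE b g : am_valid (b, g) = (if b then A else B) g.
Proof. by case: b. Qed.

Lemma am_syllables x : exists l, (forall p, List.In p l -> am_valid p) /\ am_val l = x.
Proof.
pose P x := exists l, (forall p, List.In p l -> am_valid p) /\ am_val l = x.
have P1 : P 1 by exists [::].
have PM y z : P y -> P z -> P (y * z).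
  move=> [l1 [v1 <-]] [l2 [v2 <-]]; exists (l1 ++ l2); split.
    by move=> p /In_cat[]; [exact: v1|exact: v2].
  by elim: l1 {v1} => [|p l1 IH] /=; rewrite ?mul1g // IH mulgA.
have PV y : P y -> P y^-1.
  move=> [l [vl <-]]; elim: l vl => [|[b g] l IH] vl; first by rewrite invg1.
  rewrite /= invgM; apply: PM; first by apply: IH => p ip; apply: vl; right.
  exists [:: (b, g^-1)]; rewrite /= mulg1; split=> // p [<-|[]]; rewrite am_validE.
  apply: is_subgroupV; first exact: am_subgroup.
  by rewrite -am_validE; apply: vl; left.
apply: (amalgam_generated (S := Subgrp P1 PM PV) am).
- by move=> a Aa; exists [:: (true, a)]; rewrite /= mulg1; split=> // p [<-|[]].
- by move=> b Bb; exists [:: (false, b)]; rewrite /= mulg1; split=> // p [<-|[]].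
Qed.

Definition am_elliptic x := exists y, A (y * x * y^-1) \/ B (y * x * y^-1).

Lemma am_elliptic_conj x y : conj x y -> am_elliptic y -> am_elliptic x.
Proof. by move=> [z ->] [u H]; exists (u * z); rewrite invgM !mulgA in H *. Qed.

Lemma am_val_cat l1 l2 : am_val (l1 ++ l2) = am_val l1 * am_val l2.
Proof. by elim: l1 => [|p l1 IH] /=; rewrite ?mul1g // IH mulgA. Qed.

(** Only the second syllable is required to lie outside the edge group: around a cycle every
    syllable is the second of some pair. *)
Definition am_next (p q : bool * F) := `[< p.1 = ~~ q.1 /\ ~ in_c q.2 >].

Lemma am_path p s : path am_next p s -> (forall q, List.In q s -> am_valid q) ->
  let t := [seq (q.2, q.1) | q <- s] in
  [/\ @tchain F am_basic p.1 t (last p s).1, tprod t = am_val s &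
      (tlen A_basis t + size t = am_weight s)%N].
Proof.
elim: s p => [|q s IH] p //= /andP[/asboolP[pq nq] ps] vs.
have [|ch Et Es] := IH _ ps; first by move=> r ir; apply: vs; right.
split=> /=.
- split=> //; split=> //; split=> //.
  by have := vs q (or_introl erefl); rewrite /am_valid.
- by rewrite Et.
- by rewrite /am_weight /= -/(am_weight s) -Es /tlen /=; lia.
Qed.

(** Neighbours that violate [am_next] are multiplied into one syllable. The weight, which also
    counts the syllables, does not increase, by the triangle inequality. *)
Lemma am_reduce l : (forall p, List.In p l -> am_valid p) ->
  am_elliptic (am_val l) \/ exists e t, [/\ @tchain F am_basic e t e, t <> [::],
    conj (am_val l) (tprod t) & (tlen A_basis t + size t <= am_weight l)%N].
Proof.
have [n] := ubnP (size l); elim: n l => // n IH l ltn vl.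
case: l ltn vl => [|p0 l0] ltn vl.
  by left; exists 1; left; rewrite mul1g invg1 mulg1; apply: is_subgroup1 (am_subgroup true).
case: l0 ltn vl => [|q0 l0] ltn vl.
  left; exists 1; rewrite /= mul1g invg1 !mulg1.
  by have := vl p0 (or_introl erefl); rewrite /am_valid; case: ifP; [left|right].
set l := [:: p0, q0 & l0] in ltn vl *.
have [cy|/not_cycle[p [q [m [npq [[]|[l1 [l2 [El El']]]]]]]]] := boolP (cycle am_next l).
- right; have := @am_path p0 (rcons (q0 :: l0) p0) cy.
  case=> [r|ch Et Es].
    by rewrite -cats1 => /In_cat[ir|[<-|[]]]; apply: vl; [right|left].
  exists p0.1, [seq (q.2, q.1) | q <- rcons (q0 :: l0) p0]; split=> //.
  + by rewrite last_rcons in ch.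
  + rewrite Et -cats1 am_val_cat /= mulg1; exact: conj_rot.
  + rewrite Es -cats1 /am_weight map_cat sumn_cat /= addn0.
    by rewrite addnC.
- by [].
- have cj : conj (am_val l) (am_val ((p.1, p.2 * q.2) :: m)).
    rewrite El am_val_cat; have -> : am_val ((p.1, p.2 * q.2) :: m) = am_val (l2 ++ l1).
      by rewrite El' /= mulgA.
    by rewrite am_val_cat; exact: conj_rot.
  have inl r : List.In r (l2 ++ l1) -> am_valid r.
    move=> ir; apply: vl; rewrite El; apply/In_cat.
    by case/In_cat: ir; [right|left].
  have wl : am_weight l = am_weight [:: p, q & m].
    by rewrite El -El' /am_weight !map_cat !sumn_cat addnC.
  have [||el|[e [t [ch n0 cj' wt]]]] := IH ((p.1, p.2 * q.2) :: m).
  + by rewrite -ltnS; apply: leq_trans ltn; rewrite El size_cat addnC -size_cat El'.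
  + move=> r [<-|ir]; last by apply: inl; rewrite El'; right; right.
    have vp := inl p; have vq := inl q; rewrite El' in vp vq.
    have {}vp := vp (or_introl erefl); have {}vq := vq (or_intror (or_introl erefl)).
    rewrite am_validE; apply: is_subgroupM; first exact: am_subgroup.
      by move: vp; case: (p) => b g; rewrite am_validE.
    (* Either both syllables lie in the same factor, or the second is a power of [c] and lies in
       both. *)
    move: npq vp vq; case: (p) (q) => b g [b' h] /asboolPn npq vp vq /=.
    have [Eb|nb] := eqVneq b b'; first by rewrite Eb -am_validE.
    have [[j ->]|nc] := pselect (in_c h).
      by apply: is_subgroup_zpow; [exact: am_subgroup|exact: am_c].
    by case: npq; split=> //=; move: nb; case: b b' {vp vq} => [] [].
  + by left; apply: am_elliptic_conj cj el.
  + right; exists e, t; split=> //; first exact: conj_trans cj cj'.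
    apply: leq_trans wt _; rewrite wl /am_weight /=.
    have := lenM A_basis p.2 q.2; move: (len _) (sumn _) => a b; lia.
Qed.

End AmalgamCase.
Section HNNCase.
Context {A : set F} {t a0 a1 : F} (hn : is_hnn A t a0 a1).
Implicit Types (l : seq (F * bool)).

Definition stable_letter e := if e then t else t^-1.
(** Indexed so that a pinch, a power of [edge_elt e] between [stable_letter e] and its inverse, lies
    in [A] again. *)
Definition edge_elt e := if e then a1 else a0.
Local Notation in_edge e g := (exists m, g = zpow (edge_elt e) m).

Lemma hn_subgroup : is_subgroup A. Proof. by case: hn. Qed.

Lemma hn_edge e : A (edge_elt e). Proof. by case: hn => _ ? ? _ _; case: e. Qed.

Lemma hn_relation e m :
  stable_letter e * zpow (edge_elt e) m * stable_letter (~~ e) = zpow (edge_elt (~~ e)) m.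
Proof.
have [_ _ _ Et _] := hn; case: e => /=; last by rewrite -Et -zpow_conjV.
by rewrite -Et zpow_conjV !mulgA mulgV mul1g mulgK.
Qed.

Definition hn_val l : F := foldr (fun p y => p.1 * stable_letter p.2 * y) 1 l.
Definition hn_weight l : nat := sumn [seq (len p.1 + 2 * len t).+1 | p <- l].
Definition hn_valid (p : F * bool) := A p.1.

(** A syllable may lack a stable letter, so that elements of [A] are syllables too; [hn_collect]
    absorbs these into their successors. *)
Definition syl_val (p : F * option bool) : F :=
  p.1 * (if p.2 is Some e then stable_letter e else 1).
Definition syl_weight (p : F * option bool) : nat := (len p.1 + 2 * len t).+1.

Lemma hn_syllables x : exists s : seq (F * option bool),
  (forall p, List.In p s -> A p.1) /\ foldr (fun p y => syl_val p * y) 1 s = x.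
Proof.
pose P x := exists s : seq (F * option bool),
  (forall p, List.In p s -> A p.1) /\ foldr (fun p y => syl_val p * y) 1 s = x.
have A1 : A 1 := is_subgroup1 hn_subgroup.
have Pt e : P (stable_letter e).
  by exists [:: (1, Some e)]; rewrite /= /syl_val /= mul1g mulg1; split=> // p [<-|[]].
have Pa a : A a -> P a.
  by exists [:: (a, None)]; rewrite /= /syl_val /= !mulg1; split=> // p [<-|[]].
have PM y z : P y -> P z -> P (y * z).
  move=> [l1 [v1 <-]] [l2 [v2 <-]]; exists (l1 ++ l2); split.
    by move=> p /In_cat[]; [exact: v1|exact: v2].
  by elim: l1 {v1} => [|p l1 IH] /=; rewrite ?mul1g // IH mulgA.
have PV y : P y -> P y^-1.
  move=> [l [vl <-]]; elim: l vl => [|[a o] l IH] vl; first by rewrite /= invg1; exact: Pa.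
  rewrite /= /syl_val /= !invgM; apply: (PM); first by apply: IH => p ip; apply: vl; right.
  apply: (PM); last by apply: Pa; apply: is_subgroupV hn_subgroup _; apply: (vl (a, o)); left.
  case: o {vl} => [e|]; last by rewrite invg1; exact: Pa.
  by have := Pt (~~ e); case: e; rewrite /= ?invgK.
apply: (hnn_generated (S := Subgrp (Pa _ A1) PM PV) hn); first exact: Pa.
exact: (Pt true).
Qed.

Lemma hn_collect (s : seq (F * option bool)) : (forall p, List.In p s -> A p.1) ->
  exists l a, [/\ forall p, List.In p l -> hn_valid p, A a,
    foldr (fun p y => syl_val p * y) 1 s = hn_val l * a &
    (hn_weight l + len a <= sumn (map syl_weight s))%N].
Proof.
elim: s => [|[b o] s IH] vs.
  by exists [::], 1; split=> //; [exact: is_subgroup1 hn_subgroup|rewrite mulg1|rewrite len1].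
have Ab : A b := vs (b, o) (or_introl erefl).
have [|l [a [vl Aa El wl]]] := IH; first by move=> p ip; apply: vs; right.
case: o {vs} => [e|].
  exists ((b, e) :: l), a; split=> //.
  - by move=> p [<-//|]; exact: vl.
  - by rewrite /= /syl_val /= El !mulgA.
  - by rewrite /hn_weight /= -/(hn_weight l) /syl_weight -addnA leq_add2l.
case: l vl El wl => [|[b' e] l] vl El wl.
  exists [::], (b * a); split=> //; first exact: is_subgroupM hn_subgroup _ _.
  - by rewrite /= /syl_val /= El mulg1 !mul1g.
  - have -> : sumn (map syl_weight ((b, None) :: s)) =
      ((len b + 2 * len t).+1 + sumn (map syl_weight s))%N by [].
    move: wl (lenM A_basis b a); rewrite !add0n.
    by move: (sumn _) (len (b * a)) (2 * _)%N => x y z; lia.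
exists ((b * b', e) :: l), a; split=> //.
- move=> p [<-|ip]; last by apply: vl; right.
  by apply: is_subgroupM hn_subgroup Ab _; apply: (vl (b', e)); left.
- by rewrite /= /syl_val /= El /= mulg1 !mulgA.
- move: wl; rewrite /hn_weight /syl_weight /=; have := lenM A_basis b b'.
  move: (sumn _) (sumn _) (len (b * b')) => x y z; lia.
Qed.

Definition hn_elliptic x := exists y, A (y * x * y^-1).

Lemma hn_elliptic_conj x y : conj x y -> hn_elliptic y -> hn_elliptic x.
Proof. by move=> [z ->] [u H]; exists (u * z); rewrite invgM !mulgA in H *. Qed.

Lemma hn_elliptic_in x : A x -> hn_elliptic x.
Proof. by exists 1; rewrite mul1g invg1 mulg1. Qed.

Lemma hn_val_cat l1 l2 : hn_val (l1 ++ l2) = hn_val l1 * hn_val l2.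
Proof. by elim: l1 => [|p l1 IH] /=; rewrite ?mul1g // IH !mulgA. Qed.

Definition hn_basic e g e' := exists a,
  [/\ A a, g = (if e then t else 1) * a * (if e' then 1 else t^-1) &
      e = e' \/ ~ in_edge e a].

Definition hn_next (p q : F * bool) := `[< p.2 = q.2 \/ ~ in_edge p.2 q.1 >].

Fixpoint hn_list e l : seq (F * bool) :=
  if l is q :: l' then
    ((if e then t else 1) * q.1 * (if q.2 then 1 else t^-1), q.2) :: hn_list q.2 l'
  else [::].

Lemma hn_path p s : path hn_next p s -> (forall q, List.In q s -> hn_valid q) ->
  [/\ @tchain F hn_basic p.2 (hn_list p.2 s) (last p s).2,
      tprod (hn_list p.2 s) * (if (last p s).2 then t else 1) =
      (if p.2 then t else 1) * hn_val s &
      (tlen A_basis (hn_list p.2 s) + size (hn_list p.2 s) <= hn_weight s)%N].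
Proof.
elim: s p => [|q s IH] p; first by move=> _ _; rewrite /= mul1g mulg1.
rewrite [path _ _ _]/= [last _ _]/= => /andP[/asboolP pq ps] vs.
have [|ch Et Es] := IH _ ps; first by move=> r ir; apply: vs; right.
split.
- split=> //=; exists q.1; split=> //; exact: vs (or_introl erefl).
- rewrite [LHS]/= -mulgA -/(tprod _) Et /= !mulgA; congr (_ * _).
  by rewrite -!mulgA; congr (_ * (_ * _)); case: (q.2); rewrite /= ?mul1g ?mulg1.
- rewrite /= /tlen /= -/(tlen A_basis _) /hn_weight /= -/(hn_weight s).
  set g := _ * _ * _.
  have lg : (len g <= len q.1 + 2 * len t)%N.
    rewrite /g; apply: leq_trans (lenM _ _ _) _.
    have := lenM A_basis (if p.2 then t else 1) q.1.
    have h1 : (len (if p.2 then t else 1)%g <= len t)%N by case: (p.2); rewrite ?len1.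
    have h2 : (len (if q.2 then 1 else t^-1)%g <= len t)%N by case: (q.2); rewrite ?len1 ?lenV.
    rewrite mul2n -addnn; lia.
  by move: lg Es; lia.
Qed.

(** A cyclic pinch is replaced by the power it equals, which is merged with the neighbouring
    elements of [A]. The length of that power is bounded by the pinch; this is the reason for
    [2 * len t] in the weights. *)
Lemma hn_reduce l : (forall p, List.In p l -> hn_valid p) ->
  hn_elliptic (hn_val l) \/ exists e s, [/\ @tchain F hn_basic e s e, s <> [::],
    conj (hn_val l) (tprod s) & (tlen A_basis s + size s <= hn_weight l)%N].
Proof.
have [n] := ubnP (size l); elim: n l => // n IH l ltn vl.
case: l ltn vl => [|p0 l0] ltn vl.
  by left; apply: hn_elliptic_in; apply: is_subgroup1 hn_subgroup.
set l := p0 :: l0 in ltn vl *.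
have [cy|/not_cycle[p [q [m [npq [[_ Eq]|[l1 [l2 [El El']]]]]]]]] := boolP (cycle hn_next l).
- right; have := @hn_path p0 (rcons l0 p0) cy.
  case=> [r|ch Et Es].
    by rewrite -cats1 => /In_cat[ir|[<-|[]]]; apply: vl; [right|left].
  rewrite last_rcons in ch Et.
  exists p0.2, (hn_list p0.2 (rcons l0 p0)); split=> //; first by case: (l0).
  + have -> : tprod (hn_list p0.2 (rcons l0 p0)) = (if p0.2 then t else 1) *
        hn_val (rcons l0 p0) * (if p0.2 then t else 1)^-1 by rewrite -Et mulgK.
    apply: (@conj_trans _ (hn_val (rcons l0 p0))); last by eexists.
    by rewrite -cats1 hn_val_cat /= mulg1; exact: conj_rot.
  + apply: leq_trans Es _; rewrite -cats1 /hn_weight map_cat sumn_cat /= addn0.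
    by rewrite addnC.
- by case/negP: npq; apply/asboolP; left; rewrite Eq.
move/asboolPn: npq => npq.
have pq2 : q.2 = ~~ p.2.
  by have [E|] := eqVneq p.2 q.2; [case: npq; left|case: (p.2) (q.2) => [] []].
have [j Ej] : in_edge p.2 q.1.
  by have [//|ne] := pselect (in_edge p.2 q.1); case: npq; right.
have cj : conj (hn_val l) (p.1 * zpow (edge_elt (~~ p.2)) j * hn_val m).
  rewrite El hn_val_cat; apply: conj_trans (conj_rot _ _) _; rewrite -hn_val_cat El' /=.
  by rewrite -(hn_relation p.2 j) Ej pq2 !mulgA; exact: conj_refl.
have inl r : List.In r (l2 ++ l1) -> hn_valid r.
  move=> ir; apply: vl; rewrite El; apply/In_cat.
  by case/In_cat: ir; [right|left].
have wl : hn_weight l = hn_weight [:: p, q & m].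
  by rewrite El -El' /hn_weight !map_cat !sumn_cat addnC.
rewrite El' in inl.
have Apq : A (p.1 * zpow (edge_elt (~~ p.2)) j).
  apply: is_subgroupM hn_subgroup _ _; first exact: (inl p (or_introl erefl)).
  exact: is_subgroup_zpow hn_subgroup (hn_edge _).
case: m El' cj wl inl => [|r m] El' cj wl inl.
  by left; apply: hn_elliptic_conj cj _; rewrite mulg1; exact: hn_elliptic_in.
have lq : (len (zpow (edge_elt (~~ p.2)) j) <= len q.1 + 2 * len t)%N.
  rewrite -hn_relation -Ej; apply: leq_trans (lenM _ _ _) _.
  have := lenM A_basis (stable_letter p.2) q.1.
  have le e : len (stable_letter e) = len t by case: e; rewrite //= lenV.
  by rewrite !le mul2n -addnn; lia.
have [||el|[e [s [ch n0 cj' wt]]]] := IH ((p.1 * zpow (edge_elt (~~ p.2)) j * r.1, r.2) :: m).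
- by rewrite -ltnS; apply: leq_trans ltn; rewrite El size_cat addnC -size_cat El' /=; lia.
- move=> p' [<-|ir]; last by apply: inl; right; right; right.
  by apply: is_subgroupM hn_subgroup Apq _; apply: inl; right; right; left.
- left; apply: hn_elliptic_conj cj _; apply: hn_elliptic_conj el.
  by rewrite /= !mulgA; exact: conj_refl.
- right; exists e, s; split=> //.
    by apply: conj_trans cj _; move: cj'; rewrite /= !mulgA.
  apply: leq_trans wt _; rewrite wl /hn_weight /=.
  have := lenM A_basis (p.1 * zpow (edge_elt (~~ p.2)) j) r.1.
  have := lenM A_basis p.1 (zpow (edge_elt (~~ p.2)) j).
  move: lq; move: (len (zpow _ _)) (len (p.1 * zpow _ _)) (len (_ * _ * _)) (sumn _) => x y z u; lia.
Qed.

End HNNCase.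
End Splittings.

(** * The rank of an element with respect to a twist *)

Section TwistRank.
Context {F : groupType} {k : nat} {A0 : 'I_k.+2 -> F} (A_basis : is_basis A0).
Implicit Types (g h x y z X : F) (e : bool).
Local Notation len := (len A_basis).
Local Notation wv := (word_val A0).

Lemma homog_exists x : exists2 w, cyc_reduced w & conj x (wv w) /\ homog len x (size w).
Proof.
have [z [w [cw Ex _]]] := cyc_conj A_basis x; exists w => //.
have cj : conj x (wv w) by exists z^-1; rewrite Ex invgK !mulgA mulVg mul1g mulgVK.
split=> //; apply: homog_conj (quasi_add_len A_basis) (conj_sym cj) _.
exact: homog_len.
Qed.

Lemma homog_le_len L B : quasi_add A_basis L B -> exists K, forall x l mu,
  homog len x l -> homog L x mu -> (mu <= K * l)%N.
Proof.
move=> qa; have [K HK] := quasi_add_lip qa; exists K => x l mu hl hm.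
have [w cw [cj hw]] := homog_exists x; rewrite (homog_uniq hl hw).
have hm' := homog_conj qa cj hm.
have [|h _] := @homog_close _ L (wv w) mu 0 (K * size w) (L 1) hm'; last by rewrite add0n in h.
move=> m; rewrite muln0; split=> //.
have [h _] := HK 1 (wv w ^+ m); rewrite mul1g in h; apply: leq_trans h _.
rewrite addnC leq_add2r mulnCA leq_mul2l.
by rewrite (leq_trans (lenX _ _ _)) ?orbT // leq_mul2l len_val orbT.
Qed.

(* rank X is the number of edges of a period of the axis of X in the tree of the
   splitting, each of which receives |n| copies of c0. *)
Definition is_twist_rank (c0 : F) (d : aut F) (ell : F -> Prop) (rank : F -> nat) :=
  (forall X, rank X = 0%N -> ell X) /\
  forall L B lam, quasi_add A_basis L B -> homog L c0 lam ->
  exists K, forall X (n : int) l mu, homog len X l -> homog L (itr d n X) mu ->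
    (mu <= `|n| * rank X * lam + K * l)%N /\ (`|n| * rank X * lam <= mu + K * l)%N.

(** The rank is the number of steps in a chain for a conjugate of [X], with 0 reserved for elliptic
    elements. The chain is built from a cyclically reduced conjugate, so its total length is linear
    in the homogenized length of [X]. *)
Lemma basic_rank {c0 : F} {d : aut F} {basic : bool -> F -> bool -> Prop}
    {ell : F -> Prop} :
  not_proper_power c0 ->
  (forall e g e', basic e g e' -> ~ exists m, g = zpow c0 m) ->
  (forall e g e' m, basic e g e' -> basic e (zpow c0 m * g) e') ->
  (forall e g e' m, basic e g e' -> basic e (g * zpow c0 m) e') ->
  d c0 = c0 ->
  (forall e g e', basic e g e' ->
    d g = zpow c0 (if e then 1 else 0)%R * g * zpow c0 (if e' then 0 else -1)%R) ->
  (forall X Y, conj X Y -> ell Y -> ell X) ->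
  (forall X n, ell X -> conj X (itr d n X)) ->
  (exists K, forall w, ell (wv w) \/ exists e t, [/\ @tchain F basic e t e, t <> [::],
     conj (wv w) (tprod t) & (tlen A_basis t + size t <= K * size w)%N]) ->
  exists rank, is_twist_rank c0 d ell rank.
Proof.
move=> prim b_root b_mull b_mulr d_c0 b_twist ell_conj ell_fix [Kd dec].
pose good X (t : seq (F * bool)) := t <> [::] /\ exists e w,
  [/\ cyc_reduced w, conj X (wv w), @tchain F basic e t e, conj X (tprod t) &
      (tlen A_basis t + size t <= Kd * size w)%N].
have H X : exists r, (r = 0%N /\ ell X) \/ exists2 t, r = size t & good X t.
  have [w cw [cj _]] := homog_exists X.
  have [el|[e [t [ch t0 cj' lt]]]] := dec w.
    by exists 0%N; left; split=> //; exact: ell_conj cj el.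
  exists (size t); right; exists t => //; split=> //; exists e, w; split=> //.
  exact: conj_trans cj cj'.
exists (fun X => sval (cid (H X))); split.
  move=> X; case: (cid (H X)) => r /= [[_ //]|[t Et [t0 _]]] r0.
  by case: t t0 Et; rewrite // r0.
move=> L B lam qaL homL.
have [K1 HK1] := twist_estimate prim b_root b_mull b_mulr d_c0 b_twist qaL homL.
have [K2 HK2] := homog_le_len qaL.
exists (K1 * Kd + K2)%N => X n l mu hX hmu.
case: (cid (H X)) => r /= [[-> el]|[t -> [t0 [e [w [cw cj ch cj' lt]]]]]].
  rewrite muln0 mul0n; split=> //.
  have hmu' : homog L X mu.
    by apply: homog_conj qaL _ hmu; apply: conj_sym; exact: ell_fix.
  by apply: leq_trans (HK2 _ _ _ hX hmu') _; rewrite leq_mul2r leq_addl orbT.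
have El : l = size w.
  have hw : homog len (wv w) l by apply: homog_conj (quasi_add_len A_basis) cj hX.
  exact: homog_uniq hw (homog_len A_basis cw).
have [h1 h2] := HK1 e t X n mu ch t0 cj' hmu.
have h3 : (K1 * (tlen A_basis t + size t) <= (K1 * Kd + K2) * l)%N.
  apply: (@leq_trans (K1 * Kd * l)); last by rewrite leq_mul2r leq_addr orbT.
  by rewrite -mulnA leq_mul2l El lt orbT.
by split; [apply: leq_trans h1 _|apply: leq_trans h2 _]; rewrite leq_add2l.
Qed.

Definition elliptic (s : splitting F) (X : F) :=
  match s with
  | Amalgam A B c => am_elliptic (A := A) (B := B) X
  | HNN A t a0 a1 => hn_elliptic (A := A) X
  end.

Lemma itr_fix (d : aut F) a n : d a = a -> itr d n a = a.
Proof. by move=> da; elim/int_step: n => // n; rewrite itrS da. Qed.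

Lemma itr_conj (d : aut F) c b n : d c = c -> d b = c * b * c^-1 ->
  itr d n b = zpow c n * b * (zpow c n)^-1.
Proof.
move=> dc db; elim/int_step: n => [|n]; first by rewrite mul1g invg1 mulg1.
rewrite itrS db !autM autV (itr_fix n dc).
have -> : zpow c (n + 1)%R = c * zpow c n by rewrite GRing.addrC zpowD zpow1.
rewrite invgM !mulgA; split=> [->|]; first by rewrite !mulgA.
by move/mulIg; rewrite -!mulgA => /mulgI ->.
Qed.

(** Elliptic elements stay in their conjugacy class, since the twist fixes [A] and, in an amalgam,
    conjugates [B]; the other ones have conjugates that are products of chains. *)
Theorem splitting_rank (s : splitting F) (d : aut F) :
  is_cyclic_splitting s -> not_proper_power (edge_generator s) -> is_dehn_twist s d ->
  exists rank, is_twist_rank (edge_generator s) d (elliptic s) rank.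
Proof.
case: s => [A B c|A t a0 a1] /= [c1 H] prim.
- have [sA sB Ac Bc _] := H; move=> [dA dB].
  have sAB := am_subgroup H; have cAB := am_c H.
  apply: (@basic_rank c d (@am_basic F A B c) (am_elliptic (A := A) (B := B))) => //.
  + by move=> e g e' [_ [_ ng]].
  + move=> e g e' m [-> [Eg ng]]; split=> //; split.
      by case: e' Eg => Eg; apply: is_subgroupM => //; exact: is_subgroup_zpow.
    move=> [j Ej]; apply: ng; exists (- m + j)%R.
    by rewrite zpowD -Ej zpowN mulKg.
  + move=> e g e' m [-> [Eg ng]]; split=> //; split.
      by case: e' Eg => Eg; apply: is_subgroupM => //; exact: is_subgroup_zpow.
    move=> [j Ej]; apply: ng; exists (j - m)%R.
    by rewrite zpowD -Ej zpowN mulgK.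
  + exact: dA.
  + move=> e g e' [-> [Eg _]]; case: e' Eg => Eg /=.
      by rewrite mul1g mulg1 dA.
    by rewrite dB // (zpowN c 1%R) zpow1.
  + exact: am_elliptic_conj.
  + move=> X n [y [AX|BX]].
      exists ((itr d n y)^-1 * y); rewrite !invgM invgK.
      have := itr_fix n (dA _ AX); rewrite !autM autV => E.
      apply: (mulgI (itr d n y)); apply: (mulIg (itr d n y)^-1); rewrite E.
      by rewrite !mulgA mulgV mul1g mulgK.
    exists ((itr d n y)^-1 * zpow c n * y); rewrite !invgM invgK.
    have := itr_conj n (dA _ Ac) (dB _ BX); rewrite !autM autV => E.
    apply: (mulgI (itr d n y)); apply: (mulIg (itr d n y)^-1); rewrite E.
    by rewrite !mulgA mulgV mul1g mulgK.
  + have [K HK] := @weighted_syllables F k A0 (bool * F)%type (fun p => p.2) (am_valid (A := A) (B := B))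
      (fun p => (len p.2).+1) (am_syllables H).
    exists K => w; have [l [vl El wl]] := HK w.
    have El' : wv w = am_val l by [].
    rewrite El'; have [?|[e [t [ch t0 cj lt]]]] := am_reduce A_basis H vl; first by left.
    by right; exists e, t; split=> //; exact: leq_trans lt wl.
- have [sA Aa0 Aa1 Et U] := H; move=> [dA dt].
  have tA : ~ A t.
    (* If [t] were in [A], the homomorphism that kills [A] and sends [t] to [a0] would give
       [a0 = 1]. *)
    move=> At; have [|f [[fM fA ft] _]] := U F (fun=> 1) a0 (fun _ _ _ _ => esym (mulg1 1)).
      by rewrite mulg1 mulVg.
    by apply: c1; rewrite -ft fA.
  have in0 m : A (zpow a0 m) by exact: is_subgroup_zpow.
  have Et0 m : t^-1 * zpow a0 m * t = zpow a1 m by rewrite -Et zpow_conjV.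
  have Et1 m : t * zpow a1 m * t^-1 = zpow a0 m.
    by rewrite -Et0 !mulgA mulgV mul1g mulgK.
  apply: (@basic_rank a0 d (@hn_basic F A t a0 a1) (hn_elliptic (A := A))) => //.
  + move=> e g e' [a [Aa -> na]] [m].
    case: e e' na => [] [] na; rewrite ?mul1g ?mulg1 => E.
    * apply: tA; have -> : t = zpow a0 m * a^-1 by rewrite -E mulgK.
      exact: is_subgroupM sA (in0 _) (is_subgroupV sA Aa).
    * case: na => // na; apply: na; exists m.
      by rewrite /edge_elt -Et0 -E !mulgA mulVg mul1g mulgVK.
    * by case: na => // na; apply: na; exists m.
    * apply: tA; have -> : t = (zpow a0 m)^-1 * a by rewrite -E invgM invgK -mulgA mulVg mulg1.
      exact: is_subgroupM sA (is_subgroupV sA (in0 _)) Aa.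
  + move=> e g e' m [a [Aa -> na]]; exists (zpow (edge_elt (a0 := a0) (a1 := a1) e) m * a).
    have Ae := is_subgroup_zpow m sA (hn_edge H e); split.
    * exact: is_subgroupM.
    * rewrite !mulgA; congr (_ * _ * _); case: e {na Ae} => /=; last by rewrite mul1g mulg1.
      by rewrite -Et1 mulgVK.
    * case: na => [|na]; [by left|right=> -[j Ej]; apply: na; exists (- m + j)%R].
      by rewrite zpowD -Ej zpowN mulKg.
  + move=> e g e' m [a [Aa -> na]]; exists (a * zpow (edge_elt (a0 := a0) (a1 := a1) (~~ e')) m).
    have Ae := is_subgroup_zpow m sA (hn_edge H (~~ e')); split.
    * exact: is_subgroupM.
    * rewrite -!mulgA; congr (_ * (_ * _)); case: e' {na Ae} => /=; first by rewrite mul1g mulg1.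
      by rewrite -Et0 mulgK.
    * case: na => [|na]; [by left|].
      have [->|ne] := eqVneq e e'; first by left.
      have -> : ~~ e' = e by move: ne; case: e {na}; case: e' {Ae}.
      right=> -[j Ej]; apply: na; exists (j - m)%R.
      by rewrite zpowD -Ej zpowN mulgK.
  + exact: dA.
  + move=> e g e' [a [Aa -> na]]; rewrite !autM (dA a Aa).
    have d1 : d 1 = 1 := dA _ (is_subgroup1 sA).
    have a0V : zpow a0 (-1)%R = a0^-1 by rewrite (zpowN a0 1%R) zpow1.
    by case: e e' {na} => [] []; rewrite ?autV ?dt ?d1 ?a0V ?zpow1 ?zpow0 ?invgM ?mulg1 ?mul1g ?mulgA.
  + exact: hn_elliptic_conj.
  + move=> X n [y AX]; exists ((itr d n y)^-1 * y).
    rewrite !invgM invgK.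
    have := itr_fix n (dA _ AX); rewrite !autM autV => E.
    apply: (mulgI (itr d n y)); apply: (mulIg (itr d n y)^-1); rewrite E.
    by rewrite !mulgA mulgV mul1g mulgK.
  + have [K HK] := @weighted_syllables F k A0 (F * option bool)%type (syl_val (t := t)) (fun p => A p.1)
      (syl_weight A_basis (t := t)) (hn_syllables H).
    exists K => w; have [s [vs Es ws]] := HK w.
    have [l [a [vl Aa El wl]]] := hn_collect A_basis H vs.
    have {Es}El : wv w = hn_val (t := t) l * a by rewrite -Es.
    have cj : conj (wv w) (a * hn_val (t := t) l) by rewrite El; exact: conj_rot.
    case: l vl El wl cj => [|[b e] l] vl El wl cj.
      left; apply: hn_elliptic_conj cj _; rewrite mulg1; exact: hn_elliptic_in.
    have [||[e1 [t1 [ch t0 cj' lt]]]] := @hn_reduce F k A0 A_basis A t a0 a1 H ((a * b, e) :: l).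
    * move=> p [<-|ip]; last by apply: vl; right.
      by apply: is_subgroupM sA Aa _; apply: (vl (b, e)); left.
    * move=> el; left; apply: hn_elliptic_conj cj _; apply: hn_elliptic_conj el.
      by rewrite /= !mulgA; exact: conj_refl.
    * right; exists e1, t1; split=> //.
        by apply: conj_trans cj _; move: cj'; rewrite /= !mulgA.
      apply: leq_trans lt _; apply: leq_trans ws; apply: leq_trans wl.
      rewrite /hn_weight /=; have := lenM A_basis a b.
      by move: (sumn _) (len (a * b)) => x y; lia.
Qed.

End TwistRank.

(** * Coarse maps and occurrence counts *)

Section CoarseMaps.
Context {F : groupType} {k : nat} {A : 'I_k.+2 -> F} (A_basis : is_basis A).
Implicit Types (g h x y z : F) (u v w s : seq (letter k)).
Local Notation len := (len A_basis).
Local Notation nf := (nf A_basis).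
Local Notation wv := (word_val A).

(* f is Lipschitz and proper, so that it extends to the boundary; modulus is its
   modulus of continuity on prefixes. *)
Definition coarse (f : F -> F) (K : nat) := [/\ (0 < K)%N,
  forall g (a : letter k), (len ((f g)^-1 * f (g * letter_val A a))%g <= K)%N &
  forall g, (len g <= K * (len (f g)).+1)%N].

Definition agree m x y := take m (nf x) = take m (nf y).

Lemma agree_leq m n x y : (m <= n)%N -> agree n x y -> agree m x y.
Proof. by move=> mn /(congr1 (take m)); rewrite !take_takel. Qed.

Lemma agree_near m K x y : (len (x^-1 * y) <= K)%N -> (m + K <= len x)%N -> agree m x y.
Proof.
move=> le ge; have [p [u [v [Ex Exy]]]] := nf_mul A_basis x (x^-1 * y).
rewrite mulVKg => Ey; rewrite /agree Ex Ey.
have su : (m <= size u)%N.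
  by move: le ge; rewrite ?lenE Exy Ex !size_cat size_word_inv; lia.
by rewrite !takel_cat.
Qed.

(** From this length on, the values of [f] have length at least [m + K], so that a jump of length
    [K] leaves [m] letters unchanged. *)
Definition modulus K m : nat := (K * (m + K).+1)%N.

Lemma coarse_path f K m g s : coarse f K ->
  (forall i, modulus K m <= len (g * wv (take i s)))%N -> agree m (f g) (f (g * wv s)).
Proof.
move=> [K0 lip low]; elim: s g => [|a s IH] g far; first by rewrite mulg1.
have h0 := far 0%N; rewrite take0 mulg1 in h0.
have step : agree m (f g) (f (g * letter_val A a)).
  apply: agree_near (lip g a) _.
  by have := leq_trans h0 (low g); rewrite leq_mul2l ltnS; case: (K) K0.
rewrite /agree step; have := IH (g * letter_val A a).
rewrite -mulgA => ->; first by rewrite mulgA.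
by move=> i; have := far i.+1; rewrite /= mulgA.
Qed.

(** Both points are joined to the end of their common prefix by paths whose vertices have length at
    least [modulus K m]; along them the first [m] letters of the image do not change. *)
Lemma coarse_agree f K m x y : coarse f K -> agree (modulus K m) x y ->
  agree m (f x) (f y).
Proof.
move=> cf; wlog: x y / (modulus K m <= len x)%N.
  move=> W; have [le|lt] := leqP (modulus K m) (len x); first exact: W.
  have [le'|lt'] := leqP (modulus K m) (len y).
    by move=> ag; symmetry; apply: W.
  rewrite /agree take_oversize ?(ltnW lt) // take_oversize ?(ltnW lt') // => /nf_inj ->.
  by [].
move=> le; rewrite /agree => ag; set n := modulus K m in le ag *.
have half z : (n <= len z)%N -> agree m (f (wv (take n (nf z)))) (f z).
  move=> lz; rewrite -{2}(nfK A_basis z) -{2}(cat_take_drop n (nf z)) word_val_cat.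
  apply: coarse_path cf _ => i; rewrite -word_val_cat ?lenE nf_val.
    by rewrite size_cat size_takel // leq_addr.
  apply: (@reduced_catl _ _ (drop i (drop n (nf z)))).
  by rewrite -catA !cat_take_drop nf_reduced.
have ly : (n <= len y)%N.
  by have := congr1 size ag; rewrite size_takel // size_take; case: ltnP => //; rewrite ?lenE; lia.
by rewrite -(half x le) -(half y ly) ag.
Qed.

(** Properness of [f] is the Lipschitz bound of its inverse. *)
Lemma coarse_aut (f : aut F) : exists K, coarse f K.
Proof.
pose M (f : aut F) := (\max_(a : letter k) len (f (letter_val A a))).+1.
have lip (h : aut F) w : (len (h (wv w)) <= M h * size w)%N.
  elim: w => [|a w IH]; first by rewrite (aut_zpow h 1 0%R) len1.
  rewrite /= autM mulnS; apply: leq_trans (lenM _ _ _) _; rewrite leq_add //.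
  by rewrite /M leqW // (leq_bigmax a).
exists (M f + M f^-1)%N; split.
- by rewrite /M addSn.
- move=> g a; rewrite autM mulKg; apply: leq_trans (leq_addr _ _).
  by rewrite /M leqW // (leq_bigmax a).
- move=> g; have Eg : g = (f^-1 : aut F) (f g).
    by rewrite -aut_mulE mulVg aut1E.
  rewrite {1}Eg -{1}(nfK A_basis (f g)); apply: leq_trans (lip _ _) _.
  by rewrite leq_mul // ?leq_addl // leqnSn.
Qed.

Lemma coarse_trans h : coarse (fun x => h * x) (len h).+1.
Proof.
split=> // [g a|g].
  rewrite invgM -!mulgA mulKg mulKg.
  have -> : letter_val A a = wv [:: a] by rewrite /= mulg1.
  by apply: leq_trans (len_val _ _) _.
by have := lenMl A_basis h g; nia.
Qed.

Lemma len_additive g h : len (g * h) = (len g + len h)%N -> nf (g * h) = nf g ++ nf h.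
Proof.
have [p [u [v [Eg Eh E]]]] := nf_mul A_basis g h.
rewrite ?lenE E Eg Eh !size_cat size_word_inv => Es.
have p0 : p = [::] by apply: size0nil; lia.
by rewrite p0 cats0.
Qed.

(** Bounded cancellation. If [g * h] has no cancellation, the words of [g^-1] and [h] do not begin
    with the same letter. A long cancellation between the images would make the images of [g^-1] and
    [h] agree far, and applying the inverse of [f] would make the first letters agree. *)
Lemma quasi_add_aut (f : aut F) : exists B, quasi_add A_basis (fun g => len (f g)) B.
Proof.
have [K cK] := coarse_aut f^-1; exists (2 * modulus K 1)%N; split.
  by move=> g; rewrite autV lenV.
move=> g h lgh; rewrite autM; split.
  by apply: leq_trans (lenM _ _ _) _; rewrite leq_addr.
have [p [u [v [Eg Eh E]]]] := nf_mul A_basis (f g) (f h).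
suff lp : (size p <= modulus K 1)%N.
  by rewrite ?lenE E Eg Eh !size_cat size_word_inv mul2n -addnn; lia.
rewrite leqNgt; apply/negP => lp.
have : agree 1 ((f^-1 : aut F) (f g^-1)) ((f^-1 : aut F) (f h)).
  apply: coarse_agree cK _; apply: agree_leq (ltnW lp) _.
  by rewrite /agree autV nfV Eg Eh word_inv_cat -(size_word_inv p) !take_size_cat.
rewrite -!aut_mulE mulVg !aut1E /agree nfV.
have {lgh} := len_additive lgh => Egh; have := nf_reduced A_basis (g * h); rewrite Egh.
case: (lastP (nf g)) => [|w a] in Egh *.
  rewrite /word_inv /= => _; case Ew : (nf h) => [|//] _.
  have h1 : h = 1 by apply: (@nf_inj _ _ _ A_basis); rewrite Ew nf1.
  have := congr1 size Eh; rewrite h1 (aut_zpow f 1 0%R) nf1 size_cat size_word_inv /=; lia.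
case: (nf h) => [|b w'] /=.
  by rewrite /word_inv map_rcons rev_rcons.
rewrite /word_inv map_rcons rev_rcons /= !take0 => red [Eb].
move: red; rewrite -Eb cat_rcons => /reduced_catr; rewrite /reduced /= /can_follow eqxx.
by [].
Qed.

End CoarseMaps.

(** * Counting occurrences of a word *)

Section Occurrences.
Context {F : groupType} {k : nat} {A : 'I_k.+2 -> F} (A_basis : is_basis A).
Context (u : seq (letter k)) (u_ne : u != [::]).
Implicit Types (w s t : seq (letter k)).
Local Notation nf := (nf A_basis).

Definition starts w : bool := (take (size u) w == u) || (take (size u) w == word_inv u).
Definition stops w : bool :=
  (drop (size w - size u) w == u) || (drop (size w - size u) w == word_inv u).

Fixpoint lcount w : nat := if w is a :: w' then starts w + lcount w' else 0.

Lemma starts_cat w t : (size u <= size w)%N -> starts (w ++ t) = starts w.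
Proof. by move=> le; rewrite /starts takel_cat. Qed.

Lemma starts_short w : (size w < size u)%N -> starts w = false.
Proof.
move=> lt; rewrite /starts take_oversize ?(ltnW lt) //.
by apply/negbTE; rewrite negb_or; apply/andP; split; apply/eqP => E;
  move: lt; rewrite E ?size_word_inv ltnn.
Qed.

Lemma stops_short w : (size w < size u)%N -> stops w = false.
Proof.
move=> lt; rewrite /stops; have -> : (size w - size u = 0)%N by lia.
rewrite drop0; apply/negbTE; rewrite negb_or; apply/andP; split; apply/eqP => E;
  by move: lt; rewrite E ?size_word_inv ltnn.
Qed.

(** Occurrences may be counted by their ends as well as by their beginnings, and inversion exchanges
    the two. *)
Lemma lcount_rcons w a : lcount (rcons w a) = (lcount w + stops (rcons w a))%N.
Proof.
have u0 : (0 < size u)%N by rewrite lt0n size_eq0.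
elim: w => [|b w IH] /=.
  rewrite addn0 add0n; case: (ltnP 1 (size u)) => lt.
    by rewrite starts_short ?stops_short.
  have s1 : size u = 1%N by lia.
  by rewrite /starts /stops s1 /=.
rewrite IH addnA; have sw : size (b :: rcons w a) = (size w).+2 by rewrite /= size_rcons.
have [le|] := leqP (size u) (size w).+1.
  have -> : starts (b :: rcons w a) = starts (b :: w) by rewrite -rcons_cons -cats1 starts_cat.
  have -> : stops (b :: rcons w a) = stops (rcons w a).
    rewrite /stops /= size_rcons; have -> : ((size w).+2 - size u = ((size w).+1 - size u).+1)%N by lia.
    by [].
  by [].
rewrite leq_eqVlt => /orP[/eqP E|lt]; last first.
  by rewrite !starts_short ?stops_short ?sw ?size_rcons //= ltnW.
rewrite (starts_short (w := b :: w)) ?(stops_short (w := rcons w a)) ?size_rcons ?E //=.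
rewrite addn0 addnC; congr (_ + _)%N; congr nat_of_bool.
by rewrite /starts /stops -E sw subnn drop0 take_oversize // sw.
Qed.

Lemma lcountV w : lcount (word_inv w) = lcount w.
Proof.
elim: w => //= a w IH; rewrite /word_inv map_cons rev_cons -/(word_inv w).
rewrite lcount_rcons IH addnC; congr (_ + _)%N; congr nat_of_bool.
have -> : rcons (word_inv w) (letter_inv a) = word_inv (a :: w) by rewrite /word_inv map_cons rev_cons.
set v := a :: w; have can (x y : seq (letter k)) : (word_inv x == y) = (x == word_inv y).
  by rewrite (can2_eq (@word_invK k) (@word_invK k)).
rewrite /stops /starts size_word_inv.
have -> : drop (size v - size u) (word_inv v) = word_inv (take (size u) v).
  rewrite -{2}(cat_take_drop (size u) v) word_inv_cat drop_size_cat //.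
  by rewrite size_word_inv size_drop.
by rewrite !can word_invK orbC.
Qed.

Lemma lcount_cat w t :
  (lcount w + lcount t <= lcount (w ++ t))%N /\
  (lcount (w ++ t) <= lcount w + lcount t + size u)%N.
Proof.
have le1 (b : bool) : (b <= 1)%N by case: b.
suff [h1 h2] : (lcount w + lcount t <= lcount (w ++ t))%N /\
  (lcount (w ++ t) <= lcount w + lcount t + minn (size w) (size u))%N.
  by split=> //; apply: leq_trans h2 _; rewrite leq_add2l geq_minr.
elim: w => [|a w [h1 h2]]; first by rewrite /= min0n addn0.
have [le|lt] := leqP (size u) (size w).+1.
  have E : starts (a :: w ++ t) = starts (a :: w) by rewrite -cat_cons starts_cat.
  by rewrite /= E; split; move: h1 h2; rewrite /minn; case: ltnP; case: ltnP; lia.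
rewrite /= (starts_short (w := a :: w)) //=.
have := le1 (starts (a :: w ++ t)).
by split; move: h1 h2; rewrite /minn; case: ltnP; case: ltnP; lia.
Qed.

Lemma quasi_add_count : quasi_add A_basis (fun g => lcount (nf g)) (size u).
Proof.
split=> [g|g h /len_additive ->]; first by rewrite nfV lcountV.
by have [h1 h2] := lcount_cat (nf g) (nf h); split=> //; lia.
Qed.

Lemma onth_wpow w n p : (p < n * size w)%N -> onth (wpow w n) p = onth w (p %% size w).
Proof.
elim: n p => // n IH p; rewrite mulSn => lt /=; rewrite onth_cat.
case: ltnP => [le|ge]; first by rewrite modn_small.
by rewrite IH -?(modnDr (p - size w)) ?subnK //; lia.
Qed.

Lemma onth_in (T : Type) (x0 : T) (s : seq T) j : (j < size s)%N -> onth s j = Some (nth x0 s j).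
Proof. by move=> lt; rewrite onthE (nth_map x0). Qed.

Lemma occurs_atE v w m i : (i < size w)%N -> (size v <= m * size w)%N ->
  occurs_at v w i = (take (size v) (drop i w ++ wpow w m) == v).
Proof.
move=> iw vm; set X := drop i w ++ wpow w m.
have sX : (size v <= size X)%N by rewrite size_cat size_wpow (leq_trans vm) // leq_addl.
have EX j : (j < size v)%N -> onth X j = onth w ((i + j) %% size w).
  move=> jv; rewrite -(@onth_wpow w m.+1) //.
    rewrite -[wpow w m.+1]/(w ++ wpow w m) onth_cat /X onth_cat size_drop.
    have -> : (i + j < size w)%N = (j < size w - i)%N by lia.
    case: ltnP => lt.
      by rewrite -[in RHS](cat_take_drop i w) onth_cat size_takel ?(ltnW iw) // ltnNge leq_addr /= addKn.
    by congr (onth _ _); lia.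
  by rewrite mulSn; lia.
case: v sX EX vm => [|a v]; first by rewrite take0 => _ _ _; apply/forallP => -[].
set v' := a :: v => sX EX vm.
apply/forallP/eqP => [H|E j]; last first.
  have jv := ltn_ord j.
  rewrite -EX // -{1}E !(onth_in a) ?size_takel //; last exact: leq_trans jv sX.
  by rewrite nth_take.
apply: (@eq_from_nth _ a); first by rewrite size_takel.
move=> j; rewrite size_takel // => jv; rewrite nth_take //.
have /eqP := H (Ordinal jv); rewrite /= -EX //.
by rewrite !(onth_in a) ?(leq_trans jv sX) // => -[].
Qed.

(** The bound on [m] ensures that an occurrence starting in the first period does not run out of the
    word, even if [u] is longer than [w]. *)
Lemma lcount_period w m : (size u <= m)%N -> w != [::] ->
  lcount (wpow w m.+1) = (occurrences u w + lcount (wpow w m))%N.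
Proof.
move=> um wn; have w0 : (0 < size w)%N by rewrite lt0n size_eq0.
have um' : (size u <= m * size w)%N by apply: leq_trans um _; rewrite leq_pmulr.
have H s t : lcount (s ++ t) =
    (count (fun i => starts (drop i s ++ t)) (iota 0 (size s)) + lcount t)%N.
  elim: s => //= a s ->; rewrite addnA; congr (_ + _ + _)%N.
  by rewrite -[1%N]addn0 iotaDl count_map; apply: eq_count => i /=.
rewrite [wpow w m.+1]/= H; congr (_ + _)%N; rewrite /occurrences.
apply: eq_in_count => i; rewrite mem_iota add0n => /andP[_ iw].
by rewrite /starts (occurs_atE iw um') (@occurs_atE (word_inv u) w m) ?size_word_inv.
Qed.

Lemma homog_count w : cyc_reduced w -> w != [::] ->
  homog (fun g => lcount (nf g)) (word_val A w) (occurrences u w).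
Proof.
move=> cw wn; have E n : lcount (wpow w (n + size u)) = (n * occurrences u w + lcount (wpow w (size u)))%N.
  elim: n => // n IH; rewrite addSn lcount_period ?leq_addl // IH mulSn addnA.
  by [].
exists (lcount (wpow w (size u)) + size u * occurrences u w + \max_(i < size u) lcount (wpow w i))%N => m.
rewrite -word_val_wpow nf_val ?reduced_wpow //.
have [le|lt] := leqP (size u) m.
  rewrite -{1 4}(subnK le) E; have : ((m - size u) * occurrences u w <= m * occurrences u w)%N.
    by rewrite leq_mul2r leq_subr orbT.
  have : (m * occurrences u w = (m - size u) * occurrences u w + size u * occurrences u w)%N.
    by rewrite -mulnDl subnK.
  by lia.
have h1 : (lcount (wpow w m) <= \max_(i < size u) lcount (wpow w i))%N.
  exact: (leq_bigmax (Ordinal lt) (F := fun i : 'I_(size u) => lcount (wpow w i))).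
have h2 : (m * occurrences u w <= size u * occurrences u w)%N by rewrite leq_mul2r ltnW ?orbT.
by lia.
Qed.

End Occurrences.

(** * Products of two twists *)

Section TwoTwists.
Context {F : groupType} {k : nat} {A : 'I_k.+2 -> F} (A_basis : is_basis A).
Implicit Types (g h x y z : F).
Local Notation len := (len A_basis).
Local Notation is_twist_rank := (is_twist_rank A_basis).

Lemma homog_ge1 x l : x <> 1 -> homog len x l -> (0 < l)%N.
Proof.
move=> x1; have [w cw [[z Ez] hw]] := homog_exists A_basis x.
move=> /(homog_uniq hw) <-; case: w cw Ez hw => // _ Ez _; case: x1.
by apply: (mulgI z); apply: (mulIg z^-1); rewrite -Ez mulg1 mulgV.
Qed.

(** The homogenized length of d'^p d^n x is bounded from below by the growth under d^n of the
    quasi-additive function |d'^p .|, and from above through [rank'] of d^n x. The order of the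
    quantifiers matters: [K1] is fixed before the quality [K2] of the input is known, and only [n0]
    depends on [K2]. *)
Lemma twist_step c d ell rank c' d' ell' rank' l l' :
  is_twist_rank c d ell rank -> is_twist_rank c' d' ell' rank' ->
  homog len c l -> homog len c' l' -> (0 < l')%N -> (0 < rank' c)%N ->
  exists K1, forall K2, exists n0, forall n : int, (n0 <= `|n|)%N ->
  forall x lx, homog len x lx -> (lx <= K2 * rank x)%N -> (0 < rank x)%N ->
  forall ly, homog len (itr d n x) ly ->
    (ly <= K1 * rank' (itr d n x))%N /\ (0 < rank' (itr d n x))%N.
Proof.
move=> [_ tw] [_ tw'] hc hc' l'0 rc0.
have [K' HK'] := tw' len 0%N l' (quasi_add_len A_basis) hc'.
(* With this [p] the homogenized length of d'^p c exceeds [K' * l], so that the error [K' * ly],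
   which is of order n, stays below the main term. *)
pose p := (2 * (K' * l)).+1.
have [B qa2] := quasi_add_aut A_basis (itr d' p).
have [w2 _ [_ h2]] := homog_exists A_basis (itr d' p c); set lam2 := size w2 in h2.
have toL x mu : homog len (itr d' p x) mu -> homog (fun g => len (itr d' p g)) x mu.
  by move=> [D HD]; exists D => m; rewrite autX.
have [Ka HKa] := tw len 0%N l (quasi_add_len A_basis) hc.
have [Kb HKb] := tw _ B lam2 qa2 (toL _ _ h2).
have [_ lam2_ge] := HK' c p l lam2 hc h2.
exists (2 * p * l' * l.+1)%N => K2.
pose D := ((K' * Ka + Kb) * K2)%N.
(* [2 * D] lets half of the main term absorb the errors, and [Ka * K2] keeps [ly] below
   [N * r * l.+1]. *)
exists (2 * D + Ka * K2).+1 => n ln x lx hx lxr r0 ly hy.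
have [w3 _ [_ h3]] := homog_exists A_basis (itr d' p (itr d n x)); set mu2 := size w3 in h3.
have [ly_le _] := HKa x n lx ly hx hy.
have [_ mu_ge] := HKb x n lx mu2 hx (toL _ _ h3).
have [mu_le _] := HK' (itr d n x) p ly mu2 hy h3.
rewrite /= in lam2_ge mu_le.
move: (rank' (itr d n x)) (rank x) r0 lxr ly_le mu_ge mu_le => ry r r0 lxr ly_le mu_ge mu_le.
move: `|n|%N ln ly_le mu_ge => N ln ly_le mu_ge.
have e1 : (Ka * lx <= Ka * K2 * r)%N by rewrite -mulnA leq_mul2l lxr orbT.
have e2 : (Kb * lx <= Kb * K2 * r)%N by rewrite -mulnA leq_mul2l lxr orbT.
have e3 : (p * l' <= p * rank' c * l')%N by rewrite leq_mul2r leq_pmulr ?orbT.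
have e4 : (p <= p * l')%N by rewrite leq_pmulr.
have e5 : (K' * l + 1 <= lam2)%N by move: lam2_ge e3 e4; rewrite /p; lia.
have e6 : (N * r * (K' * l + 1) <= N * r * lam2)%N by rewrite leq_mul2l e5 orbT.
have e7 : (K' * ly <= K' * (N * r * l + Ka * K2 * r))%N.
  by rewrite leq_mul2l (leq_trans ly_le) ?orbT // leq_add2l.
have E8 : (K' * (N * r * l + Ka * K2 * r) + Kb * K2 * r = N * r * (K' * l) + D * r)%N.
  by rewrite /D; nia.
have e9 : (N * r <= p * ry * l' + D * r)%N by move: e6 e7 mu_ge mu_le e2; rewrite mulnDr muln1; lia.
have e10 : (N * r <= 2 * (p * ry * l'))%N.
  have : (2 * (D * r) <= N * r)%N by rewrite mulnA leq_mul2r; apply/orP; right; lia.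
  by lia.
have e11 : (ly <= N * r * l.+1)%N.
  have : (Ka * K2 * r <= N * r)%N by rewrite leq_mul2r; apply/orP; right; lia.
  by rewrite mulnS; lia.
split.
  apply: leq_trans e11 _; apply: (@leq_trans (2 * (p * ry * l') * l.+1)%N).
    by rewrite leq_mul2r e10 orbT.
  by apply: eq_leq; nia.
rewrite lt0n; apply/eqP => ry0; move: e10; rewrite ry0 muln0 mul0n muln0 leqn0 muln_eq0.
by move: ln r0; case: (N) => // N' _; case: (r).
Qed.

Section Iteration.
Context {c1 c2 : F} {d1 d2 : aut F} {ell1 ell2 : F -> Prop} {rank1 rank2 : F -> nat}.
Context (tw1 : is_twist_rank c1 d1 ell1 rank1) (tw2 : is_twist_rank c2 d2 ell2 rank2).
Context (c1_ne : c1 <> 1) (c2_ne : c2 <> 1).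
Context (c1_hyp : (0 < rank2 c1)%N) (c2_hyp : (0 < rank1 c2)%N).

Definition pair_twist (n : nat) : aut F := itr d1 n * itr d2 (- Posz n)%R.

(* Starting at c1, the iterates alternate between elements that look like powers
   of c1 and elements that look like powers of c2, and their length is
   comparable to their rank in the tree of the next twist. *)
Theorem pair_twist_iterates (L : F -> nat) B lam : quasi_add A_basis L B ->
  homog L c1 lam -> exists K n0, forall n m : nat, (n0 <= n)%N ->
  forall mu, homog L ((pair_twist n ^+ m.+1 : aut F) c1) mu ->
  let r := rank1 (itr d2 (- Posz n)%R ((pair_twist n ^+ m : aut F) c1)) in
  [/\ 0 < r, mu <= n * r * lam + K * r & n * r * lam <= mu + K * r]%N.
Proof.
move=> qaL homL.
have [w1 _ [_ h1]] := homog_exists A_basis c1; set l1 := size w1 in h1.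
have [w2 _ [_ h2]] := homog_exists A_basis c2; set l2 := size w2 in h2.
have l1_gt0 := homog_ge1 c1_ne h1; have l2_gt0 := homog_ge1 c2_ne h2.
have [K1 HK1] := twist_step tw2 tw1 h2 h1 l1_gt0 c2_hyp.
have [K2' HK2'] := twist_step tw1 tw2 h1 h2 l2_gt0 c1_hyp.
(* [l1] is added for the start of the induction, at [c1] itself, whose second rank is positive. *)
pose K2 := (K2' + l1)%N.
have [n1 Hn1] := HK1 K2; have [n2 Hn2] := HK2' K1.
have [_ twL] := tw1; have [K HK] := twL L B lam qaL homL.
exists (K * K1)%N, (n1 + n2)%N => n m ln.
have an1 : (n1 <= `|(- Posz n)%R|)%N by lia.
have an2 : (n2 <= `|Posz n|)%N by rewrite /=; lia.
have inv i : let x := (pair_twist n ^+ i : aut F) c1 in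
    forall lx, homog len x lx -> (lx <= K2 * rank2 x)%N /\ (0 < rank2 x)%N.
  elim: i => [|i IH] /= lx hx.
    rewrite aut1E in hx *; rewrite (homog_uniq hx h1); split=> //.
    apply: (@leq_trans (l1 * rank2 c1)); first by rewrite leq_pmulr.
    by rewrite leq_mul2r /K2 leq_addl orbT.
  have [wx _ [_ hx0]] := homog_exists A_basis ((pair_twist n ^+ i : aut F) c1).
  have [lx0 rx0] := IH _ hx0.
  have [wy _ [_ hy]] := homog_exists A_basis (itr d2 (- Posz n)%R ((pair_twist n ^+ i : aut F) c1)).
  have [ly0 ry0] := Hn1 _ an1 _ _ hx0 lx0 rx0 _ hy.
  rewrite expgS in hx *.
  have [ll rr] := Hn2 _ an2 _ _ hy ly0 ry0 _ hx.
  split=> //; apply: leq_trans ll _.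
  by rewrite leq_mul2r /K2 leq_addr orbT.
move=> mu hmu r.
have [wx _ [_ hx0]] := homog_exists A_basis ((pair_twist n ^+ m : aut F) c1).
have [lx0 rx0] := inv m _ hx0.
have [wy _ [_ hy]] := homog_exists A_basis (itr d2 (- Posz n)%R ((pair_twist n ^+ m : aut F) c1)).
have [ly0 ry0] := Hn1 _ an1 _ _ hx0 lx0 rx0 _ hy.
rewrite expgS in hmu.
have [e1 e2] := HK _ n _ _ hy hmu.
have e3 : (K * size wy <= K * K1 * r)%N by rewrite -mulnA leq_mul2l ly0 orbT.
split=> //; [apply: leq_trans e1 _|apply: leq_trans e2 _]; by rewrite leq_add2l.
Qed.

End Iteration.
End TwoTwists.

(** * Consequences of filling and of very smallness *)

Section TreeConditions.
Context {F : groupType}.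
Implicit Types (g h x y z : F) (s : splitting F) (X : set F).

Lemma cycP x z : cyc z x <-> exists m, x = zpow z m.
Proof.
split=> [[n [->|->]]|[[n|n] ->]].
- by exists (Posz n).
- by exists (- Posz n)%R; rewrite zpowN.
- by exists n; left.
- by exists n.+1; right.
Qed.

Lemma cyc_subgroup z : is_subgroup (cyc z).
Proof.
split; first by rewrite inE; apply/cycP; exists 0%R.
move=> x y; rewrite !inE => /cycP[m ->] /cycP[n ->]; apply/cycP.
by exists (m - n)%R; rewrite zpowD zpowN.
Qed.

Lemma cyc_id z : cyc z z. Proof. by exists 1%N; left. Qed.

Lemma left_mul_subgroup X x : is_subgroup X -> X x -> left_mul x X = X.
Proof.
move=> sX Xx; apply/seteqP; split=> y /=.
  by move=> [z Xz <-]; exact: is_subgroupM.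
move=> Xy; exists (x^-1 * y); last by rewrite mulVKg.
by apply: is_subgroupM => //; exact: is_subgroupV.
Qed.

Lemma left_mulM x y X : left_mul x (left_mul y X) = left_mul (x * y) X.
Proof.
apply/seteqP; split=> z /=.
  by move=> [_ [u Xu <-] <-]; exists u => //; rewrite mulgA.
by move=> [u Xu <-]; exists (y * u); [exists u|rewrite mulgA].
Qed.

Lemma left_mul1 X : left_mul 1 X = X.
Proof.
apply/seteqP; split=> z /=; first by move=> [u Xu <-]; rewrite mul1g.
by move=> Xz; exists z; rewrite ?mul1g.
Qed.

(** The vertex alone is an invariant subtree, so the intersection of all invariant subtrees contains
    no edge. *)
Lemma fixed_vertex_volume (T : ftree F) X v :
  vertices T v -> (forall x, X x -> vact x v = v) -> free_volume T X = 0%N.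
Proof.
move=> Tv fixv; rewrite /free_volume.
have -> : @free_edge_orbits F T X = set0; last by rewrite fset_set0 finmap.cardfs0.
rewrite -subset0 => O [e [[_ H] _ _]].
apply: (H [set v] set0); last first.
  by move=> x Xx; split=> [u ->|//]; rewrite /= fixv.
split=> //; first by move=> _ ->.
- by exists v.
- by move=> u w -> ->; exists [::].
Qed.

Lemma elliptic_volume s x : is_cyclic_splitting s -> elliptic s x ->
  free_volume (bass_serre s) (cyc x) = 0%N.
Proof.
have fix_coset (B : set F) y : is_subgroup B -> B (y * x * y^-1) ->
    forall z, cyc x z -> left_mul z (left_mul y^-1 B) = left_mul y^-1 B.
  move=> sB By z /cycP[m ->]; rewrite left_mulM.
  have -> : zpow x m * y^-1 = y^-1 * (zpow (y * x * y^-1) m).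
    by rewrite zpow_conj !mulgA mulVg mul1g.
  by rewrite -left_mulM (left_mul_subgroup sB (is_subgroup_zpow m sB By)).
case: s => [A B c|A t a0 a1] [_ H] /=.
- have [sA sB _ _ _] := H; move=> [y [Ay|By]].
    apply: (@fixed_vertex_volume (bass_serre (Amalgam A B c)) _ (true, left_mul y^-1 A)).
      by exists y^-1; left.
    by move=> z xz /=; rewrite fix_coset.
  apply: (@fixed_vertex_volume (bass_serre (Amalgam A B c)) _ (false, left_mul y^-1 B)).
    by exists y^-1; right.
  by move=> z xz /=; rewrite fix_coset.
- have [sA _ _ _ _] := H; move=> [y Ay].
  apply: (@fixed_vertex_volume (bass_serre (HNN A t a0 a1)) _ (left_mul y^-1 A)); first by exists y^-1.
  by move=> z xz /=; rewrite fix_coset.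
Qed.

Lemma edge_generator_elliptic s : is_cyclic_splitting s -> elliptic s (edge_generator s).
Proof.
case: s => [A B c|A t a0 a1] [_ H] /=; exists 1; rewrite mul1g invg1 mulg1.
  by left; case: H.
by case: H.
Qed.

(** Filling is applied to the cyclic group of the first edge generator, which fixes a vertex of its
    own tree and so must have positive volume in the second. *)
Lemma fill_not_elliptic s1 s2 : is_cyclic_splitting s1 -> is_cyclic_splitting s2 ->
  fill (bass_serre s1) (bass_serre s2) -> ~ elliptic s2 (edge_generator s1).
Proof.
move=> cs1 cs2 fl el; have [c1 _] := cs1.
have := fl (cyc (edge_generator s1)) (cyc_subgroup _).
rewrite (elliptic_volume cs1 (edge_generator_elliptic cs1)) (elliptic_volume cs2 el).
have nt : ~ trivial_subgroup (cyc (edge_generator s1)).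
  by move=> E; apply: c1; have := cyc_id (edge_generator s1); rewrite E.
by move=> /(_ nt) => H; have := H (or_intror (ex_intro _ _ erefl)).
Qed.

Lemma fill_sym (T1 T2 : ftree F) : fill T1 T2 -> fill T2 T1.
Proof. by move=> fl X sX nX HX; rewrite addnC; exact: fl. Qed.

(** A single edge is an arc whose stabilizer is the edge group, and this group is not trivial. *)
Lemma very_small_maximal s : edge_generator s <> 1 -> very_small (bass_serre s) ->
  maximal_cyclic (cyc (edge_generator s)).
Proof.
move=> c1 [vs _].
have nb T (d : dart T) : no_backtracking [:: d].
  by case=> [|? [|? ?]] d1 d2 p2.
have key (T : ftree F) (e : edg T) :
    (forall u p, is_arc u p -> trivial_subgroup (@arc_stab F T p) \/ maximal_cyclic (@arc_stab F T p)) ->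
    edges T e ->
    [set g | eact g e = e] = cyc (edge_generator s) -> maximal_cyclic (cyc (edge_generator s)).
  move=> vT Te Ee; have [||] := vT (org e) [:: (e, true)].
  - by split=> //; exists (trm e).
  - have -> : arc_stab [:: (e, true)] = cyc (edge_generator s).
      rewrite -Ee; apply/seteqP; split=> g /=.
        by move=> H; apply: (H (e, true)); left.
      by move=> H d [<-|[]].
    by move=> E; case: c1; have := cyc_id (edge_generator s); rewrite E.
  - have -> // : arc_stab [:: (e, true)] = cyc (edge_generator s).
    rewrite -Ee; apply/seteqP; split=> g /=.
      by move=> H; apply: (H (e, true)); left.
    by move=> H d [<-|[]].
have stabE (c : F) : [set g | left_mul g (cyc c) = cyc c] = cyc c.
  apply/seteqP; split=> g /=.
    move=> E; have : left_mul g (cyc c) g.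
      by exists 1; [exact: is_subgroup1 (cyc_subgroup c)|rewrite mulg1].
    by rewrite E.
  by move=> cg; apply: left_mul_subgroup => //; exact: cyc_subgroup.
case: s c1 vs key => [A B c|A t a0 a1] c1 vs key.
- apply: (key (bass_serre (Amalgam A B c)) (cyc c)) => //; [by exists 1; rewrite left_mul1|exact: stabE].
- apply: (key (bass_serre (HNN A t a0 a1)) (cyc a0)) => //; [by exists 1; rewrite left_mul1|exact: stabE].
Qed.

(** If c = g^n with n at least 2, maximality gives g = c^m, so that g^(nm-1) = 1 with a nonzero
    exponent, against absence of torsion. *)
Lemma maximal_cyclic_prim {k : nat} {A : 'I_k.+2 -> F} (A_basis : is_basis A) (c : F) :
  c <> 1 -> maximal_cyclic (cyc c) -> not_proper_power c.
Proof.
move=> c1 [_ mx] g n Ec; rewrite leqNgt; apply/negP => n2.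
have Ecg : cyc c = cyc g.
  apply: mx => x /cycP[m ->]; apply/cycP; exists (Posz n * m)%R.
  rewrite Ec; case: m => m /=; first by rewrite -expgnA.
  by rewrite NegzE GRing.mulrN zpowN -expgnA.
have : cyc c g by rewrite Ecg; exact: cyc_id.
have g1 : g <> 1 by move=> g1; apply: c1; rewrite Ec g1 expg1n.
move=> /cycP[m Em].
have E1 : zpow g (Posz n * m - 1)%R = 1.
  rewrite zpowD (zpowN g 1%R) zpow1; apply: (mulIg g); rewrite mulgVK mul1g {2}Em Ec.
  case: m {Em} => m /=; first by rewrite -expgnA.
  by rewrite NegzE GRing.mulrN zpowN -expgnA.
have ne : (Posz n * m - 1 != 0)%R.
  apply/eqP; case: (m) => j; last by rewrite NegzE GRing.mulrN -PoszM; lia.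
  have := leq_mul n2 (leqnn j); rewrite -PoszM; case: j => [|j]; lia.
apply: g1; case: (_ - _)%R ne E1 => [[|j]|j] // _ /=.
  exact: expg_eq1.
by move/(congr1 (fun x => x^-1)) => /=; rewrite invgK invg1; exact: expg_eq1.
Qed.

End TreeConditions.

(** * The boundary and the space of lines *)

Section Rays.
Context {k : nat}.
Implicit Types (x y : boundary k) (p q : boundary2 k) (m n : nat).

Lemma size_prefix_word x n : size (prefix_word x n) = n.
Proof. exact: size_mkseq. Qed.

Lemma nth_prefix_word a x n i : (i < n)%N -> nth a (prefix_word x n) i = val x i.
Proof. by move=> lt; rewrite nth_mkseq. Qed.

Lemma take_prefix_word x m n : (m <= n)%N -> take m (prefix_word x n) = prefix_word x m.
Proof. by move=> le; rewrite /prefix_word /mkseq -map_take take_iota; congr map; congr iota; lia. Qed.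

Lemma prefix_word_leq x y m n : (m <= n)%N -> prefix_word x n = prefix_word y n ->
  prefix_word x m = prefix_word y m.
Proof. by move=> le /(congr1 (take m)); rewrite !take_prefix_word. Qed.

Lemma prefix_word_eqP x y n :
  prefix_word x n = prefix_word y n <-> forall i, (i < n)%N -> val x i = val y i.
Proof.
split=> [E i lt|E].
  by rewrite -(nth_prefix_word (ord0, true) x lt) E nth_prefix_word.
apply: (@eq_from_nth _ (ord0, true)); rewrite ?size_prefix_word // => i lt.
by rewrite !nth_prefix_word ?E.
Qed.

Lemma rayP x n : can_follow (val x n : letter k) (val x n.+1).
Proof. by have := valP x; rewrite inE; exact. Qed.

Lemma ray_ext x y : (forall n, val x n = val y n) -> x = y.
Proof. by move=> E; apply: val_inj; apply/funext. Qed.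

Lemma ray_prefix_ext x y : (forall n, prefix_word x n = prefix_word y n) -> x = y.
Proof.
by move=> E; apply: ray_ext => n; have /prefix_word_eqP := E n.+1; apply.
Qed.

Lemma prefix_word_reduced x n : reduced (prefix_word x n).
Proof.
rewrite /reduced; apply: (path_sorted (x := val x 0%N)).
case: n => // n; rewrite /prefix_word /mkseq /=.
apply/andP; split; first by rewrite /can_follow; case: (sval x 0%N : letter k) => i []; rewrite xpair_eqE andbF.
elim: n 0%N => //= n IH i; rewrite rayP /=; exact: IH.
Qed.

Definition near_ray m x : set (boundary k) := [set y | prefix_word y m = prefix_word x m].

Lemma nbhs_rayP x (U : set (boundary k)) : nbhs x U <-> exists m, near_ray m x `<=` U.
Proof.
split.
  have FF : Filter (filter_from setT (fun m => near_ray m x)).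
    apply: filter_fromT_filter; first by exists 0%N.
    move=> i j; exists (maxn i j) => y h; split.
      exact: (prefix_word_leq (leq_maxl i j) h).
    exact: (prefix_word_leq (leq_maxr i j) h).
  suff cv : (fun y : boundary k => val y) @ (filter_from setT (fun m => near_ray m x)) --> val x.
    rewrite nbhsE => -[B [[C oC <-] Cx] BU].
    have /cv [m _ h] : nbhs (val x) C by exact: open_nbhs_nbhs.
    by exists m; apply: subset_trans BU.
  apply/cvg_sup => i U' [V [[W oW <-] Wx WU']].
  exists i.+1 => // y /prefix_word_eqP E; apply: WU'; rewrite /= -[_ y]/(val y) /=.
  by move: Wx => /=; rewrite (E i).
case=> m /filterS; apply.
elim: m => [|m IH]; first by apply: filterS filterT.
have c : continuous (fun y : boundary k => val y m : discrete_topology (letter k)).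
  have -> : (fun y : boundary k => val y m) =
      (fun f : {ptws nat -> discrete_topology (letter k)} => f m) \o (fun y : boundary k => val y).
    by [].
  move=> y; apply: continuous_comp; first exact: initial_continuous.
  exact: (@proj_continuous _ (fun=> discrete_topology (letter k)) m).
have := c x _ (discrete_set1 (val x m)) => h.
apply: filterS (filterI IH h) => y [/prefix_word_eqP E Em]; apply/prefix_word_eqP => i.
by rewrite ltnS leq_eqVlt => /predU1P[->|/E].
Qed.

Definition near_ends m p q :=
  prefix_word (end1 q) m = prefix_word (end1 p) m /\
  prefix_word (end2 q) m = prefix_word (end2 p) m.

Lemma near_ends_leq m n p q : (m <= n)%N -> near_ends n p q -> near_ends m p q.
Proof. by move=> le [h1 h2]; split; apply: prefix_word_leq le _. Qed.

Lemma nbhs_pairP p (U : set (boundary2 k)) : nbhs p U <-> exists m, near_ends m p `<=` U.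
Proof.
split.
  rewrite nbhsE => -[B [[C oC <-] Cp] BU].
  have : nbhs (val p) C by exact: open_nbhs_nbhs.
  case=> -[U1 U2] [/= /nbhs_rayP[m1 h1] /nbhs_rayP[m2 h2]] UC.
  exists (maxn m1 m2) => q [e1 e2]; apply: BU; apply: UC; split.
    by apply: h1; apply: prefix_word_leq e1; rewrite leq_maxl.
  by apply: h2; apply: prefix_word_leq e2; rewrite leq_maxr.
case=> m /filterS; apply.
have : nbhs (val p) [set x : boundary k * boundary k | near_ray m (end1 p) x.1 /\ near_ray m (end2 p) x.2].
  exists (near_ray m (end1 p), near_ray m (end2 p)) => //=.
  by split; apply/nbhs_rayP; exists m.
by move=> /(@initial_continuous _ _ (fun q : boundary2 k => val q) p).
Qed.

(** The quotient topology is tested on the preimage among pairs of ends, where common prefixes give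
    a basis of neighbourhoods. *)
Lemma open_linesP (U : set (lines k)) : open U <->
  forall p, U (line_of p) -> exists m, forall q, near_ends m p q -> U (line_of q).
Proof.
rewrite /open /= /quotient_open openE; split.
  by move=> h p /h /nbhs_pairP.
by move=> h p /h /nbhs_pairP.
Qed.

Lemma line_ofP p q : line_of p = line_of q <->
  (end1 p = end1 q /\ end2 p = end2 q) \/ (end1 p = end2 q /\ end2 p = end1 q).
Proof. by split=> [/eqmodP/asboolP|h]; [|apply/eqmodP/asboolP]. Qed.

Lemma line_ofK (P : lines k -> Prop) : (forall p, P (line_of p)) -> forall l, P l.
Proof. by move=> h l; rewrite -[l]reprK; exact: h. Qed.

Lemma ends_neq p : end1 p <> end2 p.
Proof. by have := valP p; rewrite inE. Qed.

Lemma pair_ex x y : x <> y -> exists p, end1 p = x /\ end2 p = y.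
Proof.
move=> xy; have h : (x, y) \in @distinct_pairs k by rewrite inE.
by exists (SigSub h); rewrite /end1 /end2 SubK.
Qed.

Lemma pair_ext p q : end1 p = end1 q -> end2 p = end2 q -> p = q.
Proof.
rewrite /end1 /end2 => E1 E2; apply: val_inj.
by move: E1 E2; case: (val p) (val q) => [a b] [c d] /= -> ->.
Qed.

Lemma flip_ex p : exists q, [/\ end1 q = end2 p, end2 q = end1 p & line_of q = line_of p].
Proof.
have [q [q1 q2]] : exists q, end1 q = end2 p /\ end2 q = end1 p.
  by apply: pair_ex => E; apply: (@ends_neq p).
by exists q; split=> //; apply/line_ofP; right; rewrite q1 q2.
Qed.

Lemma ray_build (w : nat -> seq (letter k)) : (forall m, reduced (w m)) ->
  (forall m, (m <= size (w m))%N) ->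
  (forall m n, (m <= n)%N -> take m (w n) = take m (w m)) ->
  exists x, forall m, prefix_word x m = take m (w m).
Proof.
move=> rw sw tw; pose a0 : letter k := (ord0, true).
pose f n : letter k := nth a0 (w n.+1) n.
have fE i n : (i < n)%N -> f i = nth a0 (w n) i.
  move=> lt; rewrite /f -(nth_take a0 (ltnSn i) (w n)) tw // nth_take //.
have fr : (f : nat -> discrete_topology (letter k)) \in @rays k.
  rewrite inE => n; rewrite /= (fE n n.+2) // (fE n.+1 n.+2) //.
  have /(sortedP a0) := rw n.+2; apply; exact: leq_trans (sw _).
exists (SigSub fr) => m; apply: (@eq_from_nth _ a0).
  by rewrite size_prefix_word size_takel.
rewrite size_prefix_word => i lt; rewrite nth_prefix_word // SubK nth_take //.
exact: fE.
Qed.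

End Rays.

(** * Extension to the boundary, geodesics and cylinders *)

Section RayMaps.
Context {F : groupType} {k : nat} {A : 'I_k.+2 -> F} (A_basis : is_basis A).
Implicit Types (g h : F) (x y : boundary k) (p q : boundary2 k) (m n : nat) (u : nat -> F).
Local Notation len := (len A_basis).
Local Notation nf := (nf A_basis).
Local Notation wv := (word_val A).
Local Notation coarse := (coarse A_basis).
Local Notation ray_val := (ray_val A).
Local Notation converges_to := (converges_to A).

Lemma nf_ray x n : nf (ray_val x n) = prefix_word x n.
Proof. by rewrite nf_val // prefix_word_reduced. Qed.

Lemma len_ray x n : len (ray_val x n) = n.
Proof. by rewrite ?lenE nf_ray size_prefix_word. Qed.

Lemma converges_toP u x : converges_to u x <->
  forall m, \forall n \near \oo, take m (nf (u n)) = prefix_word x m.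
Proof.
split=> h m; have := h m; apply: filterS => n.
  by move=> [w [rw <- <-]]; rewrite nf_val.
by move=> E; exists (nf (u n)); rewrite nf_reduced nfK.
Qed.

Lemma converges_to_ray x : converges_to (ray_val x) x.
Proof.
apply/converges_toP => m; exists m => // n /= le.
by rewrite nf_ray take_prefix_word.
Qed.

Lemma converges_to_uniq u x y : converges_to u x -> converges_to u y -> x = y.
Proof.
move=> /converges_toP hx /converges_toP hy; apply: ray_prefix_ext => m.
have [n [<- <-]] := filter_ex (filterI (hx m) (hy m)); by [].
Qed.

Lemma converges_to_agree u v x : converges_to u x ->
  (forall m, \forall n \near \oo, agree A_basis m (u n) (v n)) -> converges_to v x.
Proof.
move=> /converges_toP hu h; apply/converges_toP => m.
by apply: filterS (filterI (hu m) (h m)) => n [<- ->].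
Qed.

Lemma converges_to_ex u :
  (forall m, exists N, forall n, (N <= n)%N -> (m <= len (u n))%N /\ agree A_basis m (u n) (u N)) ->
  exists x, converges_to u x.
Proof.
move=> /choice[N hN].
have S m n : (N m <= n)%N -> (m <= len (u n))%N by move=> /hN[].
have E m n : (N m <= n)%N -> take m (nf (u n)) = take m (nf (u (N m))) by move=> /hN[].
have [x hx] : exists x : boundary k, forall m, prefix_word x m = take m (nf (u (N m))).
  apply: (@ray_build k (fun m => nf (u (N m)))).
  - by move=> m; exact: nf_reduced.
  - by move=> m; apply: S.
  - move=> m n le; have := E m (maxn (N m) (N n)) (leq_maxl _ _) => <-.
    have := E n (maxn (N m) (N n)) (leq_maxr _ _) => /(congr1 (take m)).
    by rewrite !take_takel.
exists x; apply/converges_toP => m; exists (N m) => // n /= le.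
by rewrite hx E.
Qed.

Lemma coarse_far f K m g : coarse f K -> (modulus K m <= len g)%N -> (m <= len (f g))%N.
Proof.
move=> [K0 _ low] h; have := leq_trans h (low g).
by rewrite /modulus leq_mul2l ltnS eqn0Ngt K0 /=; apply: leq_trans; rewrite leq_addr.
Qed.

Lemma agree_ray x m i j : (m <= i)%N -> (m <= j)%N -> agree A_basis m (ray_val x i) (ray_val x j).
Proof. by move=> hi hj; rewrite /agree !nf_ray !take_prefix_word. Qed.

Lemma coarse_ray_ex f K x : coarse f K -> exists y, converges_to (f \o ray_val x) y.
Proof.
move=> cf; apply: converges_to_ex => m; exists (modulus K m) => n le; split.
  by apply: coarse_far cf _; rewrite len_ray.
by apply: coarse_agree cf _; exact: agree_ray.
Qed.

(** The extension of [f] to the boundary; the default value is not reached when [f] is coarse. *)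
Definition bmap (f : F -> F) x : boundary k := xget x [set y | converges_to (f \o ray_val x) y].

Lemma bmapP f K x : coarse f K -> converges_to (f \o ray_val x) (bmap f x).
Proof. by move=> /coarse_ray_ex -/(_ x)[y hy]; rewrite /bmap; case: xgetP => // /(_ y). Qed.

Lemma coarse_converges f K u x : coarse f K -> converges_to u x ->
  converges_to (f \o u) (bmap f x).
Proof.
move=> cf /converges_toP h; apply: (converges_to_agree (bmapP x cf)) => m.
have := h (modulus K m) => [[N _ hN]]; exists (maxn N (modulus K m)) => // n /=.
rewrite geq_max => /andP[n1 n2]; apply: coarse_agree cf _.
rewrite /agree nf_ray take_prefix_word //; symmetry; exact: hN.
Qed.

Lemma prefix_bmap f K x m : coarse f K ->
  prefix_word (bmap f x) m = take m (nf (f (ray_val x (modulus K m)))).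
Proof.
move=> cf; have /converges_toP/(_ m)[N _ h] := bmapP x cf.
rewrite -(h (maxn N (modulus K m))) /=; last by rewrite leq_maxl.
by apply: coarse_agree cf _; apply: agree_ray => //; rewrite leq_maxr.
Qed.

Lemma bmap_near f K x y m : coarse f K ->
  prefix_word y (modulus K m) = prefix_word x (modulus K m) ->
  prefix_word (bmap f y) m = prefix_word (bmap f x) m.
Proof. by move=> cf E; rewrite !(prefix_bmap _ _ cf) /Defs.ray_val E. Qed.

Lemma bmap_uniq f K x y : coarse f K -> converges_to (f \o ray_val x) y -> bmap f x = y.
Proof. by move=> /(bmapP x); exact: converges_to_uniq. Qed.

Lemma bmap_comp (f g : F -> F) K K' x : coarse f K -> coarse g K' ->
  bmap f (bmap g x) = bmap (f \o g) x.
Proof.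
move=> cf cg; have h := coarse_converges cf (bmapP x cg).
rewrite [RHS]/bmap; case: xgetP => [y _ hy|/(_ _ h)//].
by have := converges_to_uniq h hy.
Qed.

Lemma bmap_id x : bmap id x = x.
Proof.
rewrite /bmap; case: xgetP => [y _ hy|//].
exact: (converges_to_uniq hy (converges_to_ray x)).
Qed.

(** Treats left translations and automorphisms alike; the coarse inverse makes the extension a
    homeomorphism. *)
Definition bicoarse (f f' : F -> F) := [/\ exists K, coarse f K, exists K, coarse f' K,
  cancel f f' & cancel f' f].

Lemma bicoarse_sym f f' : bicoarse f f' -> bicoarse f' f.
Proof. by case. Qed.

Lemma bicoarse_trans g : bicoarse (fun z => g * z) (fun z => g^-1 * z).
Proof.
split; [exists (len g).+1 | exists (len g^-1).+1 | exact: mulKg | exact: mulVKg].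
  exact: coarse_trans.
exact: coarse_trans.
Qed.

Lemma bicoarse_aut (f : aut F) : bicoarse f (f^-1%g : aut F).
Proof.
split; [exact: coarse_aut | exact: coarse_aut | |] => x; rewrite -aut_mulE.
  by rewrite mulVg.
by rewrite mulgV.
Qed.

Lemma bmap_can f f' : bicoarse f f' -> cancel (bmap f) (bmap f').
Proof.
move=> [[K cf] [K' cf'] fK _] x; rewrite (bmap_comp _ cf' cf).
have -> : f' \o f = id by apply/funext => z /=; exact: fK.
exact: bmap_id.
Qed.

(** Limits are unique, so the choice made in [line_map] is forced up to the order of the two ends,
    which does not affect the line. *)
Lemma line_mapE f f' p q : bicoarse f f' ->
  end1 q = bmap f (end1 p) -> end2 q = bmap f (end2 p) ->
  line_map A f (line_of p) = line_of q.
Proof.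
move=> [[K cf] _ _ _] q1 q2; rewrite /line_map.
case: xgetP => [l _|/(_ (line_of q))]; last first.
  by case; exists p, q; rewrite q1 q2; split=> //; apply: bmapP cf.
move=> [p' [q' [/line_ofP Ep <- c1 c2]]]; apply/line_ofP.
rewrite q1 q2 -(bmap_uniq cf c1) -(bmap_uniq cf c2).
by case: Ep => -[-> ->]; [left|right].
Qed.

Lemma pair_map f f' p : bicoarse f f' ->
  exists q, end1 q = bmap f (end1 p) /\ end2 q = bmap f (end2 p).
Proof. by move=> bf; apply: pair_ex => /(can_inj (bmap_can bf)); exact: ends_neq. Qed.

Lemma line_map_open f f' (U : set (lines k)) : bicoarse f f' ->
  open U -> open (line_map A f @^-1` U).
Proof.
move=> bf /open_linesP oU; apply/open_linesP => p /=.
have [p' [p1 p2]] := pair_map p bf; case: (bf) => -[K cf] _ _ _.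
rewrite (line_mapE bf p1 p2) => /oU[m h]; exists (modulus K m) => q [e1 e2].
have [q' [q1 q2]] := pair_map q bf; rewrite /= (line_mapE bf q1 q2); apply: h.
by rewrite /near_ends q1 q2 p1 p2; split; apply: bmap_near cf _.
Qed.

Lemma line_map_can f f' : bicoarse f f' -> cancel (line_map A f) (line_map A f').
Proof.
move=> bf; apply: line_ofK => p; have [q [q1 q2]] := pair_map p bf.
rewrite (line_mapE bf q1 q2); apply: (line_mapE (bicoarse_sym bf)); rewrite ?q1 ?q2.
  by rewrite (bmap_can bf).
by rewrite (bmap_can bf).
Qed.

(** Used for g f(z) = f(f^-1(g) z), which exchanges a translation with an automorphism. *)
Lemma line_map_comm (f f1 g g1 h h1 j j1 : F -> F) l : bicoarse f f1 -> bicoarse g g1 ->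
    bicoarse h h1 -> bicoarse j j1 -> (forall z, f (g z) = h (j z)) ->
  line_map A f (line_map A g l) = line_map A h (line_map A j l).
Proof.
move=> bf bg bh bj E; move: l; apply: line_ofK => p.
have [q [q1 q2]] := pair_map p bg; have [r [r1 r2]] := pair_map q bf.
have [s [s1 s2]] := pair_map p bj.
rewrite (line_mapE bg q1 q2) (line_mapE bf r1 r2) (line_mapE bj s1 s2).
have E' : f \o g = h \o j by apply/funext.
symmetry; case: bf bg bh bj => -[? cf] _ _ _ [[? cg] _ _ _] [[Kh ch] h2 h3 h4] [[? cj] _ _ _].
apply: (@line_mapE h h1); first by split=> //; exists Kh.
  by rewrite r1 s1 q1 !(bmap_comp _ cf cg, bmap_comp _ ch cj) E'.
by rewrite r2 s2 q2 !(bmap_comp _ cf cg, bmap_comp _ ch cj) E'.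
Qed.

Lemma line_map_id l : line_map A id l = l.
Proof.
move: l; apply: line_ofK => p; apply: (@line_mapE id id); rewrite ?bmap_id //.
have -> : (@id F) = (fun z => 1 * z) by apply/funext => z; rewrite mul1g.
have := bicoarse_trans 1; by rewrite invg1.
Qed.

Section Segments.
Implicit Types (c : int -> F) (d : nat -> F) (v w s t : seq (letter k)).

Definition geodesic_ray d := (forall n, exists a, d n.+1 = d n * letter_val A a) /\
  forall n, d n.+2 <> d n.

Lemma geodesic_ray_shift d m : geodesic_ray d -> geodesic_ray (fun n => d (m + n)%N).
Proof. by move=> [h1 h2]; split=> n; rewrite !addnS; [exact: h1 | exact: h2]. Qed.

(** Absence of backtracking is a local condition; letter by letter it makes the whole word read
    along the path reduced. *)
Lemma geodesic_ray_len d n : geodesic_ray d -> len ((d 0%N)^-1 * d n) = n.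
Proof.
move=> [h1 h2].
have rc w a : reduced (rcons w a) -> nf (wv w * letter_val A a) = rcons w a.
  by move=> h; rewrite -[RHS](nf_val A_basis h) -cats1 word_val_cat /= mulg1.
suff [a E] : exists a, nf ((d 0%N)^-1 * d n.+1) = rcons (nf ((d 0%N)^-1 * d n)) a /\
    len ((d 0%N)^-1 * d n) = n by case: E.
elim: n => [|n [a [E Es]]].
  have [a ->] := h1 0%N; exists a; rewrite mulKg mulVg nf1 len1; split=> //.
  by rewrite -[letter_val A a]mul1g; exact: (rc [::]).
have [b Eb] := h1 n.+1; exists b; split; last by move: Es; rewrite ?lenE E size_rcons => ->.
have rE : reduced (rcons (nf ((d 0%N)^-1 * d n)) a) by rewrite -E nf_reduced.
have dE : d n.+1 = d n * letter_val A a.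
  have := congr1 wv E; rewrite nfK -cats1 word_val_cat nfK /= mulg1 -mulgA.
  by move=> /mulgI.
rewrite Eb mulgA -[in LHS](nfK A_basis ((d 0%N)^-1 * d n.+1)) rc // E.
move: (nf _) rE => w rE; rewrite /reduced; case: w rE => [|e w] //=.
  rewrite andbT /can_follow => _; apply/eqP => Eba; apply: (h2 n).
  by rewrite Eb dE Eba -mulgA letter_valV mulgV mulg1.
move=> rE; rewrite rcons_path rE last_rcons /can_follow; apply/eqP => Eba; apply: (h2 n).
by rewrite Eb dE Eba -mulgA letter_valV mulgV mulg1.
Qed.

Lemma geodesic_ray_dist d m n : geodesic_ray d -> (m <= n)%N ->
  len ((d m)^-1 * d n) = (n - m)%N.
Proof.
move=> gd le; have := geodesic_ray_len (n - m) (geodesic_ray_shift m gd).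
by rewrite /= addn0 subnKC.
Qed.

Lemma geodesic_ray_cat d m n : geodesic_ray d -> (m <= n)%N ->
  nf ((d 0%N)^-1 * d n) = nf ((d 0%N)^-1 * d m) ++ nf ((d m)^-1 * d n).
Proof.
move=> gd le; rewrite -len_additive mulgA mulgK //.
by rewrite !(geodesic_ray_dist gd) //; lia.
Qed.

Lemma geodesic_rays c : is_geodesic A c -> forall i : int,
  geodesic_ray (fun n => c (i + n%:Z)%R) /\ geodesic_ray (fun n => c (i - n%:Z)%R).
Proof.
move=> [h1 h2] i; split; split=> n.
- have [a Ea] := h1 (i + n%:Z)%R; exists a; rewrite -Ea; congr c; lia.
- have := h2 (i + n%:Z)%R; congr (_ <> _); congr c; lia.
- have [a Ea] := h1 (i - n.+1%:Z)%R; exists (letter_inv a).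
  have -> : (i - n%:Z)%R = (i - n.+1%:Z + 1)%R by lia.
  by rewrite Ea letter_valV mulgK.
- move=> E; apply: (h2 (i - n.+2%:Z)%R); rewrite E; congr c; lia.
Qed.

Lemma geodesic_rev c : is_geodesic A c -> is_geodesic A (fun i => c (- i)%R).
Proof.
move=> gc; have g i := (geodesic_rays gc i).2; split=> i.
  have [a Ea] := (g (- i)%R).1 0%N; exists a; move: Ea; rewrite GRing.subr0 => <-; congr c; lia.
by have := (g (- i)%R).2 0%N; rewrite GRing.subr0; congr (_ <> _); congr c; lia.
Qed.

Lemma converges_shift c x (i : int) : converges_to (fun n : nat => c (Posz n)) x ->
  converges_to (fun n : nat => c (i + n%:Z)%R) x.
Proof.
move=> /converges_toP h; apply/converges_toP => m; have [N _ hN] := h m.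
exists (N + `|i|)%N => // n /= le.
have -> : (i + n%:Z)%R = Posz `|(i + n%:Z)%R|%N by lia.
by apply: hN => /=; lia.
Qed.

Lemma geodesic_end c x (i : int) n : is_geodesic A c ->
  converges_to (fun n : nat => c (Posz n)) x -> c i = 1 ->
  prefix_word x n = nf (c (i + n%:Z)%R).
Proof.
move=> gc cx ci; have /converges_toP/(_ n)[N _ h] := converges_shift i cx.
have gd := (geodesic_rays gc i).1.
have := geodesic_ray_cat gd (leq_maxl n N); rewrite /= GRing.addr0 ci invg1 !mul1g => E.
rewrite -(h (maxn n N)) /=; last by rewrite leq_maxr.
rewrite E take_cat.
have : len (c (i + n%:Z)%R) = n.
  by have := geodesic_ray_len n gd; rewrite GRing.addr0 ci invg1 mul1g.
by rewrite ?lenE => ->; rewrite ltnn subnn take0 cats0.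
Qed.

Definition through s t : set (lines k) := [set l | exists p, [/\ line_of p = l,
  prefix_word (end1 p) (size s) = s & prefix_word (end2 p) (size t) = t]].

Definition seg g h : set (lines k) :=
  [set l | exists c, [/\ geodesic_of A c l, exists i, c i = g & exists j, c j = h]].

(** The rays from 1 to the two ends share their first [s] letters; the line turns at the branch
    point, which is taken as the origin of [c]. *)
Lemma geodesic_branch p (s : nat) : prefix_word (end1 p) s = prefix_word (end2 p) s ->
    val (end1 p) s <> val (end2 p) s ->
  exists2 c, geodesic_of A c (line_of p) & forall n : nat,
    c (Posz n) = ray_val (end1 p) (s + n) /\ c (- n%:Z)%R = ray_val (end2 p) (s + n).
Proof.
move=> E ne; set x := end1 p; set y := end2 p.
pose c (i : int) := match i with Posz n => ray_val x (s + n) | Negz n => ray_val y (s + n.+1) end.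
have c2 n : c (- n%:Z)%R = ray_val y (s + n).
  by case: n => [|n] //; rewrite GRing.oppr0 /= addn0 /Defs.ray_val E.
have st z n : ray_val z n.+1 = ray_val z n * letter_val A (val z n).
  by rewrite /Defs.ray_val /prefix_word mkseqS -cats1 word_val_cat /= mulg1.
have st' z n : exists a, ray_val z n = ray_val z n.+1 * letter_val A a.
  by exists (letter_inv (val z n)); rewrite st letter_valV mulgK.
have lenE z n : len (ray_val z n) = n by exact: len_ray.
exists c; last by [].
split; last first.
  exists p; split=> //; apply/converges_toP => m; exists m => // n /= le.
    by rewrite nf_ray take_prefix_word //; lia.
  by rewrite c2 nf_ray take_prefix_word //; lia.
split=> -[] n.
- exists (val x (s + n)%N).
  have -> : (n%:Z + 1)%R = Posz n.+1 by lia.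
  by rewrite /= addnS st.
- have -> : (Negz n + 1)%R = (- n%:Z)%R by lia.
  by rewrite c2 /= addnS; exact: st'.
- have -> : (n%:Z + 2)%R = Posz n.+2 by lia.
  by move=> /(congr1 len); rewrite /= !lenE; lia.
- have [->|n0] := posnP n.
    have -> : (Negz 0 + 2)%R = Posz 1 by lia.
    move=> /(congr1 nf); rewrite /= !nf_ray => /prefix_word_eqP/(_ s) h; apply: ne; apply: h; lia.
  have -> : (Negz n + 2)%R = (- (n.-1)%:Z)%R by lia.
  by rewrite c2 => /(congr1 len); rewrite /= !lenE; lia.
Qed.

Lemma branch_ex p : exists s : nat, prefix_word (end1 p) s = prefix_word (end2 p) s /\
  val (end1 p) s <> val (end2 p) s.
Proof.
have [n ne] : exists n, (val (end1 p) n : letter k) != val (end2 p) n.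
  apply: contrapT => h; apply: (@ends_neq _ p); apply: ray_ext => n.
  by apply: contrapT => /eqP ne; apply: h; exists n.
have h : exists n, (val (end1 p) n : letter k) != val (end2 p) n by exists n.
case: (ex_minnP h) => s /eqP hs mn; exists s; split=> //.
apply/prefix_word_eqP => i lt; apply/eqP; apply: contraTT lt => ne'.
by rewrite -leqNgt mn.
Qed.

Definition starts_with w p := val (end1 p) 0%N <> val (end2 p) 0%N /\
  (prefix_word (end1 p) (size w) = w \/ prefix_word (end2 p) (size w) = w).

Lemma starts_with_line w p q : line_of p = line_of q -> starts_with w p -> starts_with w q.
Proof.
move=> /line_ofP; case=> -[E1 E2]; rewrite /starts_with E1 E2 //.
by move=> [ne h]; split; [exact: nesym | case: h; [right|left]].
Qed.

Lemma geodesic_at1 c p (i : int) : is_geodesic A c -> c i = 1 ->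
  converges_to (fun n : nat => c (Posz n)) (end1 p) ->
  converges_to (fun n : nat => c (- n%:Z)%R) (end2 p) ->
  (forall n : nat, prefix_word (end1 p) n = nf (c (i + n%:Z)%R) /\
                   prefix_word (end2 p) n = nf (c (i - n%:Z)%R)) /\
  val (end1 p) 0%N <> val (end2 p) 0%N.
Proof.
move=> gc ci c1 c2.
have E1 n := geodesic_end n gc c1 ci.
have E2 n : prefix_word (end2 p) n = nf (c (i - n%:Z)%R).
  rewrite (@geodesic_end (fun i => c (- i)%R) (end2 p) (- i)%R n) //.
  - by congr (nf (c _)); lia.
  - exact: geodesic_rev.
  - by rewrite GRing.opprK.
split=> // E; have : prefix_word (end1 p) 1 = prefix_word (end2 p) 1.
  by apply/prefix_word_eqP => -[].
rewrite E1 E2 => /nf_inj; case: gc => _ /(_ (i - 1)%R) ne h; apply: ne.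
by rewrite -h; congr c; lia.
Qed.

(** A line passes through 1 exactly when the rays from 1 to its ends start with different letters,
    and these rays are then its two halves. *)
Lemma CylP (u : seq (letter k)) p : reduced u -> u <> [::] -> Cyl A (wv u) (line_of p) <-> starts_with u p.
Proof.
move=> ru u0; split.
  move=> [c [[gc [q [Eq c1 c2]]] [i ci] [j cj]]].
  apply: starts_with_line Eq _; have [E ne] := geodesic_at1 gc ci c1 c2.
  split=> //; have [le|lt] := Order.TotalTheory.leP i j.
    left; have Ej : j = (i + `|j - i|%:Z)%R by lia.
    have Eu : u = prefix_word (end1 q) `|j - i| by rewrite (E _).1 -Ej cj nf_val.
    by rewrite [in LHS]Eu size_prefix_word -Eu.
  right; have Ej : j = (i - `|j - i|%:Z)%R by lia.
  have Eu : u = prefix_word (end2 q) `|j - i| by rewrite (E _).2 -Ej cj nf_val.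
  by rewrite [in LHS]Eu size_prefix_word -Eu.
move=> [ne h]; have [//|//|c gc Ec] := @geodesic_branch p 0.
exists c; split=> //; first by exists 0%R; rewrite (Ec 0%N).1.
case: h => Eu; [exists (Posz (size u)) | exists (- (size u)%:Z)%R].
  by rewrite (Ec _).1 /Defs.ray_val Eu.
by rewrite (Ec _).2 /Defs.ray_val Eu.
Qed.

Lemma through_sym s t : through s t = through t s.
Proof.
by apply/seteqP; split=> l [p [<- h1 h2]]; have [q [q1 q2 <-]] := flip_ex p; exists q; rewrite q1 q2.
Qed.

Lemma branch_word s t : size s = size t -> s <> t -> exists r a b s' t',
  [/\ s = r ++ a :: s', t = r ++ b :: t' & a <> b].
Proof.
elim: s t => [|a s IH] [|b t] // [] Es ne.
have [Eab|/eqP nab] := eqVneq a b; last by exists [::], a, b, s, t.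
have [|r [a' [b' [s' [t' [-> -> h]]]]]] := IH t Es; first by move=> E; apply: ne; rewrite Eab E.
by exists (a :: r), a', b', s', t'; rewrite Eab.
Qed.

(** From [wv s] the geodesic goes down to the branch point and up along [t]. As neither word is a
    prefix of the other, it has turned before reaching [wv t], so the rest only prolongs [t]. *)
Lemma seg_end s t c x (i j : int) : reduced s -> reduced t -> size s = size t -> s <> t ->
  is_geodesic A c -> converges_to (fun n : nat => c (Posz n)) x ->
  c i = wv s -> c j = wv t -> (i <= j)%R -> prefix_word x (size t) = t.
Proof.
move=> rs rt sz ne gc cx ci cj le.
have [r [a [b [s' [t' [Es Et ab]]]]]] := branch_word sz ne.
have gd := (geodesic_rays gc i).1.
have Ej : c (i + `|j - i|%:Z)%R = wv t by rewrite -cj; congr c; lia.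
have /converges_toP/(_ (size t))[N _ h] := converges_shift i cx.
have := geodesic_ray_cat gd (leq_maxl `|j - i|%N N); rewrite /= GRing.addr0 ci Ej => E.
rewrite -(h (maxn `|j - i| N)) /=; last by rewrite leq_maxr.
have rI : reduced (word_inv (a :: s') ++ b :: t').
  have rs' : reduced (a :: s') by apply: (@reduced_catr _ r); rewrite -Es.
  have rt' : reduced (b :: t') by apply: (@reduced_catr _ r); rewrite -Et.
  move: rs'; rewrite -reducedV /word_inv /= rev_cons => rs'.
  apply: reduced_cat_lasthead => //; rewrite /can_follow letter_invK.
  by apply/eqP => /esym.
move: E; set z := (wv t)^-1 * _ => E.
have Est : (wv s)^-1 * wv t = wv (word_inv (a :: s') ++ b :: t').
  by rewrite Es Et !word_val_cat word_valV invgM -!mulgA mulKg.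
have rE : reduced ((word_inv (a :: s') ++ b :: t') ++ nf z).
  by rewrite -(nf_val A_basis rI) -Est -E nf_reduced.
rewrite -catA in rE; have {}rE := reduced_catr rE.
have -> : c (i + maxn `|(j - i)%R|%N N)%R = wv (t ++ nf z).
  by rewrite word_val_cat nfK mulVKg.
rewrite nf_val ?take_size_cat // Et -catA; apply: reduced_glue => //.
by rewrite -Et.
Qed.

Lemma seg_through s t : reduced s -> reduced t -> size s = size t -> s <> t ->
  seg (wv s) (wv t) = through s t.
Proof.
move=> rs rt sz ne; apply/seteqP; split=> [l|l [p [<- p1 p2]]].
  wlog: s t rs rt sz ne l / exists c, geodesic_of A c l /\
      exists i j, [/\ (i <= j)%R, c i = wv s & c j = wv t].
    move=> W [c [gc [i ci] [j cj]]]; have [le|/Order.POrderTheory.ltW le] := Order.TotalTheory.leP i j.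
      by apply: W => //; [exists c; split=> //; exists i, j | exists c; split=> //; [exists i|exists j]].
    rewrite through_sym; apply: W => //; first exact: nesym.
      by exists c; split=> //; exists j, i.
    by exists c; split=> //; [exists j|exists i].
  move=> [c [[gc [p [Ep c1 c2]]] [i [j [le ci cj]]]]] _.
  rewrite through_sym; exists p; split=> //.
    exact: seg_end rs rt sz ne gc c1 ci cj le.
  apply: (@seg_end t s (fun i => c (- i)%R) _ (- j)%R (- i)%R) => //.
  - exact: nesym.
  - exact: geodesic_rev.
  - by rewrite GRing.opprK.
  - by rewrite GRing.opprK.
  - by lia.
have [n [En ne']] := branch_ex p; have [c gc Ec] := geodesic_branch En ne'.
have le : (n <= size t)%N.
  rewrite leqNgt; apply/negP => lt; apply: ne; rewrite -p1 -p2 sz.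
  by apply: prefix_word_leq En; exact: ltnW.
exists c; split=> //.
  by exists (Posz (size s - n)%N); rewrite (Ec _).1 subnKC ?sz // /Defs.ray_val -sz p1.
by exists (- (size t - n)%N%:Z)%R; rewrite (Ec _).2 subnKC // /Defs.ray_val p2.
Qed.

Lemma seg_trans (x g h : F) l : seg g h l -> seg (x * g) (x * h) (line_map A (fun z => x * z) l).
Proof.
move=> [c [[gc [p [<- c1 c2]]] [i ci] [j cj]]]; have bx := bicoarse_trans x.
have [q [q1 q2]] := pair_map p bx; rewrite (line_mapE bx q1 q2).
case: bx => -[K cK] _ _ _.
exists (fun i => x * c i); split; [split | by exists i; rewrite ci | by exists j; rewrite cj].
  case: gc => h1 h2; split=> m; first by have [a ->] := h1 m; exists a; rewrite mulgA.
  by move=> /mulgI; exact: h2.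
exists q; rewrite q1 q2; split=> //.
  exact: (coarse_converges cK c1).
exact: (coarse_converges cK c2).
Qed.

Lemma seg_preimage (x g h : F) :
  line_map A (fun z => x * z) @^-1` seg (x * g) (x * h) = seg g h.
Proof.
apply/seteqP; split=> l /=; last exact: seg_trans.
move=> /(seg_trans x^-1); rewrite !mulKg.
by rewrite (line_map_can (bicoarse_trans x)).
Qed.

Lemma seg_Cyl g h : seg g h = line_map A (fun z => g^-1 * z) @^-1` Cyl A (g^-1 * h).
Proof. by rewrite -(seg_preimage g^-1 g h) mulVg. Qed.

End Segments.

End RayMaps.

(** * Boxes in the space of lines *)

Section Keys.
Context {k : nat}.
Implicit Types (x y : boundary k) (p q : boundary2 k) (m n : nat) (l : lines k).

Definition prefix_tuple x m : m.-tuple (letter k) :=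
  Tuple (introT eqP (size_prefix_word x m)).

Lemma prefix_tupleE x y m : prefix_tuple x m = prefix_tuple y m <->
  prefix_word x m = prefix_word y m.
Proof. by split=> [/(congr1 val)|E]; [|apply: val_inj]. Qed.

Definition key_type m := (m.-tuple (letter k) * m.-tuple (letter k))%type.

(** The order of the codes picks a representative of the unordered pair, so that the type of keys
    remains a finite type. *)
Definition unordered m (s t : m.-tuple (letter k)) : key_type m :=
  if (pickle s <= pickle t)%N then (s, t) else (t, s).

Lemma unorderedC m (s t : m.-tuple (letter k)) : unordered s t = unordered t s.
Proof.
rewrite /unordered; case: ltngtP => // E.
by have -> : s = t by apply: (pcan_inj (@pickleK _)).
Qed.

Lemma unorderedP m (s t s' t' : m.-tuple (letter k)) : unordered s t = unordered s' t' <->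
  (s = s' /\ t = t') \/ (s = t' /\ t = s').
Proof.
split; last by case=> -[-> ->] //; exact: unorderedC.
by rewrite /unordered; case: ifP => _; case: ifP => _ [-> ->]; auto.
Qed.

(* The lines with the same key at level m form a box of the cover by pairs of
   prefixes of length m. *)
Definition key m l : key_type m :=
  unordered (prefix_tuple (end1 (repr l)) m) (prefix_tuple (end2 (repr l)) m).

Lemma key_line m p : key m (line_of p) =
  unordered (prefix_tuple (end1 p) m) (prefix_tuple (end2 p) m).
Proof.
rewrite /key; set q := repr _.
have : line_of q = line_of p by rewrite /line_of reprK.
by move=> /line_ofP[] [-> ->] //; exact: unorderedC.
Qed.

Lemma key_through m p : [set l | key m l = key m (line_of p)] =
  through (prefix_word (end1 p) m) (prefix_word (end2 p) m).
Proof.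
apply/seteqP; split.
  apply: line_ofK => q /=; rewrite !key_line => /unorderedP.
  case=> -[/prefix_tupleE E1 /prefix_tupleE E2].
    by exists q; rewrite !size_prefix_word E1 E2.
  have [q' [q1 q2 Eq]] := flip_ex q; exists q'; split=> //.
    by rewrite size_prefix_word q1 E2.
  by rewrite size_prefix_word q2 E1.
move=> _ [q [<-]]; rewrite !size_prefix_word /= => E1 E2.
by rewrite !key_line; apply/unorderedP; left; split; apply/prefix_tupleE.
Qed.

Lemma key_leq m n l l' : (m <= n)%N -> key n l = key n l' -> key m l = key m l'.
Proof.
move=> le; move: l l'; apply: line_ofK => p; apply: line_ofK => q.
rewrite !key_line => /unorderedP h; apply/unorderedP.
by case: h => -[/prefix_tupleE h1 /prefix_tupleE h2]; [left|right];
  split; apply/prefix_tupleE; apply: prefix_word_leq le _.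
Qed.

Lemma open_keyP (U : set (lines k)) : open U <->
  forall l, U l -> exists m, forall l', key m l' = key m l -> U l'.
Proof.
rewrite open_linesP; split=> [h|h p].
  apply: line_ofK => p /h[m hm]; exists m.
  move=> l' E; have : [set l | key m l = key m (line_of p)] l' by [].
  rewrite key_through => -[q [<-]]; rewrite !size_prefix_word => E1 E2.
  by apply: hm.
move=> /h[m hm]; exists m => q [E1 E2]; apply: hm; rewrite !key_line.
by apply/unorderedP; left; split; apply/prefix_tupleE.
Qed.

(** Distinct prefixes mean that the line turns before level [m]. Such a nonempty box is a translate
    of a cylinder, whereas a box with equal prefixes contains lines arbitrarily far from 1. *)
Definition proper_key m (i : key_type m) : bool := i.1 != i.2.

Lemma proper_line m p : proper_key (key m (line_of p)) =
  (prefix_word (end1 p) m != prefix_word (end2 p) m).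
Proof.
rewrite key_line /proper_key /unordered; case: ifP => _ //=.
by rewrite eq_sym.
Qed.

Lemma proper_leq m n l : (m <= n)%N -> proper_key (key m l) -> proper_key (key n l).
Proof.
move=> le; move: l; apply: line_ofK => p; rewrite !proper_line.
by apply: contra_neq; exact: prefix_word_leq.
Qed.

Lemma proper_ex l : exists m, proper_key (key m l).
Proof.
move: l; apply: line_ofK => p; have [s [_ ne]] := branch_ex p; exists s.+1.
by rewrite proper_line; apply/eqP => /prefix_word_eqP/(_ s) E; apply: ne; exact: E.
Qed.

Definition fiber m (i : key_type m) : set (lines k) := [set l | key m l = i].

Lemma fiber_open m i : open (@fiber m i).
Proof. by apply/open_keyP => l <-; exists m. Qed.

(** The boxes at the levels that work for single lines are open and cover [K]; the largest level in
    a finite subcover serves everywhere by monotonicity. *)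
Lemma compact_uniform (K : set (lines k)) (Q : forall m, key_type m -> Prop) :
  compact K -> (forall m n l, (m <= n)%N -> Q m (key m l) -> Q n (key n l)) ->
  (forall l, K l -> exists m, Q m (key m l)) -> exists m, forall l, K l -> Q m (key m l).
Proof.
move=> cK mon ex.
have [f hf] : exists f : lines k -> nat, forall l, K l -> Q (f l) (key (f l) l).
  suff /choice[f hf] : forall l, exists m, K l -> Q m (key m l) by exists f.
  by move=> l; have [/ex[m hm]|nK] := pselect (K l); [exists m|exists 0%N].
move: cK; rewrite compact_cover => /(_ _ K (fun l => fiber (key (f l) l))) [].
- by move=> l _; exact: fiber_open.
- by move=> l Kl; exists l.
move=> D DK cov; exists (\max_(l <- D) f l) => l /cov[l' /= l'D El'].
have le : (f l' <= \max_(l <- D) f l)%N by rewrite (big_rem l') //= leq_maxl.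
apply: mon le _; rewrite El'; apply: hf.
by have := DK _ l'D; rewrite inE.
Qed.

Lemma fiber_cover m (S : set (lines k)) : (forall l, S l -> fiber (key m l) `<=` S) ->
  exists D : {fset key_type m}, S = \big[setU/set0]_(i <- D) fiber i /\
    forall i, i \in D <-> exists2 l, S l & i = key m l.
Proof.
move=> h; pose D := [fset i | i in [pred i : key_type m | `[< exists2 l, S l & i = key m l >]]]%fset.
have DP i : i \in D <-> exists2 l, S l & i = key m l.
  split=> [/imfsetP[j /= + ->]|H]; first by move/asboolP.
  by apply/imfsetP; exists i => //=; apply/asboolP.
exists D; split=> //; rewrite -bigcup_fset; apply/seteqP; split=> l.
  by move=> Sl; exists (key m l) => //=; apply/DP; exists l.
by move=> [i /= /DP[l' Sl' ->]]; exact: h.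
Qed.

Lemma trivIset_fiber m (D : set (key_type m)) : trivIset D (@fiber m).
Proof. by move=> i j _ _ [l [<- <-]]. Qed.

End Keys.

(** * Cylinders as compact open sets *)

Section Cylinders.
Context {F : groupType} {k : nat} {A : 'I_k.+2 -> F} (A_basis : is_basis A).
Implicit Types (g h : F) (p q : boundary2 k) (u : seq (letter k)).
Local Notation wv := (word_val A).

Lemma starts_with_near u p q : near_ends (size u).+1 p q -> starts_with u p -> starts_with u q.
Proof.
move=> near [ne h]; have [E1 E2] := near_ends_leq (leqnSn (size u)) near.
case: near => /prefix_word_eqP/(_ 0%N) F1 /prefix_word_eqP/(_ 0%N) F2.
by rewrite /starts_with E1 E2 F1 // F2.
Qed.

Lemma near_ends_sym m p q : near_ends m p q -> near_ends m q p.
Proof. by case. Qed.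

Lemma Cyl_open u : reduced u -> u <> [::] -> open (Cyl A (wv u)).
Proof.
move=> ru u0; apply/open_linesP => p /(CylP A_basis _ ru u0) h; exists (size u).+1 => q near.
by apply/(CylP A_basis _ ru u0); apply: starts_with_near near h.
Qed.

Lemma Cyl_openC u : reduced u -> u <> [::] -> open (~` Cyl A (wv u)).
Proof.
move=> ru u0; apply/open_linesP => p h; exists (size u).+1 => q near.
move=> /(CylP A_basis _ ru u0) hq; apply: h; apply/(CylP A_basis _ ru u0).
by apply: starts_with_near hq; exact: near_ends_sym.
Qed.

Lemma ultra_letter (G : set_system (boundary2 k)) (f : boundary2 k -> letter k) :
  UltraFilter G -> exists a, G [set p | f p = a].
Proof.
move=> UG; apply: contrapT => h.
have GN a : G [set p | f p <> a].
  have [ga|//] := in_ultra_setVsetC [set p | f p = a] UG.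
  by case: h; exists a.
have /filter_ex[p] : G [set p | f p \notin enum [set: letter k]].
  elim: (enum _) => [|a s IH]; first by apply: filterS filterT.
  apply: filterS (filterI (GN a) IH) => p [/eqP h1 h2] /=.
  by rewrite inE negb_or h1.
by rewrite /= mem_enum in_setT.
Qed.

(** An ultrafilter on pairs decides every letter of both ends, the alphabet being finite. The two
    limit rays are distinct because their first letters differ. *)
Lemma Cyl_compact u : reduced u -> u <> [::] -> compact (Cyl A (wv u)).
Proof.
move=> ru u0; pose C : set (boundary2 k) := [set p | val (end1 p) 0%N <> val (end2 p) 0%N /\
  prefix_word (end1 p) (size u) = u].
have -> : Cyl A (wv u) = @line_of k @` C.
  apply/seteqP; split=> [|_ [p [ne Eu] <-]]; last by apply/(CylP A_basis _ ru u0); split; [|left].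
  apply: line_ofK => p /(CylP A_basis _ ru u0)[ne [h|h]]; first by exists p.
  have [q [q1 q2 <-]] := flip_ex p; exists q => //; rewrite /C /= q1 q2; split=> //.
  exact: nesym.
apply: continuous_compact; first by apply: continuous_subspaceT; exact: pi_continuous.
rewrite compact_ultra => G UG GC.
have /choice[x hx] n := ultra_letter (fun p => val (end1 p) n) UG.
have /choice[y hy] n := ultra_letter (fun p => val (end2 p) n) UG.
have Gx m : G [set p | forall i, (i < m)%N -> val (end1 p) i = x i].
  elim: m => [|m IH]; first by apply: filterS filterT.
  apply: filterS (filterI IH (hx m)) => p [h1 h2] i.
  by rewrite ltnS leq_eqVlt => /predU1P[->|/h1].
have Gy m : G [set p | forall i, (i < m)%N -> val (end2 p) i = y i].
  elim: m => [|m IH]; first by apply: filterS filterT.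
  apply: filterS (filterI IH (hy m)) => p [h1 h2] i.
  by rewrite ltnS leq_eqVlt => /predU1P[->|/h1].
have mk z (zf : forall m, exists p : boundary k, forall i, (i < m)%N -> val p i = z i) :
    exists r : boundary k, forall i, val r i = z i.
  have zr : (z : nat -> discrete_topology (letter k)) \in @rays k.
    rewrite inE => n; have [p hp] := zf n.+2; rewrite /= -!hp //; exact: rayP.
  by exists (SigSub zr) => i; rewrite SubK.
have [X hX] : exists r : boundary k, forall i, val r i = x i.
  by apply: mk => m; have [p hp] := filter_ex (Gx m); exists (end1 p).
have [Y hY] : exists r : boundary k, forall i, val r i = y i.
  by apply: mk => m; have [p hp] := filter_ex (Gy m); exists (end2 p).
have [p0 [h0 [[ne Eu] h1]]] := filter_ex (filterI (Gx (size u).+1) (filterI GC (Gy (size u).+1))).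
have ne' : val X 0%N <> val Y 0%N by rewrite hX hY -h0 // -h1.
have [p [p1 p2]] : exists p, end1 p = X /\ end2 p = Y.
  by apply: pair_ex => E; apply: ne'; rewrite E.
exists p; split.
  rewrite /C /= p1 p2; split=> //; rewrite -[RHS]Eu; apply/prefix_word_eqP => i lt.
  by rewrite hX h0 // ltnW.
move=> U /nbhs_pairP[m hm]; apply: filterS (filterI (Gx m) (Gy m)) => q [q1 q2].
apply: hm; rewrite /near_ends p1 p2; split; apply/prefix_word_eqP => i lt.
  by rewrite hX q1.
by rewrite hY q2.
Qed.

Lemma line_map_continuous f f' : bicoarse A_basis f f' -> continuous (line_map A f).
Proof. by move=> bf; apply/continuousP => U oU; apply: line_map_open bf oU. Qed.

Lemma line_map_compact f f' (K : set (lines k)) : bicoarse A_basis f f' -> compact K ->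
  compact (line_map A f @^-1` K).
Proof.
move=> bf cK; have -> : line_map A f @^-1` K = line_map A f' @` K.
  apply/seteqP; split=> l /=; last by move=> [l' Kl' <-]; rewrite /= (line_map_can (bicoarse_sym bf)).
  by move=> h; exists (line_map A f l) => //; rewrite (line_map_can bf).
apply: continuous_compact => //; apply: continuous_subspaceT.
exact: line_map_continuous (bicoarse_sym bf).
Qed.

Lemma proper_fiber m (i : key_type m) l : proper_key i -> key m l = i ->
  exists g u, [/\ reduced u, u <> [::] &
    fiber i = line_map A (fun z => g * z) @^-1` Cyl A (wv u)].
Proof.
move: l; apply: line_ofK => p pi Ei; rewrite -Ei in pi *; rewrite proper_line in pi.
set s := prefix_word (end1 p) m in pi; set t := prefix_word (end2 p) m in pi.
exists (wv s)^-1, (nf A_basis ((wv s)^-1 * wv t)); split.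
- exact: nf_reduced.
- move=> E; have := nfK A_basis ((wv s)^-1 * wv t); rewrite E => /esym /(congr1 (fun z => wv s * z)).
  rewrite mulVKg mulg1 => /(congr1 (nf A_basis)); rewrite !nf_val ?prefix_word_reduced // => Est.
  by move/eqP: pi => ne; apply: ne; rewrite Est.
rewrite /fiber key_through -(seg_through A_basis) ?prefix_word_reduced ?size_prefix_word //.
  by rewrite (nfK A_basis) (seg_Cyl A_basis).
exact/eqP.
Qed.

Lemma clopen_fibers (S : set (lines k)) : compact S -> open S ->
  exists m (D : {fset key_type (k := k) m}), S = \big[setU/set0]_(i <- D) fiber i /\
    forall i, i \in D -> exists g u, [/\ reduced u, u <> [::] &
      fiber i = line_map A (fun z => g * z) @^-1` Cyl A (wv u)].
Proof.
move=> cS /open_keyP oS.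
have [||m hm] := @compact_uniform k S (fun m i => proper_key i /\ fiber i `<=` S) cS.
- move=> m n l le [h1 h2]; split; first exact: proper_leq h1.
  by move=> l' /(key_leq le) E; apply: h2.
- move=> l Sl; have [m1 h1] := proper_ex l; have [m2 h2] := oS l Sl.
  exists (maxn m1 m2); split; first by apply: proper_leq h1; exact: leq_maxl.
  by move=> l' /(key_leq (leq_maxr m1 m2)); exact: h2.
have [D [E DP]] := @fiber_cover k m S (fun l Sl => (hm l Sl).2).
exists m, D; split=> // i /DP[l Sl ->]; apply: (@proper_fiber m _ l) => //.
by case: (hm l Sl).
Qed.

End Cylinders.

(** Otherwise the middle letter would be its own inverse, or the two middle letters would cancel.
    Hence a word and its inverse never occur at the same position. *)
Lemma word_inv_neq {k : nat} (v : seq (letter k)) : reduced v -> v <> [::] -> v <> word_inv v.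
Proof.
move=> rv v0 E; pose a0 : letter k := (ord0, true); set n := size v.
have n0 : (0 < n)%N by rewrite lt0n size_eq0; apply/eqP.
have h t : (t < n)%N -> nth a0 v t = letter_inv (nth a0 v (n - t.+1)).
  move=> lt; rewrite {1}E /word_inv nth_rev ?size_map //.
  by rewrite (nth_map a0) //; rewrite -/n; lia.
have ne a : a <> @letter_inv k a by case: a => i [].
have [od|ev] := boolP (odd n).
  apply: (ne (nth a0 v n./2)); rewrite {1}h; last by have := odd_double_half n; lia.
  by congr (letter_inv (nth _ _ _)); have := odd_double_half n; rewrite od -muln2; lia.
have := sortedP a0 rv => /(_ (n./2.-1)).
have Dn := odd_double_half n; rewrite (negbTE ev) -muln2 in Dn.
rewrite prednK; last by lia.
move=> cf; have /cf/negP : (n./2 < size v)%N by rewrite -/n; lia.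
apply; rewrite h; last by lia.
by apply/eqP; congr (letter_inv (nth _ _ _)); lia.
Qed.

(** * Axes *)

Section PeriodicWords.
Context {k : nat} {C : seq (letter k)} (C0 : C != [::]) (C_cyc : cyc_reduced C).
Local Notation l := (size C).
Implicit Types (i j n q : nat) (v : seq (letter k)).

Definition periodic i : letter k := nth (ord0, true) C (i %% l).
Local Notation W := periodic.

Let l0 : (0 < l)%N. Proof. by rewrite lt0n size_eq0. Qed.

Lemma periodicD i q : W (i + q * l) = W i.
Proof. by rewrite /periodic addnC modnMDl. Qed.

Definition window i n := mkseq (fun t => W (i + t)%N) n.

Lemma size_window i n : size (window i n) = n. Proof. exact: size_mkseq. Qed.

Lemma nth_window a i n t : (t < n)%N -> nth a (window i n) t = W (i + t)%N.
Proof. exact: nth_mkseq. Qed.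

Lemma window_eqP a i n v : window i n = v <-> size v = n /\ forall t, (t < n)%N -> nth a v t = W (i + t)%N.
Proof.
split=> [<-|[sv h]]; first by split=> [|t lt]; [exact: size_window | exact: nth_window].
by apply: (@eq_from_nth _ a); rewrite size_window // => t lt; rewrite nth_window // h.
Qed.

Lemma windowD i m n : window i (m + n) = window i m ++ window (i + m) n.
Proof.
apply/(window_eqP (ord0, true)); rewrite size_cat !size_window; split=> // t lt.
rewrite nth_cat size_window; case: ltnP => h; first by rewrite nth_window.
by rewrite nth_window; [congr W|]; lia.
Qed.

Lemma window_period i q n : window (i + q * l) n = window i n.
Proof. by apply: eq_mkseq => t; rewrite addnAC periodicD. Qed.

Lemma wpow_window n : wpow C n = window 0 (n * l).
Proof.
elim: n => [|n IH]; first by [].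
rewrite mulSn windowD add0n; have -> : window l (n * l) = window 0 (n * l).
  by have := window_period 0 1 (n * l)%N; rewrite add0n mul1n.
rewrite -IH /=; congr (_ ++ _); symmetry.
apply/(window_eqP (ord0, true)); split=> // t lt.
by rewrite /periodic add0n modn_small.
Qed.

Lemma window_reduced i n : reduced (window i n).
Proof.
apply: (@reduced_catr _ (window 0 i)); rewrite -(add0n i) -windowD add0n.
apply: (@reduced_catl _ _ (window (i + n) ((i + n) * l - (i + n)))).
rewrite -[in window (i + n) _](add0n (i + n)%N) -windowD subnKC; last by rewrite leq_pmulr.
by rewrite -wpow_window; exact: reduced_wpow.
Qed.

Lemma occurs_at_window v i : occurs_at v C i = (window i (size v) == v).
Proof.
apply/forallP/eqP => [h|/(window_eqP (ord0, true))[_ h] j].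
  apply/(window_eqP (ord0, true)); split=> // t lt; have /eqP := h (Ordinal lt).
  by rewrite !(onth_in (ord0, true)) ?ltn_mod //= => -[].
by rewrite !(onth_in (ord0, true)) ?ltn_mod //= h.
Qed.

(* The ends of the axis of the periodic word C, translated so that the j-th vertex
   is 1. Adding multiples of l to the indices avoids truncated subtraction. *)
Definition is_fwd j (x : boundary k) := forall n, val x n = W (j + n)%N.
Definition is_bwd j (x : boundary k) :=
  forall n, val x n = letter_inv (W (j + (n.+1 * l - n.+1))%N).

Lemma can_follow_W i : can_follow (W i) (W i.+1).
Proof. by have := window_reduced i 2; rewrite /reduced /= addn0 addn1 andbT. Qed.

Lemma fwd_ex j : exists x, is_fwd j x.
Proof.
have h : ((fun n => W (j + n)%N) : nat -> discrete_topology (letter k)) \in @rays k.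
  by rewrite inE => n; rewrite addnS; exact: can_follow_W.
by exists (SigSub h) => n; rewrite SubK.
Qed.

Lemma bwd_ex j : exists x, is_bwd j x.
Proof.
have h : ((fun n => letter_inv (W (j + (n.+1 * l - n.+1))%N)) : nat -> discrete_topology (letter k)) \in @rays k.
  rewrite inE => n; rewrite /= can_followV.
  have -> : W (j + (n.+1 * l - n.+1)) = W (j + (n.+2 * l - n.+2)).+1.
    rewrite -[in LHS](periodicD _ 1); congr W; move: (leq_pmulr n.+1 l0).
    by rewrite !mulSn; lia.
  exact: can_follow_W.
by exists (SigSub h) => n; rewrite SubK.
Qed.

Lemma prefix_fwd j x n : is_fwd j x -> prefix_word x n = window j n.
Proof. by move=> h; apply/esym/(window_eqP (ord0, true)); rewrite size_prefix_word; split=> // t lt; rewrite nth_prefix_word. Qed.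

Lemma prefix_bwd j x n : is_bwd j x -> prefix_word x n = word_inv (window (j + (n * l - n)) n).
Proof.
move=> h; apply: (@eq_from_nth _ (ord0, true)).
  by rewrite size_prefix_word size_word_inv size_window.
rewrite size_prefix_word => t lt; rewrite nth_prefix_word // h /word_inv nth_rev.
  rewrite size_map size_window (nth_map (ord0, true)) ?size_window; last by lia.
  rewrite nth_window; last by lia.
  congr letter_inv; rewrite -(periodicD _ (n - t.+1)); congr W.
  have := leq_pmulr n l0; have := leq_pmulr t.+1 l0.
  have : (n * l = (n - t.+1) * l + t.+1 * l)%N by rewrite -mulnDl subnK.
  by move: (n * l)%N (t.+1 * l)%N ((n - t.+1) * l)%N; lia.
by rewrite size_map size_window.
Qed.

Lemma fwd_bwd_neq j x y : is_fwd j x -> is_bwd j y -> val x 0%N <> val y 0%N.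
Proof.
move=> hx hy; rewrite hx hy addn0 mul1n => E.
have := can_follow_W (j + (l - 1)); rewrite /can_follow -E -[W j](periodicD _ 1).
by have -> : (j + (l - 1)).+1 = (j + 1 * l)%N; [move: l0; lia | rewrite eqxx].
Qed.

Definition is_axis j (p : boundary2 k) := is_fwd j (end1 p) /\ is_bwd j (end2 p).

Lemma axis_ex j : exists p, is_axis j p.
Proof.
have [x hx] := fwd_ex j; have [y hy] := bwd_ex j.
have [p [p1 p2]] : exists p, end1 p = x /\ end2 p = y.
  by apply: pair_ex => E; apply: (fwd_bwd_neq hx hy); rewrite E.
by exists p; rewrite /is_axis p1 p2.
Qed.

Lemma axis_uniq j (p q : boundary2 k) : is_axis j p -> is_axis j q -> p = q.
Proof.
move=> [p1 p2] [q1 q2]; apply: pair_ext; apply: ray_ext => n.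
  by rewrite p1 q1.
by rewrite p2 q2.
Qed.

Lemma axis_starts j p v : v <> [::] -> is_axis j p ->
  starts_with v p <-> occurs_at v C j || occurs_at (word_inv v) C (j + (size v * l - size v)).
Proof.
move=> v0 [hx hy]; rewrite /starts_with (prefix_fwd _ hx) (prefix_bwd _ hy) !occurs_at_window size_word_inv.
split=> [[_ []] h|/orP[]/eqP h]; rewrite ?h ?eqxx //.
- by rewrite -[in word_inv v]h word_invK eqxx orbT.
- by split; [exact: fwd_bwd_neq hx hy | left].
- by split; [exact: fwd_bwd_neq hx hy | right; rewrite ?h word_invK].
Qed.

Lemma sum_periodic (f : nat -> nat) s : (forall i, f (i + l)%N = f i) ->
  (\sum_(0 <= j < l) f (j + s) = \sum_(0 <= j < l) f j)%N.
Proof.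
move=> pf; elim: s => [|s IH]; first by under eq_bigr do rewrite addn0.
rewrite -IH; case: (l) l0 pf => // m _ pf.
rewrite big_nat_recr //= [RHS]big_nat_recl //= addnC add0n.
have -> : (m + s.+1 = s + m.+1)%N by lia.
by rewrite pf; congr addn; apply: eq_bigr => i _; congr f; lia.
Qed.

(** Each side counts two mutually exclusive events, and the shift by [s] of the index on the
    backward half is harmless by periodicity. *)
Lemma occurrences_axis v : reduced v -> v <> [::] ->
  count (fun j => occurs_at v C j || occurs_at (word_inv v) C (j + (size v * l - size v))) (iota 0 l)
  = occurrences v C.
Proof.
move=> rv v0; set s := (_ - _)%N.
have vV : v <> word_inv v.
  exact: word_inv_neq.
have cE (a b : pred nat) : (forall j, ~~ (a j && b j)) ->
    count (fun j => a j || b j) (iota 0 l) = (\sum_(0 <= j < l) a j + \sum_(0 <= j < l) b j)%N.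
  move=> ex; rewrite -big_split -sum1_count big_mkcond /index_iota subn0.
  by apply: eq_bigr => j _ /=; have := ex j; case: (a j); case: (b j).
rewrite /occurrences !cE.
- congr addn; rewrite (@sum_periodic (fun j => occurs_at (word_inv v) C j) s) // => i.
  by rewrite !occurs_at_window -[in window (i + l) _](mul1n l) window_period.
- move=> j; rewrite !occurs_at_window size_word_inv; apply/negP => /andP[/eqP h1 /eqP h2].
  by apply: vV; rewrite -h2.
- move=> j; rewrite !occurs_at_window size_word_inv; apply/negP => /andP[/eqP h1 /eqP h2].
  have [p [hx hy]] := axis_ex j; apply: (fwd_bwd_neq hx hy).
  have sv : (0 < size v)%N by case: (v) v0.
  have : prefix_word (end1 p) (size v) = prefix_word (end2 p) (size v).
    by rewrite (prefix_fwd _ hx) (prefix_bwd _ hy) h1 h2 word_invK.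
  by move=> /prefix_word_eqP; apply.
Qed.

End PeriodicWords.

(** * Translates of an axis *)

Section AxisLines.
Context {F : groupType} {k : nat} {A : 'I_k.+2 -> F} (A_basis : is_basis A).
Implicit Types (g h x : F) (p q : boundary2 k) (u : seq (letter k)) (l : lines k).
Local Notation wv := (word_val A).
Local Notation nf := (nf A_basis).
Local Notation len := (len A_basis).
Local Notation converges_to := (converges_to A).
Local Notation bicoarse := (bicoarse A_basis).
Local Notation bmap := (@bmap F k A).
Local Notation seg := (@seg F k A).

Definition axis_pair g x p := converges_to (fun i => x * g ^+ i) (end1 p) /\
  converges_to (fun i => x * g ^- i) (end2 p).

(** If [g] is not a proper power, its counting current is the counting measure on these lines, as
    [count_clopen] makes precise on compact open sets. *)
Definition axis_lines g : set (lines k) :=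
  [set l | exists p x, line_of p = l /\ axis_pair g x p].

Lemma axis_pair_map f f' g x p q : bicoarse f f' -> {morph f : y z / y * z} ->
  axis_pair g x p -> end1 q = bmap f (end1 p) -> end2 q = bmap f (end2 p) ->
  axis_pair (f g) (f x) q.
Proof.
move=> [[K cf] _ _ _] fM [c1 c2] q1 q2.
have f1 : f 1 = 1 by apply: (mulgI (f 1)); rewrite -fM !mulg1.
have fX i : f (g ^+ i) = f g ^+ i by elim: i => [|i IH] //; rewrite !expgS fM IH.
have fV y : f y^-1 = (f y)^-1 by apply: (mulgI (f y)); rewrite -fM !mulgV.
split; rewrite ?q1 ?q2.
  have -> : (fun i => f x * f g ^+ i) = f \o (fun i => x * g ^+ i).
    by apply/funext => i /=; rewrite fM fX.
  exact: coarse_converges cf c1.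
have -> : (fun i => f x * f g ^- i) = f \o (fun i => x * g ^- i).
  by apply/funext => i /=; rewrite fM fV fX.
exact: coarse_converges cf c2.
Qed.

Lemma axis_lines_map (f : aut F) g l :
  axis_lines (f g) (line_map A f l) <-> axis_lines g l.
Proof.
have W (f1 : aut F) g1 l1 : axis_lines g1 l1 -> axis_lines (f1 g1) (line_map A f1 l1).
  move=> [p [x [<- ax]]]; have bf := bicoarse_aut A_basis f1.
  have [q [q1 q2]] := pair_map p bf; exists q, (f1 x); rewrite (line_mapE bf q1 q2).
  split=> //; exact: axis_pair_map bf (autM f1) ax q1 q2.
split; last exact: W.
move=> /(W f^-1); rewrite -aut_mulE mulVg aut1E.
by have := line_map_can (bicoarse_aut A_basis f) l => /= ->.
Qed.

Lemma converges_near (u v : nat -> F) K (x : boundary k) : converges_to u x ->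
  (forall i, (len ((u i)^-1 * v i) <= K)%N) -> converges_to v x.
Proof.
move=> cu h; apply: (@converges_to_agree _ _ _ A_basis _ _ _ cu) => m.
have /converges_toP := cu => /(_ A_basis (m + K)%N); apply: filterS => i E.
apply: agree_near (h i) _; have := congr1 size E; rewrite size_prefix_word => <-.
by rewrite size_take_min ?lenE geq_minr.
Qed.

Lemma axis_lines_conj z g : axis_lines (z * g * z^-1) = axis_lines g.
Proof.
have W y h : axis_lines h `<=` axis_lines (y * h * y^-1).
  move=> _ [p [x [<- [c1 c2]]]]; exists p, (x * y^-1); split=> //; split.
    apply: (@converges_near _ _ (len y^-1) _ c1) => i.
    by rewrite expg_conj -!mulgA mulKg invgM !mulgA mulgVK mulVg mul1g.
  apply: (@converges_near _ _ (len y^-1) _ c2) => i.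
  by rewrite expg_conj !invgM !invgK -!mulgA mulKg !mulgA mulgVK mulgV mul1g.
apply/seteqP; split; last exact: W.
move=> l /(W z^-1); rewrite invgK.
by have -> : z^-1 * (z * g * z^-1) * z = g by rewrite -!mulgA mulKg mulVg mulg1.
Qed.

Section Word.
Context {C : seq (letter k)} (C_cyc : cyc_reduced C) (C_prim : not_proper_power (wv C)).
Local Notation c := (wv C).
Local Notation l := (size C).

Let C0 : C != [::].
Proof. by have := root_size C_prim; rewrite lt0n size_eq0. Qed.

Definition base j := wv (window (C := C) 0 j).

Lemma axis_pair_base j p : is_axis (C := C) j p -> axis_pair c (base j)^-1 p.
Proof.
move=> [hx hy]; split; apply/(converges_toP A_basis) => m.
  exists (j + m)%N => // i /= le; rewrite (prefix_fwd m hx).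
  have ll : (j + m <= i * l)%N.
    by apply: leq_trans le _; rewrite leq_pmulr // lt0n size_eq0.
  have E : (i * l = j + (i * l - j))%N by rewrite subnKC // (leq_trans (leq_addr m j) ll).
  rewrite -word_val_wpow (wpow_window C0 C_cyc i) E (windowD C0 C_cyc 0 j).
  rewrite word_val_cat mulKg add0n nf_val ?(window_reduced C0 C_cyc) //.
  rewrite -(@subnKC m (i * l - j)); last by lia.
  by rewrite (windowD C0 C_cyc j m) take_size_cat // size_window.
exists (j + m)%N => // i /= le; rewrite (prefix_bwd C0 C_cyc m hy).
have -> : (base j)^-1 * c ^- i = wv (word_inv (window (C := C) 0 (i * l + j))).
  rewrite word_valV (windowD C0 C_cyc) word_val_cat invgM -(wpow_window C0 C_cyc) word_val_wpow.
  by rewrite window_period.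
have ll : (j + m <= i * l)%N.
  by apply: leq_trans le _; rewrite leq_pmulr // lt0n size_eq0.
rewrite nf_val ?reducedV ?(window_reduced C0 C_cyc) // -(@subnK m (i * l + j)); last by lia.
rewrite (windowD C0 C_cyc) word_inv_cat take_size_cat ?size_word_inv ?size_window // add0n.
congr word_inv; rewrite -[RHS](window_period (C := C) _ (i - m)).
congr window; rewrite mulnBl.
have := leq_pmulr m (n := l); rewrite lt0n size_eq0 C0 => /(_ isT).
have : (m * l <= i * l)%N by rewrite leq_mul2r; apply/orP; right; lia.
by move: (m * l)%N (i * l)%N ll; lia.
Qed.

Lemma axis_pair_uniq g x p q : axis_pair g x p -> axis_pair g x q -> p = q.
Proof.
by move=> [p1 p2] [q1 q2]; apply: pair_ext; apply: (converges_to_uniq A_basis); eassumption.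
Qed.

Lemma axis_pair_shift g x n p : axis_pair g x p -> axis_pair g (x * g ^+ n) p.
Proof.
move=> [c1 c2]; split.
  apply: (@converges_near _ _ (len (g ^+ n)) _ c1) => i.
  by rewrite invgM -!mulgA mulKg -expgnDr addnC expgnDr mulKg.
apply: (@converges_near _ _ (len (g ^+ n)) _ c2) => i.
by rewrite invgM invgK -!mulgA mulKg mulgA -expgnDr addnC expgnDr -mulgA mulgV mulg1.
Qed.

Lemma axis_pair_trans g x y p q : axis_pair g x p -> axis_pair g (y * x) q ->
  end1 q = bmap (fun z => y * z) (end1 p) /\ end2 q = bmap (fun z => y * z) (end2 p).
Proof.
move=> [c1 c2] [d1 d2]; have [[K cy] _ _ _] := bicoarse_trans A_basis y.
split; apply: (converges_to_uniq A_basis); [exact: d1| |exact: d2|].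
  by under eq_fun do rewrite -mulgA; exact: coarse_converges cy c1.
by under eq_fun do rewrite -mulgA; exact: coarse_converges cy c2.
Qed.

(** Two vertices far out on the line begin with different letters, so the segment between them
    passes through 1. *)
Lemma geodesic_through1 (d : int -> F) p : is_geodesic A d ->
  converges_to (fun n : nat => d (Posz n)) (end1 p) ->
  converges_to (fun n : nat => d (- n%:Z)%R) (end2 p) ->
  val (end1 p) 0%N <> val (end2 p) 0%N -> exists i, d i = 1.
Proof.
move=> gd /(converges_toP A_basis)/(_ 1%N) c1 /(converges_toP A_basis)/(_ 1%N) c2 ne.
have [N [/= E1 E2]] := filter_ex (filterI c1 c2).
have gr := (geodesic_rays gd (- N%:Z)%R).1.
have := geodesic_ray_len A_basis (N + N) gr.
have := @geodesic_ray_cat _ _ _ A_basis _ _ (N + N) gr.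
rewrite /= GRing.addr0.
have -> : (- N%:Z + (N + N)%N%:Z)%R = Posz N by lia.
set a := d (- N%:Z)%R in E2 *; set b := d (Posz N) in E1 *.
have rab : reduced (word_inv (nf a) ++ nf b).
  move: E1 E2 (nf_reduced A_basis a) (nf_reduced A_basis b).
  case: (nf a) => [|x a'] //; case: (nf b) => [|y b'] // F1 F2 ra rb.
  have {F1}Ey : y = val (end1 p) 0%N by case: F1.
  have {F2}Ex : x = val (end2 p) 0%N by case: F2.
  move: ra; rewrite -reducedV /word_inv /= rev_cons => ra.
  apply: reduced_cat_lasthead => //; rewrite /can_follow letter_invK.
  by rewrite Ex Ey; apply/eqP.
have -> : a^-1 * b = wv (word_inv (nf a) ++ nf b).
  by rewrite word_val_cat word_valV !(nfK A_basis).
rewrite ?lenE nf_val // => cat sz.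
have le : (len a <= N + N)%N by rewrite -sz size_cat size_word_inv leq_addr.
exists (- N%:Z + (len a)%:Z)%R; have := geodesic_ray_len A_basis (len a) gr.
have := cat (len a) le; rewrite GRing.addr0 -/a ?lenE => /(congr1 (take (size (nf a)))) + sz'.
rewrite take_size_cat ?size_word_inv // -{1}sz' take_size_cat // -(nfV A_basis).
by move=> /nf_inj E; apply: (mulgI a^-1); rewrite -E mulg1.
Qed.

Lemma is_axis_mod j p : is_axis (C := C) j p -> is_axis (C := C) (j %% l) p.
Proof.
have E t : periodic (C := C) (j + t) = periodic (C := C) (j %% l + t).
  rewrite -(periodicD (C := C) (j %% l + t) (j %/ l)); congr (periodic _).
  by rewrite {1}(divn_eq j l) -addnA addnC.
by move=> [h1 h2]; split=> n; rewrite ?h1 ?h2 E.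
Qed.

(** Translation by [x^-1] carries the line to the axis of the periodic word and the vertex 1 to a
    vertex of this axis, whose index modulo the period is [j]. *)
Lemma axis_lines_base l0 h : axis_lines c l0 -> seg 1 h l0 ->
  exists j p, [/\ (j < l)%N, is_axis (C := C) j p & l0 = line_of p].
Proof.
move=> [p [x [<- ax]]] sg.
suff [j axj] : exists j, is_axis (C := C) j p.
  exists (j %% l)%N, p; split=> //; last exact: is_axis_mod.
  by rewrite ltn_mod lt0n size_eq0.
have [p0 ax0] := axis_ex C0 C_cyc 0; have ap0 := axis_pair_base ax0.
rewrite /base /= invg1 in ap0.
have [E1 E2] : end1 p0 = bmap (fun z => x^-1 * z) (end1 p) /\ end2 p0 = bmap (fun z => x^-1 * z) (end2 p).
  by apply: (axis_pair_trans ax); rewrite mulVg.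
have := seg_trans A_basis x^-1 sg; rewrite (line_mapE (bicoarse_trans A_basis x^-1) E1 E2).
case=> d [[gd [q [Eq d1 d2]]] [i di] _].
have neq : val (end1 q) 0%N <> val (end2 q) 0%N.
  have := fwd_bwd_neq C0 C_cyc ax0.1 ax0.2.
  by case/line_ofP: Eq => -[-> ->] // h1 h2; apply: h1.
have [i1 di1] := geodesic_through1 gd d1 d2 neq.
have [pq _] := geodesic_at1 A_basis gd di1 d1 d2.
have {pq d1 d2} : exists n, x^-1 = wv (prefix_word (end1 p0) n) \/ x^-1 = wv (prefix_word (end2 p0) n).
  have : exists n, x^-1 = wv (prefix_word (end1 q) n) \/ x^-1 = wv (prefix_word (end2 q) n).
    exists `|(i - i1)%R|%N; rewrite !(pq _).1 !(pq _).2 !(nfK A_basis) -[x^-1]mulg1 -di.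
    have [le|lt] := Order.TotalTheory.leP i1 i; [left|right]; congr d; lia.
  by case/line_ofP: Eq => -[-> ->] [n []] ->; exists n; [left|right|right|left].
case=> n [Ex|Ex].
  exists n; have [p1 ax1] := axis_ex C0 C_cyc n.
  have -> // : p = p1; apply: axis_pair_uniq ax _.
  rewrite -(invgK x) Ex (prefix_fwd n ax0.1); exact: axis_pair_base.
(* On the backward half the index is made nonnegative by adding [n] periods. *)
exists (n * l - n)%N; have [p1 ax1] := axis_ex C0 C_cyc (n * l - n).
have -> // : p = p1; apply: axis_pair_uniq ax _.
have -> : x = (base (n * l - n))^-1 * c ^+ n.
  rewrite -(invgK x) Ex (prefix_bwd C0 C_cyc n ax0.2) word_valV invgK.
  rewrite -word_val_wpow (wpow_window C0 C_cyc).
  have E : (n * l = (n * l - n) + n)%N by rewrite subnK // leq_pmulr // lt0n size_eq0.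
  by rewrite {3}E (windowD C0 C_cyc) word_val_cat mulKg.
by apply: axis_pair_shift; exact: axis_pair_base.
Qed.

Lemma base_add i n : base i * wv (window (C := C) i n) = base (i + n).
Proof. by rewrite /base (windowD C0 C_cyc 0 i) word_val_cat. Qed.

Lemma base_period n i : base (n * l + i) = c ^+ n * base i.
Proof.
rewrite /base (windowD C0 C_cyc 0 (n * l)) word_val_cat -(wpow_window C0 C_cyc) word_val_wpow.
by rewrite window_period.
Qed.

Lemma nf_base i : nf (base i) = window (C := C) 0 i.
Proof. by rewrite nf_val // (window_reduced C0 C_cyc). Qed.

Lemma base_conj i : wv (window (C := C) i l) = (base i)^-1 * c * base i.
Proof.
have := base_period 1 i; rewrite mul1n addnC -base_add expg1 => /(congr1 (fun z => (base i)^-1 * z)).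
by rewrite mulKg mulgA.
Qed.

(** If the lines agree with the same direction, the quotient of the two base vertices centralizes
    [c], hence is a power of it, and the indices agree modulo the period. Opposite directions would
    conjugate [c] to its inverse. *)
Lemma axis_inj i j p q : (i < l)%N -> (j < l)%N -> is_axis (C := C) i p -> is_axis (C := C) j q ->
  line_of p = line_of q -> i = j.
Proof.
move=> il jl [f1 b1] [f2 b2] /line_ofP[] -[E1 E2].
  have Ec : (base i)^-1 * c * base i = (base j)^-1 * c * base j.
    by rewrite -!base_conj -(prefix_fwd _ f1) -(prefix_fwd _ f2) E1.
  have : base j * (base i)^-1 * c = c * (base j * (base i)^-1).
    have := congr1 (fun z => base j * z * (base i)^-1) Ec.
    by rewrite -!mulgA mulgV mulg1 mulVKg.
  move=> /(commute_root A_basis C_cyc C_prim)[m Em].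
  have lb t : len (base t) = t by rewrite ?lenE nf_base size_window.
  case: m Em => n /= Em.
    have : base j = base (n * l + i) by rewrite base_period -Em mulgVK.
    move=> /(congr1 len); rewrite !lb => Ej; case: n {Em} Ej => // n.
    by rewrite mulSn => Ej; move: jl; rewrite Ej -addnA ltnNge leq_addr.
  have : base i = base (n.+1 * l + j).
    rewrite base_period; apply: (mulgI (c ^+ n.+1)^-1); rewrite mulKg -[in LHS]Em mulgVK.
    by [].
  move=> /(congr1 len); rewrite !lb => Ei.
  by move: il; rewrite Ei mulSn -addnA ltnNge leq_addr.
exfalso; set t := (j + (l * l - l))%N.
have Ec : (base i)^-1 * c * base i = ((base t)^-1 * c * base t)^-1.
  rewrite -!base_conj -(prefix_fwd _ f1) -word_valV -(prefix_bwd C0 C_cyc _ b2).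
  by rewrite E1.
apply: (root_conjV A_basis C_cyc C_prim (g := base t * (base i)^-1)).
have := congr1 (fun z => base t * z * (base t)^-1) Ec.
by rewrite !invgM !invgK -!mulgA mulgV mulg1 mulVKg.
Qed.

(** The translates through 1 are the axes based at the vertices of one period, each obtained once;
    the cylinder selects the positions where [u] is read along one of the two halves. *)
Lemma axis_count (u : seq (letter k)) : reduced u -> u <> [::] ->
  finite_set (axis_lines c `&` Cyl A (wv u)) /\
  #|` fset_set (axis_lines c `&` Cyl A (wv u))| = occurrences u C.
Proof.
move=> ru u0; have [ax hax] := choice (axis_ex C0 C_cyc).
pose s := [seq line_of (ax j) | j <- iota 0 l &
  occurs_at u C j || occurs_at (word_inv u) C (j + (size u * l - size u))].
have us : uniq s.
  rewrite map_inj_in_uniq ?filter_uniq ?iota_uniq // => i j.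
  rewrite !mem_filter !mem_iota !add0n => /andP[_ /= il] /andP[_ /= jl].
  exact: axis_inj il jl (hax i) (hax j).
have -> : axis_lines c `&` Cyl A (wv u) = [set` s].
  apply/seteqP; split=> l0 /=.
    move=> [al cl]; have [j [p [jl axj El]]] := axis_lines_base al cl.
    have Ep : p = ax j by exact: axis_uniq axj (hax j).
    apply/mapP; exists j; last by rewrite -Ep.
    rewrite mem_filter mem_iota /= add0n jl andbT.
    apply/(axis_starts C0 C_cyc u0 (hax j)); rewrite -Ep.
    by apply/(CylP A_basis _ ru u0); rewrite -El.
  move=> /mapP[j]; rewrite mem_filter mem_iota /= add0n => /andP[h jl] ->; split.
    by exists (ax j), (base j)^-1; split=> //; exact: axis_pair_base.
  by apply/(CylP A_basis _ ru u0); apply/(axis_starts C0 C_cyc u0 (hax j)).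
split; first exact: finite_seq.
have -> : [set` s] = [set` [fset x in s]%fset].
  by apply/seteqP; split=> x /=; rewrite in_fset.
rewrite set_fsetK card_fseq undup_id // size_map size_filter.
exact: occurrences_axis.
Qed.

End Word.

Lemma axis_count_conj (g : F) (w u : seq (letter k)) : cyc_reduced w -> not_proper_power g ->
  (exists x, wv w = x * g * x^-1) -> reduced u -> u <> [::] ->
  finite_set (axis_lines g `&` Cyl A (wv u)) /\
  #|` fset_set (axis_lines g `&` Cyl A (wv u))| = occurrences u w.
Proof.
move=> cw pg [x Ew] ru u0.
have pw : not_proper_power (wv w).
  move=> y n Ey; apply: (pg (x^-1 * y * x)); have := expg_conj x^-1 y n.
  by rewrite invgK => ->; rewrite -Ey Ew -!mulgA mulKg mulVg mulg1.
by have := axis_count cw pw ru u0; rewrite Ew axis_lines_conj.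
Qed.

End AxisLines.

Import Order.TTheory GRing.Theory Num.Theory numFieldNormedType.Exports.

(** * Currents *)

Section LineMeasures.
Context {R : realType} {k : nat}.
Implicit Types (nu : line_measure R k) (S U K : set (lines k)).

Lemma open_borel U : open U -> measurable (U : set (borel_lines k)).
Proof. by move=> oU; exact: sub_sigma_algebra. Qed.

Lemma continuous_borel (f : lines k -> lines k) : continuous f ->
  measurable_fun setT (f : borel_lines k -> borel_lines k).
Proof.
move=> /continuousP cf; apply: (@measurability _ _ (borel_lines k) (borel_lines k) setT f (@open (lines k))).
  by [].
by move=> _ [U oU <-]; rewrite setTI; apply: open_borel; exact: cf.
Qed.

Lemma pushforward_ex nu (f : lines k -> lines k) : continuous f ->
  exists nu' : line_measure R k, forall S, nu' S = nu (f @^-1` S).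
Proof.
move=> /continuous_borel mf.
by exists (measure_function_pushforward__canonical__measure_function_Measure nu mf).
Qed.

Lemma scale_ex nu (t : R) : (0 <= t)%R ->
  exists nu' : line_measure R k, forall S, nu' S = (t%:E * nu S)%E.
Proof. by move=> t0; exists (mscale (NngNum t0) nu). Qed.

Lemma homeo_radon nu nu' (f f' : lines k -> lines k) : continuous f -> continuous f' ->
  cancel f f' -> cancel f' f -> (forall S, nu' S = nu (f @^-1` S)) ->
  is_radon nu -> is_radon nu'.
Proof.
move=> cf cf' fK f'K E [h1 h2 h3].
have im S : f' @` S = f @^-1` S.
  apply/seteqP; split=> [_ [x Sx <-]|x Sx]; first by rewrite /= f'K.
  by exists (f x).
have cpt K : compact K -> compact (f @^-1` K).
  by move=> cK; rewrite -im; apply: continuous_compact => //; exact: continuous_subspaceT.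
have pK S : f @^-1` (f' @^-1` S) = S by apply/seteqP; split=> x; rewrite /= fK.
have pK' S : f' @^-1` (f @^-1` S) = S by apply/seteqP; split=> x; rewrite /= f'K.
have cpt' K : compact K -> compact (f' @^-1` K).
  move=> cK; have -> : f' @^-1` K = f @` K.
    apply/seteqP; split=> [x Kx|_ [x Kx <-]]; last by rewrite /= fK.
    by exists (f' x).
  by apply: continuous_compact => //; exact: continuous_subspaceT.
split.
- by move=> K /cpt /h1; rewrite E.
- move=> S mS; rewrite E h2; last by rewrite -[X in measurable X]setTI; exact: continuous_borel.
  congr ereal_inf; apply/seteqP; split=> [_ [U [oU SU] <-]|_ [U [oU SU] <-]].
    exists (f' @^-1` U); last by rewrite E pK.
    split; first exact: (continuousP f').1.
    by move=> x Sx; apply: SU; rewrite /= f'K.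
  exists (f @^-1` U); last by rewrite E.
  split; first exact: (continuousP f).1.
  by move=> x Sx; apply: SU.
- move=> U oU; rewrite E h3; last exact: (continuousP f).1.
  congr ereal_sup; apply/seteqP; split=> [_ [K [cK KU] <-]|_ [K [cK KU] <-]].
    exists (f' @^-1` K); last by rewrite E pK.
    split; first exact: cpt'.
    by move=> x /KU; rewrite /= f'K.
  exists (f @^-1` K); last by rewrite E.
  by split; [exact: cpt | move=> x /KU].
Qed.

Lemma scale_radon nu nu' (t : R) : (0 < t)%R -> (forall S, nu' S = (t%:E * nu S)%E) ->
  is_radon nu -> is_radon nu'.
Proof.
move=> t0 E [h1 h2 h3].
have im (Q : set (set (lines k))) : [set nu' U | U in Q] = [set (t%:E * x)%E | x in [set nu U | U in Q]].
  apply/seteqP; split=> [_ [U QU <-]|_ [_ [U QU <-] <-]]; last by exists U.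
  by exists (nu U) => //; exists U.
split.
- by move=> K /h1 h; rewrite E; apply: lte_mul_pinfty; rewrite ?lee_fin ?(ltW t0).
- by move=> S mS; rewrite E h2 // im ereal_inf_pZl.
- by move=> U oU; rewrite E h3 // im ereal_sup_pZl.
Qed.

End LineMeasures.

Section CurrentMaps.
Context {R : realType} {F : groupType} {k : nat} {A : 'I_k.+2 -> F} (A_basis : is_basis A).
Implicit Types (nu : line_measure R k) (S U K : set (lines k)) (E : nonzero_Curr R A).
Local Notation wv := (word_val A).
Local Notation nf := (nf A_basis).
Local Notation homog := (@homog F).

Lemma nonzero_ex nu : is_current A nu -> nu setT <> 0%E ->
  exists E, forall S, nmeas E S = nu S.
Proof.
move=> cnu nz; pose c : Curr R A := exist _ nu cnu.
have h : c \in @nonzero_set R F k A by rewrite inE.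
by exists (SigSub h) => S; rewrite /nmeas SubK.
Qed.

Lemma nmeas_current E : is_current A (nmeas E).
Proof. exact: (svalP (val E : Curr R A)). Qed.

Lemma nmeas_nonzero E : nmeas E setT <> 0%E.
Proof. by have := valP E; rewrite inE. Qed.

(** Invariance of the push-forward under [g] is invariance of [E] under the image of [g] by the
    inverse of [f]. *)
Lemma aut_act_ex (f : aut F) E : exists E', forall S, nmeas E' S = nmeas E (line_map A f @^-1` S).
Proof.
have bf := bicoarse_aut A_basis f; have cf := line_map_continuous bf.
have cf' := line_map_continuous (bicoarse_sym bf).
have [nu' hnu] := pushforward_ex (nmeas E) cf; have [rE iE] := nmeas_current E.
have [||E' hE] := @nonzero_ex nu'; last by exists E' => S; rewrite hE.
  split.
    exact: (homeo_radon cf cf' (line_map_can bf) (line_map_can (bicoarse_sym bf)) hnu rE).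
  move=> g S mS; rewrite !hnu.
  rewrite -[RHS](iE ((f^-1 : aut F)%g g)); last first.
    by rewrite -[X in measurable X]setTI; exact: continuous_borel.
  congr (nmeas E _); apply/seteqP; split=> l /=.
    rewrite (@line_map_comm _ _ _ A_basis _ _ _ _ _ _ _ _ l (bicoarse_trans A_basis g) bf bf (bicoarse_trans A_basis ((f^-1 : aut F)%g g))) //.
    by move=> z; rewrite autM -aut_mulE mulgV.
  rewrite (@line_map_comm _ _ _ A_basis _ _ _ _ _ _ _ _ l (bicoarse_trans A_basis g) bf bf (bicoarse_trans A_basis ((f^-1 : aut F)%g g))) //.
  by move=> z; rewrite autM -aut_mulE mulgV.
by rewrite hnu preimage_setT; exact: nmeas_nonzero.
Qed.

Lemma aut_actE (f : aut F) E S : measurable (S : set (borel_lines k)) ->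
  nmeas (aut_act f E) S = nmeas E (line_map A f @^-1` S).
Proof.
rewrite /aut_act; case: xgetP => [E' _ h mS|h]; first exact: h.
by have [E' hE'] := aut_act_ex f E; case: (h E') => S' _; rewrite hE'.
Qed.

Lemma scale_current_ex (t : R) E : (0 < t)%R ->
  exists E', forall S, nmeas E' S = (t%:E * nmeas E S)%E.
Proof.
move=> t0; have [nu' h] := scale_ex (nmeas E) (ltW t0); have [rE iE] := nmeas_current E.
have [||E' hE] := @nonzero_ex nu'; last by exists E' => S; rewrite hE h.
  split; first exact: scale_radon t0 h rE.
  by move=> g S mS; rewrite !h iE.
rewrite h => /eqP; rewrite mule_eq0 => /orP[|/eqP]; last exact: nmeas_nonzero.
by rewrite eqe gt_eqF.
Qed.

Lemma card_fibers m (D : {fset key_type m}) (X : set (lines k)) : finite_set X ->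
  (forall l, X l -> key m l \in D) ->
  #|` fset_set X| = (\sum_(i <- D) #|` fset_set (X `&` fiber i)|)%N.
Proof.
move=> fX XD.
have fI i : #|` fset_set (X `&` fiber i)| = (\sum_(l <- fset_set X) (key m l == i))%N.
  have -> : #|` fset_set (X `&` fiber i)| = size [seq l <- fset_set X | key m l == i].
    apply: perm_size; apply: uniq_perm; rewrite ?filter_uniq ?fset_uniq // => l.
    rewrite mem_filter !in_fset_set //; last by apply: sub_finite_set fX => ? [].
    apply/idP/idP; rewrite !inE; first by move=> [h1 h2]; rewrite h2 eqxx; exact/mem_set.
    by move=> /andP[/eqP h1 /set_mem h2].
  by rewrite size_filter -sum1_count big_mkcond; apply: eq_bigr => l _; case: ifP.
under eq_bigr do rewrite fI.
rewrite exchange_big /= -sum1_size big_seq_cond [RHS]big_seq_cond.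
apply: eq_bigr => l; rewrite andbT in_fset_set // inE => Xl.
rewrite (big_rem (key m l)) /=; last exact: XD.
rewrite eqxx big_seq big1 // => i; rewrite (mem_rem_uniq _ (fset_uniq D)) inE => /andP[+ _].
by rewrite eq_sym => /negbTE ->.
Qed.

Lemma card_preimage (f f' : lines k -> lines k) (X : set (lines k)) :
  cancel f f' -> cancel f' f -> finite_set X ->
  finite_set (f @^-1` X) /\ #|` fset_set (f @^-1` X)| = #|` fset_set X|.
Proof.
move=> fK f'K fX; have -> : f @^-1` X = f' @` X.
  apply/seteqP; split=> [x Xx|_ [x Xx <-]]; last by rewrite /= f'K.
  by exists (f x).
split; first exact: finite_image.
by rewrite fset_set_image // card_imfset //; exact: can_inj f'K.
Qed.

Lemma axis_lines_trans y g l :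
  axis_lines (A := A) g (line_map A (fun z => y * z) l) <-> axis_lines (A := A) g l.
Proof.
have W x l1 : axis_lines (A := A) g l1 -> axis_lines (A := A) g (line_map A (fun z => x * z) l1).
  move=> [p [x0 [<- [c1 c2]]]]; have bx := bicoarse_trans A_basis x.
  have [q [q1 q2]] := pair_map p bx; exists q, (x * x0); rewrite (line_mapE bx q1 q2).
  case: bx => -[K cK] _ _ _; split=> //; rewrite /axis_pair q1 q2; split.
    by under eq_fun do rewrite -mulgA; exact: coarse_converges cK c1.
  by under eq_fun do rewrite -mulgA; exact: coarse_converges cK c2.
split; last exact: W.
by move=> /(W y^-1); rewrite (line_map_can (bicoarse_trans A_basis y)).
Qed.

(* S is a disjoint union of translates of cylinders, on which an invariant measure
   is known. *)
Lemma count_clopen E g m w S : not_proper_power g -> cyc_reduced w ->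
  (exists x, wv w = x * g * x^-1) ->
  (forall u : seq (letter k), reduced u -> u <> [::] ->
     nmeas E (Cyl A (wv u)) = ((m * occurrences u w)%N%:R)%:E) ->
  compact S -> open S -> finite_set (axis_lines (A := A) g `&` S) /\
    nmeas E S = ((m * #|` fset_set (axis_lines (A := A) g `&` S)|)%N%:R)%:E.
Proof.
move=> pg cw ew hE cS oS; have [n [D [ES DP]]] := clopen_fibers A_basis cS oS.
set ax := axis_lines (A := A) g.
have one i : i \in D -> finite_set (ax `&` fiber i) /\
    nmeas E (fiber i) = ((m * #|` fset_set (ax `&` fiber i)|)%N%:R)%:E.
  move=> /DP[x [u [ru u0 ->]]]; have bx := bicoarse_trans A_basis x.
  have [fin card] := axis_count_conj A_basis cw pg ew ru u0.
  have -> : ax `&` line_map A (fun z => x * z) @^-1` Cyl A (wv u) =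
      line_map A (fun z => x * z) @^-1` (ax `&` Cyl A (wv u)).
    by apply/seteqP; split=> l /= [h1 h2]; split=> //; apply/(axis_lines_trans x).
  have [fin' ->] := card_preimage (line_map_can bx) (line_map_can (bicoarse_sym bx)) fin.
  split=> //; rewrite (nmeas_current E).2 ?hE ?card //.
  exact: (open_borel (Cyl_open A_basis ru u0)).
have fin : finite_set (ax `&` S).
  rewrite ES -bigcup_fset setI_bigcupr; apply: bigcup_finite; first exact: finite_fset.
  by move=> i /= /one[].
split=> //; rewrite (@card_fibers n D _ fin); last first.
  by move=> l [_]; rewrite ES -bigcup_fset => -[i /= iD Ei]; have -> : key n l = i by [].
rewrite big_distrr natr_sum -sumEFin /= {1}ES measure_fbigsetU.
- apply: eq_big_seq => i iD; apply: (etrans (one i iD).2); congr ((m * #|` fset_set _|)%N%:R)%:E.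
  apply/seteqP; split=> l [h1 h2]; first by split=> //; split=> //; rewrite ES -bigcup_fset; exists i.
  by case: h1.
- by move=> i _; apply: open_borel; exact: fiber_open.
- exact: trivIset_fiber.
Qed.

(** With h = g^m, the current moved by [f] counts the translates of the axis of [f g] with
    multiplicity [m]. On cylinders it thus has the masses of the counting current of [f h], which
    are homogenized counts. *)
Lemma counting_current_map h E (f : aut F) u : is_counting_current h E ->
  reduced u -> u <> [::] -> exists N : nat,
    nmeas E (line_map A f @^-1` Cyl A (wv u)) = (N%:R)%:E /\
    homog (fun x => lcount u (nf x)) (f h) N.
Proof.
move=> [g [m [w [Eh m0 pg [cw ew] hE]]]] ru u0.
have bf := bicoarse_aut A_basis f.
have cS := line_map_compact bf (Cyl_compact A_basis ru u0).
have oS := line_map_open bf (Cyl_open A_basis ru u0).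
have [_ ->] := count_clopen pg cw ew hE cS oS.
have [z [w' [cw' Ew' _]]] := cyc_conj A_basis (f g).
have pf : not_proper_power (f g).
  move=> y n Ey; apply: (pg ((f^-1 : aut F)%g y)); rewrite -autX -Ey.
  by rewrite -aut_mulE mulVg.
have ew' : exists x, wv w' = x * f g * x^-1.
  by exists z^-1; rewrite Ew' invgK -!mulgA mulKg mulVg mulg1.
have [fin card] := axis_count_conj A_basis cw' pf ew' ru u0.
have -> : axis_lines (A := A) g `&` line_map A f @^-1` Cyl A (wv u) =
    line_map A f @^-1` (axis_lines (A := A) (f g) `&` Cyl A (wv u)).
  by apply/seteqP; split=> l /= [h1 h2]; split=> //; apply/(axis_lines_map A_basis f).
have [_ ->] := card_preimage (line_map_can bf) (line_map_can (bicoarse_sym bf)) fin.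
rewrite card; exists (m * occurrences u w')%N; split=> //.
rewrite Eh autX; apply: homogX.
have w0 : w' != [::].
  apply/eqP => E0; have := pf 1 2; rewrite expg1n Ew' E0 /= mulg1 mulgV.
  by move=> /(_ erefl).
apply: (homog_conj (quasi_add_count A_basis _)) (homog_count A_basis _ _ _) => //.
- exact/eqP.
- by exists z.
- exact/eqP.
Qed.

(* Every line passes through a vertex, so that the translates of the cylinders of
   the letters cover. *)
Lemma nonzero_letter E : exists a : letter k, nmeas E (Cyl A (wv [:: a])) <> 0%E.
Proof.
apply: contrapT => h; have {}h a : nmeas E (Cyl A (wv [:: a])) = 0%E.
  by apply: contrapT => ne; apply: h; exists a.
have rl (a : letter k) : reduced [:: a] by [].
have nl (a : letter k) : [:: a] <> [::] by [].
pose T := (seq (letter k) * letter k)%type.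
pose B n : set (lines k) := if unpickle n is Some sa
  then line_map A (fun z => (wv (sa : T).1)^-1 * z) @^-1` Cyl A (wv [:: sa.2]) else set0.
apply: (@nmeas_nonzero E).
have -> : setT = \bigcup_n B n.
  apply/seteqP; split=> // l _; move: l; apply: line_ofK => p.
  have [n [En ne]] := branch_ex p; have [c gc Ec] := geodesic_branch A_basis En ne.
  set s := prefix_word (end1 p) n.
  exists (pickle ((s, val (end1 p) n) : T)) => //; rewrite /B pickleK /=.
  suff : @seg F k A (wv s) (wv s * wv [:: val (end1 p) n : letter k]) (line_of p).
    by rewrite (seg_Cyl A_basis) mulKg.
  exists c; split=> //.
    by exists 0%R; rewrite (Ec 0%N).1 addn0.
  exists 1%R; rewrite (Ec 1%N).1 addn1 /ray_val /prefix_word mkseqS -cats1 word_val_cat.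
  by [].
apply/negligibleP; last first.
  apply: negligible_bigcup => n; apply/negligibleP; rewrite /B; case: unpickle => [[s a]|] /=.
  - apply: open_borel; apply: line_map_open (bicoarse_trans A_basis (wv s)^-1) _.
    exact: (Cyl_open A_basis (rl a) (nl a)).
  - exact: measurable0.
  - rewrite (nmeas_current E).2 ?h //.
    exact: open_borel (Cyl_open A_basis (rl a) (nl a)).
  - exact: measure0.
apply: open_borel; apply: bigcup_open => n _; rewrite /B; case: unpickle => [[s a]|] /=; last exact: open0.
apply: line_map_open (bicoarse_trans A_basis (wv s)^-1) _.
exact: (Cyl_open A_basis (rl a) (nl a)).
Qed.

Definition cyl_mass (u : seq (letter k)) E : R := fine (nmeas E (Cyl A (wv u))).

(** A normalization for projective classes: it is finite, and positive on every nonzero current. *)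
Definition total_mass E : R := (\sum_(a : letter k) cyl_mass [:: a] E)%R.

Lemma nmeas_compact E S : compact S -> (nmeas E S < +oo)%E.
Proof. by case: (nmeas_current E) => -[h _ _] _; exact: h. Qed.

Lemma cyl_massE u E : reduced u -> u <> [::] ->
  nmeas E (Cyl A (wv u)) = (cyl_mass u E)%:E.
Proof.
move=> ru u0; rewrite /cyl_mass fineK // ge0_fin_numE ?measure_ge0 //.
exact: nmeas_compact (Cyl_compact A_basis ru u0).
Qed.

Lemma cyl_mass_ge0 u E : (0 <= cyl_mass u E)%R.
Proof. exact/fine_ge0/measure_ge0. Qed.

Lemma total_mass_gt0 E : (0 < total_mass E)%R.
Proof.
rewrite lt_def sumr_ge0 ?andbT; last by move=> a _; exact: cyl_mass_ge0.
have [a ha] := nonzero_letter E; apply/eqP => /psumr_eq0P h.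
by apply: ha; rewrite cyl_massE // h // => b _; exact: cyl_mass_ge0.
Qed.

End CurrentMaps.

(** * Weak convergence *)

Section StepApproximation.
Context {d : measure_display} {T : measurableType d} {R : realType} (mu : {measure set T -> \bar R}%R).
Local Open Scope ring_scope.

Lemma Rintegral_near_cst (S : set T) (f : T -> R) (r e : R) : measurable S ->
  (mu S < +oo)%E -> measurable_fun S f -> (forall x, S x -> `|f x - r| <= e) ->
  mu.-integrable S (EFin \o f) /\ `|\int[mu]_(x in S) f x - r * fine (mu S)| <= e * fine (mu S).
Proof.
move=> mS fS mf h.
have if' : mu.-integrable S (EFin \o f).
  apply: measurable_bounded_integrable => //; exists (`|r| + `|e|); split; first exact: num_real.
  move=> M lM x Sx; apply: ltW; apply: le_lt_trans lM.
  rewrite -(subrK r (f x)) addrC; apply: le_trans (ler_normD _ _) _; rewrite lerD2l.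
  by apply: le_trans (h x Sx) _; rewrite ler_norm.
have ic (c : R) : mu.-integrable S (EFin \o cst c).
  apply: measurable_bounded_integrable => //; exists `|c|; split; first exact: num_real.
  by move=> M lM x _; exact: ltW.
split=> //; rewrite -Rintegral_cst // -RintegralB //; last exact: ic.
have ib : mu.-integrable S (EFin \o (fun x => f x - r)).
  exact: (integrableB mS if' (ic r)).
apply: le_trans (le_normr_Rintegral _ ib) _ => //.
rewrite -Rintegral_cst //; apply: le_Rintegral => //; first exact: (integrable_norm ib).
exact: ic.
Qed.

Lemma Rintegral_near_step (I : choiceType) (D : {fset I}) (F : I -> set T) (f : T -> R)
    (r : I -> R) (e : R) :
  (forall i, measurable (F i)) -> trivIset [set` D] F ->
  (forall i, i \in D -> (mu (F i) < +oo)%E) ->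
  measurable_fun setT f -> (forall x, ~ (\big[setU/set0]_(i <- D) F i) x -> f x = 0) ->
  (forall i x, i \in D -> F i x -> `|f x - r i| <= e) ->
  `|\int[mu]_(x in setT) f x - \sum_(i <- D) r i * fine (mu (F i))|
    <= e * \sum_(i <- D) fine (mu (F i)).
Proof.
move=> mF tF fF mf f0 h; set V := \big[setU/set0]_(i <- D) F i.
have loc i : i \in D -> mu.-integrable (F i) (EFin \o f) /\
    `|\int[mu]_(x in F i) f x - r i * fine (mu (F i))| <= e * fine (mu (F i)).
  move=> iD; apply: Rintegral_near_cst; [exact: mF|exact: fF|exact: measurable_funTS|].
  by move=> x; exact: h.
have -> : \int[mu]_(x in setT) f x = \int[mu]_(x in V) f x.
  rewrite [RHS]Rintegral_mkcond; apply: eq_Rintegral => x _.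
  by rewrite patchE; case: ifPn => // /negP; rewrite inE => /f0.
have -> : \int[mu]_(x in V) f x = \sum_(i <- D) \int[mu]_(x in F i) f x.
  rewrite /Rintegral integral_bigsetU_EFin //.
  - rewrite [in LHS]big_seq [RHS]big_seq sum_fine // => i iD.
    exact: integrable_fin_num (loc i iD).1.
  - exact/measurable_EFinP/measurable_funTS.
rewrite -sumrB mulr_sumr; apply: le_trans (ler_norm_sum _ _ _) _.
by rewrite big_seq [leRHS]big_seq; apply: ler_sum => i /loc[].
Qed.
End StepApproximation.

Section WeakConvergence.
Context {R : realType} {F : groupType} {k : nat} {A : 'I_k.+2 -> F} (A_basis : is_basis A).
Implicit Types (E : nonzero_Curr R A) (u : seq (letter k)) (S K : set (lines k)).
Local Notation wv := (word_val A).
Local Open Scope ring_scope.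

Lemma continuous_borel_real (f : lines k -> R^o) : continuous f ->
  measurable_fun setT (f : borel_lines k -> R).
Proof.
move=> /continuousP cf; apply: (@measurability _ _ (borel_lines k) _ setT f _ (RGenOInfty.measurableE R)).
move=> _ [_ [y ->] <-]; rewrite setTI; apply: open_borel; apply: cf.
exact: interval_open.
Qed.

Lemma pairingE E (t : test_fun R k) :
  pairing (val E : Curr R A) t = \int[nmeas E]_(l in setT) (sval t l : R).
Proof. by []. Qed.

Lemma clopen_indic_continuous S : open S -> open (~` S) -> continuous (\1_S : lines k -> R^o).
Proof.
move=> oS oC; apply/continuousP => B oB; rewrite preimage_indic.
by case: ifP => _; case: ifP => _ //; [exact: openT|exact: open0].
Qed.

(** Cylinders are compact, open and closed, so their indicators are admissible test functions. *)
Lemma cyl_mass_continuous u : reduced u -> u <> [::] ->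
  continuous (cyl_mass (R := R) (A := A) u : nonzero_Curr R A -> R^o).
Proof.
move=> ru u0; have oS := Cyl_open A_basis ru u0.
have ct := clopen_indic_continuous oS (Cyl_openC A_basis ru u0).
have ht : continuous (\1_(Cyl A (wv u)) : lines k -> R^o) /\
    exists2 K : set (lines k), compact K & forall l, ~ K l -> \1_(Cyl A (wv u)) l = 0 :> R.
  split=> //; exists (Cyl A (wv u)); first exact: Cyl_compact.
  by move=> l nl; rewrite indicE memNset.
pose t : test_fun R k := exist _ _ ht.
have -> : (cyl_mass (R := R) (A := A) u : nonzero_Curr R A -> R^o) =
    (fun p : {ptws test_fun R k -> R^o} => p t) \o (@pairing R F k A) \o (fun E => val E : Curr R A).
  apply/funext => E; rewrite /= pairingE /= /Rintegral integral_indic //; last exact: open_borel.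
  by rewrite setIT.
have c1 : continuous (fun E : nonzero_Curr R A => val E : Curr R A) by exact: initial_continuous.
have c2 : continuous (@pairing R F k A : Curr R A -> {ptws test_fun R k -> R^o}).
  exact: initial_continuous.
have c3 : continuous (fun p : {ptws test_fun R k -> R^o} => p t).
  move=> p; have /cvg_sup/(_ t) h : nbhs p --> p by [].
  move=> W nW; apply: h; exact: (@initial_continuous _ _ (fun q : {ptws test_fun R k -> R^o} => q t) p W nW).
move=> E; apply: (continuous_comp (c1 E)).
exact: (continuous_comp (c2 (val E)) (c3 _)).
Qed.

Lemma cvg_nonzero_Curr (En : nat -> nonzero_Curr R A) E :
  (forall t : test_fun R k, (fun n => pairing (val (En n) : Curr R A) t) @ \oo --> pairing (val E : Curr R A) t) ->
  En @ \oo --> E.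
Proof.
move=> h.
have cv : (fun n => pairing (val (En n) : Curr R A) : {ptws test_fun R k -> R^o}) @ \oo -->
    (pairing (val E : Curr R A) : {ptws test_fun R k -> R^o}).
  apply/cvg_sup => t U' [V [[W oW <-] Wx WU']].
  have /h hW : nbhs (pairing (val E : Curr R A) t) W by exact: open_nbhs_nbhs.
  have hW' : nbhs \oo (fun n => W (pairing (val (En n) : Curr R A) t)) := hW.
  change (nbhs \oo (fun n => U' (pairing (val (En n) : Curr R A)))).
  by apply: filterS hW' => n Wn; apply: WU'.
move=> U; rewrite nbhsE => -[B [[C [D oD <-] <-] Dp] BU].
have /cv h' : nbhs (pairing (val E : Curr R A) : {ptws test_fun R k -> R^o}) D.
  exact: open_nbhs_nbhs.
have h'' : nbhs \oo (fun n => D (pairing (val (En n) : Curr R A))) := h'.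
change (nbhs \oo (fun n => U (En n))).
by apply: filterS h'' => n Dn; apply: BU.
Qed.

Lemma cvg_seq_sum (I : eqType) (T : Type) (G : set_system T) (s : seq I) (u : I -> T -> R^o)
    (v : I -> R^o) : Filter G -> (forall i, i \in s -> u i @ G --> v i) ->
  (fun n => \sum_(i <- s) u i n) @ G --> \sum_(i <- s) v i.
Proof.
move=> FG; elim: s => [|i s IH] h.
  by rewrite big_nil; under eq_fun do rewrite big_nil; exact: cvg_cst.
rewrite big_cons; under eq_fun do rewrite big_cons.
apply: cvgD; first by apply: h; rewrite inE eqxx.
by apply: IH => j js; apply: h; rewrite inE js orbT.
Qed.

(** A test function is uniformly close to a step function on the boxes of a fine level, whose masses
    converge. The error is controlled because the mass of the boxes meeting the support does not
    grow with the level. *)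
Lemma cyl_mass_cvg (En : nat -> nonzero_Curr R A) E :
  (forall u, reduced u -> u <> [::] ->
     (fun n => cyl_mass u (En n) : R^o) @ \oo --> (cyl_mass u E : R^o)) ->
  En @ \oo --> E.
Proof.
move=> hc; apply: cvg_nonzero_Curr => -[f [cf [K cK f0]]]; rewrite pairingE.
under eq_fun do rewrite pairingE.
rewrite /=; have mf := continuous_borel_real cf.
(* From level [m0] on, all the boxes that meet [K] are translates of cylinders. *)
have [m0 hm0] : exists m, forall l, K l -> proper_key (key m l).
  apply: (compact_uniform cK (Q := fun m i => proper_key i)).
    by move=> m n l; exact: proper_leq.
  by move=> l _; exact: proper_ex.
pose V m : set (lines k) := [set l | exists2 l', K l' & key m l = key m l'].
have exD m : exists D : {fset key_type (k := k) m},
    V m = \big[setU/set0]_(i <- D) fiber i /\ forall i, i \in D <-> exists2 l, V m l & i = key m l.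
  by apply: fiber_cover => l [l' Kl' El] l'' El''; exists l' => //; rewrite -El.
pose D m := projT1 (cid (exD m)); have hD m := projT2 (cid (exD m)).
have DE m l : key m l \in D m -> V m l.
  by move=> /(hD m).2[l' [l'' Kl'' E1] E2]; exists l'' => //; rewrite E2.
pose fm (X : nonzero_Curr R A) m (i : key_type m) : R := fine (nmeas X (fiber i : set (borel_lines k))).
have cyl m i : (m0 <= m)%N -> i \in D m -> exists u, [/\ reduced u, u <> [::] &
    forall X : nonzero_Curr R A, nmeas X (fiber i) = nmeas X (Cyl A (wv u))].
  move=> le /(hD m).2[l [l' Kl' E1] E2].
  have pi : proper_key i by rewrite E2 E1; apply: proper_leq le _; exact: hm0.
  have [g [u [ru u0 Ei]]] := proper_fiber A_basis pi (esym E2).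
  exists u; split=> // X; rewrite Ei (nmeas_current X).2 //.
  exact: open_borel (Cyl_open A_basis ru u0).
have fmc m i : (m0 <= m)%N -> i \in D m -> (fun n => fm (En n) m i : R^o) @ \oo --> (fm E m i : R^o).
  move=> le /(cyl m i le)[u [ru u0 Eu]]; rewrite /fm Eu.
  by under eq_fun do rewrite Eu; exact: hc.
have fin (X : nonzero_Curr R A) m i : (m0 <= m)%N -> i \in D m -> (nmeas X (fiber i) < +oo)%E.
  move=> le /(cyl m i le)[u [ru u0 ->]]; exact: nmeas_compact (Cyl_compact A_basis ru u0).
pose tot (X : nonzero_Curr R A) m : R := \sum_(i <- D m) fm X m i.
pose v0 := tot E m0.
have fm0 (X : nonzero_Curr R A) m i : 0 <= fm X m i by apply/fine_ge0/measure_ge0.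
have v00 : 0 <= v0 by apply: sumr_ge0 => i _; exact: fm0.
have totE (X : nonzero_Curr R A) m : (m0 <= m)%N -> nmeas X (V m) = (tot X m)%:E.
  move=> le; rewrite (hD m).1 measure_fbigsetU.
  - rewrite /tot -sumEFin; apply: eq_big_seq => i iD; rewrite /fm fineK //.
    by rewrite ge0_fin_numE ?measure_ge0 // (fin X m i le iD).
  - by move=> i _; apply: open_borel; exact: fiber_open.
  - exact: trivIset_fiber.
have tot_le m : (m0 <= m)%N -> tot E m <= v0.
  move=> le; rewrite -lee_fin -!totE //; apply: le_measure.
  - by rewrite inE; apply: open_borel; apply/open_keyP => l Vl; exists m => l' El; case: Vl => l1 h1 h2; exists l1 => //; rewrite El.
  - by rewrite inE; apply: open_borel; apply/open_keyP => l Vl; exists m0 => l' El; case: Vl => l1 h1 h2; exists l1 => //; rewrite El.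
  - by move=> l [l' Kl' El]; exists l' => //; exact: key_leq le El.
(* The errors are [e * v0] for [E], [e * (v0 + 1)] for a nearby current, whose total mass differs by
   at most 1, and [e] between the two step sums. *)
apply/cvgrPdist_le => eps eps0; pose e := eps / (2 * v0 + 2).
have d0 : 0 < 2 * v0 + 2 by rewrite ltr_wpDl // mulr_ge0.
have e0 : 0 < e by rewrite divr_gt0.
have [m hm] : exists m, forall l, K l -> (m0 <= m)%N /\
    forall l1 l2, fiber (key m l) l1 -> fiber (key m l) l2 -> `|f l1 - f l2| <= e.
  apply: (compact_uniform cK (Q := fun m i => (m0 <= m)%N /\
    forall l1 l2, fiber i l1 -> fiber i l2 -> `|f l1 - f l2| <= e)).
    move=> m n l le [h1 h2]; split; first exact: leq_trans h1 le.
    by move=> l1 l2 /(key_leq le) E1 /(key_leq le) E2; apply: h2.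
  move=> l _; have : open (f @^-1` ball (f l) (e / 2)).
    by apply: (continuousP f).1 => //; exact: ball_open.
  move=> /open_keyP/(_ l) []; first by rewrite /=; apply: ballxx; rewrite divr_gt0.
  move=> m1 h1; exists (maxn m0 m1); split; first exact: leq_maxl.
  move=> l1 l2 /(key_leq (leq_maxr m0 m1)) /h1 b1 /(key_leq (leq_maxr m0 m1)) /h1 b2.
  have : ball (f l1) (e / 2 + e / 2) (f l2) by apply: ball_triangle b2; exact: ball_sym.
  by rewrite -splitr => /ltW.
have lem : forall l, K l -> (m0 <= m)%N by move=> l /hm[].
have [/eqP K0|/set0P[l0 Kl0]] := boolP (K == set0).
  have f00 l : f l = 0 by apply: f0; rewrite K0.
  have I0 (X : nonzero_Curr R A) : \int[nmeas X]_(l in setT) f l = 0.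
    transitivity (\int[nmeas X]_(l in setT) (0 : R)); last by rewrite Rintegral_cst ?mul0r.
    by apply: eq_Rintegral => l _; exact: f00.
  by near=> n; rewrite !I0 subrr normr0 ltW.
have {}lem := lem l0 Kl0.
have [r hr] : exists r : key_type (k := k) m -> R, forall i l, i \in D m -> fiber i l -> `|f l - r i| <= e.
  have ex i : exists x : R, i \in D m -> forall l, fiber i l -> `|f l - x| <= e.
    have [iD|nD] := boolP (i \in D m); last by exists 0.
    have [l [l' Kl' E1] E2] := ((hD m).2 i).1 iD; exists (f l') => _ l1 h1.
    by apply: (hm l' Kl').2 => //; rewrite -E1 -E2.
  by exists (fun i => projT1 (cid (ex i))) => i l iD; apply: (projT2 (cid (ex i))).
have step (X : nonzero_Curr R A) : `|\int[nmeas X]_(l in setT) f l - \sum_(i <- D m) r i * fm X m i| <= e * tot X m.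
  apply: (@Rintegral_near_step _ _ _ (nmeas X) _ (D m) (@fiber k m) f r e) => //.
  - by move=> i; apply: open_borel; exact: fiber_open.
  - exact: trivIset_fiber.
  - by move=> i iD; exact: fin lem iD.
  - by move=> l; rewrite -(hD m).1 => nV; apply: f0 => Kl; apply: nV; exists l.
have ctot : (fun n => tot (En n) m : R^o) @ \oo --> (tot E m : R^o).
  by apply: cvg_seq_sum => i iD; exact: fmc.
have csum : (fun n => \sum_(i <- D m) r i * fm (En n) m i : R^o) @ \oo -->
    (\sum_(i <- D m) r i * fm E m i : R^o).
  by apply: cvg_seq_sum => i iD; apply: cvgM; [exact: cvg_cst | exact: fmc].
have /cvgrPdist_le/(_ _ ltr01) near1 := ctot.
have /cvgrPdist_le/(_ _ e0) near2 := csum.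
near=> n.
have h1 : `|tot E m - tot (En n) m| <= 1 by near: n.
have h2 : `|\sum_(i <- D m) r i * fm E m i - \sum_(i <- D m) r i * fm (En n) m i| <= e by near: n.
have h3 := step E; have h4 := step (En n); have h5 := tot_le m lem.
have Ee : e * (2 * v0 + 2) = eps by rewrite /e divfK // gt_eqF.
move: h1 h2 h3 h4 Ee h5; set I1 := Rintegral _ _ _; set I2 := Rintegral _ _ _.
set s1 := \sum_(i <- _) _; set s2 := \sum_(i <- _) _.
rewrite !ler_norml => /andP[h1 h1'] /andP[h2 h2'] /andP[h3 h3'] /andP[h4 h4'] Ee h5.
have h6 : e * tot E m <= e * v0 by rewrite ler_pM2l.
have h7 : e * tot (En n) m <= e * (v0 + 1) by rewrite ler_pM2l //; lra.
by apply/andP; split; rewrite -Ee; lra.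
Unshelve. all: by end_near.
Qed.

End WeakConvergence.

Section RatioEstimate.
Local Open Scope ring_scope.
(** The factor [n * r] cancels in the quotient, which leaves an error of order 1/n;
    [2 * K <= n * tot] keeps [T] above half of its main term. *)
Lemma ratio_estimate (R : realFieldType) (N T lam tot n r K : R) :
  0 < r -> 0 < n -> 0 < tot -> 0 <= lam -> 0 <= K ->
  `|N - n * r * lam| <= K * r -> `|T - n * r * tot| <= K * r -> 2 * K <= n * tot ->
  `|lam / tot - N / T| <= 2 * K * (tot + lam) / tot ^+ 2 / n.
Proof.
move=> r0 n0 t0 l0 K0 hN hT le.
have nr0 : 0 < n * r by rewrite mulr_gt0.
have lT : n * r * tot / 2 <= T.
  move: hT; rewrite ler_norml => /andP[h _].
  have : r * (2 * K) <= r * (n * tot) by rewrite ler_pM2l.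
  by lra.
have T0 : 0 < T by apply: lt_le_trans lT; rewrite divr_gt0 // mulr_gt0.
have -> : lam / tot - N / T = (lam * (T - n * r * tot) - tot * (N - n * r * lam)) / (tot * T).
  by field; rewrite !gt_eqF.
rewrite normrM normfV (gtr0_norm (mulr_gt0 t0 T0)) ler_pdivrMr ?mulr_gt0 //.
apply: (@le_trans _ _ (K * r * (tot + lam))).
  apply: le_trans (ler_normB _ _) _; rewrite !normrM (ger0_norm l0) (gtr0_norm t0).
  by rewrite mulrDr addrC lerD // mulrC ler_wpM2r // ltW.
have -> : 2 * K * (tot + lam) / tot ^+ 2 / n * (tot * T) = (K * (tot + lam) * 2 / (tot * n)) * T.
  by field; rewrite !gt_eqF.
have -> : K * r * (tot + lam) = (K * (tot + lam) * 2 / (tot * n)) * (n * r * tot / 2).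
  by field; rewrite !gt_eqF.
by rewrite ler_wpM2l // divr_ge0 ?mulr_ge0 ?addr_ge0 // ltW.
Qed.
End RatioEstimate.

(** * Ratios of masses on projective classes *)

Section Projective.
Context {R : realType} {F : groupType} {k : nat} {A : 'I_k.+2 -> F} (A_basis : is_basis A).
Implicit Types (E : nonzero_Curr R A) (u : seq (letter k)) (x : PCurr R A).
Local Notation nf := (nf A_basis).
Local Open Scope ring_scope.

Lemma pclassP E E' : pclass E = pclass E' <-> exists2 c : R, 0 < c &
  forall S : set (borel_lines k), measurable S -> nmeas E' S = (c%:E * nmeas E S)%E.
Proof. by split=> [/eqmodP/asboolP|h]; [|apply/eqmodP/asboolP]. Qed.

Lemma pclass_repr x : pclass (repr x) = x.
Proof. by rewrite /pclass reprK. Qed.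

Lemma cyl_mass_scale (c : R) E E' u : reduced u -> u <> [::] ->
  (forall S : set (borel_lines k), measurable S -> nmeas E' S = (c%:E * nmeas E S)%E) ->
  cyl_mass u E' = c * cyl_mass u E.
Proof.
move=> ru u0 h; rewrite /cyl_mass h; last exact: open_borel (Cyl_open A_basis ru u0).
by rewrite (cyl_massE A_basis) // -EFinM.
Qed.

Lemma total_mass_scale (c : R) E E' :
  (forall S : set (borel_lines k), measurable S -> nmeas E' S = (c%:E * nmeas E S)%E) ->
  total_mass E' = c * total_mass E.
Proof.
by move=> h; rewrite /total_mass mulr_sumr; apply: eq_bigr => a _; exact: cyl_mass_scale.
Qed.

(* repr x is only defined up to scaling, which cancels out. *)
Definition ratio u x : R^o := cyl_mass u (repr x) / total_mass (repr x).

Lemma ratio_pclass u E : reduced u -> u <> [::] ->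
  ratio u (pclass E) = cyl_mass u E / total_mass E.
Proof.
move=> ru u0; have /pclassP[c c0 h] : pclass E = pclass (repr (pclass E)).
  by rewrite pclass_repr.
rewrite /ratio (cyl_mass_scale ru u0 h) (total_mass_scale h) invfM mulrACA divff ?mul1r //.
by rewrite gt_eqF.
Qed.

Lemma ratio_continuous u : reduced u -> u <> [::] -> continuous (ratio u).
Proof.
move=> ru u0; apply/quotient_continuous.
rewrite (_ : _ \o _ = (fun E => cyl_mass u E / total_mass E : R^o)); last first.
  by apply/funext => E; exact: ratio_pclass.
move=> E; have ct : (fun X : nonzero_Curr R A => total_mass X : R^o) @ E --> (total_mass E : R^o).
  apply: cvg_seq_sum => [|a _]; first exact: nbhs_filter.
  exact: (@cyl_mass_continuous _ _ _ _ A_basis [:: a] isT _ E).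
have t0 : total_mass E != 0 by rewrite gt_eqF // (total_mass_gt0 A_basis).
exact: (cvgM (@cyl_mass_continuous _ _ _ _ A_basis u ru u0 E) (cvgV t0 ct)).
Qed.

(** Representatives are rescaled to the total mass of [E]; convergence of ratios becomes convergence
    of cylinder masses, and the projection is continuous. *)
Lemma pclass_cvg (x_ : nat -> PCurr R A) E :
  (forall u, reduced u -> u <> [::] -> ratio u (x_ n) @[n --> \oo] --> ratio u (pclass E)) ->
  x_ @ \oo --> pclass E.
Proof.
move=> h; pose t n := total_mass E / total_mass (repr (x_ n)).
have t0 n : 0 < t n by rewrite divr_gt0 // (total_mass_gt0 A_basis).
have ex n := scale_current_ex (repr (x_ n)) (t0 n).
pose En n := projT1 (cid (ex n)); have hE n := projT2 (cid (ex n)).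
have -> : x_ = fun n => pclass (En n).
  apply/funext => n; rewrite -[LHS]pclass_repr; apply/pclassP.
  by exists (t n) => // S _; exact: hE.
have cE : En @ \oo --> E.
  apply: (cyl_mass_cvg A_basis) => u ru u0.
  have -> : cyl_mass u E = total_mass E * ratio u (pclass E) :> R^o.
    by rewrite ratio_pclass // mulrCA divff ?mulr1 // gt_eqF // (total_mass_gt0 A_basis).
  have -> : (fun n => cyl_mass u (En n) : R^o) = fun n => total_mass E * ratio u (x_ n).
    apply/funext => n; rewrite (cyl_mass_scale ru u0 (fun S _ => hE n S)) /t /ratio.
    by rewrite mulrAC -mulrA.
  by apply: cvgM; [exact: cvg_cst | exact: h].
have cp : continuous (fun X : nonzero_Curr R A => pclass X) by exact: pi_continuous.
by move=> U /(cp E) /cE.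
Qed.

(** [f0] and the representative of [p] differ by an inner automorphism, which homogenized counts do
    not see, and the scalar between representatives of the class cancels in the ratio. *)
Lemma ratio_out_act h E (f0 : aut F) (p : out F) u : is_counting_current h E ->
  out_class f0 = p -> reduced u -> u <> [::] ->
  exists (N : nat) (Na : letter k -> nat), [/\ homog (fun y => lcount u (nf y)) (f0 h) N,
    forall a, homog (fun y => lcount [:: a] (nf y)) (f0 h) (Na a) &
    ratio u (out_act p (pclass E)) = N%:R / (\sum_a Na a)%N%:R].
Proof.
move=> hE pE ru u0; set E0 := repr (pclass E); set f := repr p.
have /pclassP[c c0 hc] : pclass E = pclass E0 by rewrite pclass_repr.
have cj : conj (f h) (f0 h).
  have /asboolP[z hz] : outer_eq f f0 by rewrite /f -pE; exact: outer_eq_repr.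
  by exists z; rewrite hz.
have one v : reduced v -> v <> [::] -> exists N : nat,
    homog (fun y => lcount v (nf y)) (f0 h) N /\ cyl_mass v (aut_act f E0) = c * N%:R.
  move=> rv v0; have [N [EN hN]] := counting_current_map A_basis f hE rv v0.
  have ne : v != [::] by exact/eqP.
  exists N; split; first exact: homog_conj (quasi_add_count A_basis ne) cj hN.
  rewrite /cyl_mass (aut_actE A_basis); last exact: open_borel (Cyl_open A_basis rv v0).
  rewrite hc ?EN //; apply: open_borel; apply: (line_map_open (bicoarse_aut A_basis f)).
  exact: (Cyl_open A_basis rv v0).
have [N [hN EN]] := one u ru u0.
have ex1 a : exists N0 : nat, homog (fun y => lcount [:: a] (nf y)) (f0 h) N0 /\
    cyl_mass [:: a] (aut_act f E0) = c * N0%:R by exact: one.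
pose Na a := projT1 (cid (ex1 a)); have hNa a := projT2 (cid (ex1 a)).
exists N, Na; split; [by []|by move=> a; case: (hNa a)|].
rewrite /out_act ratio_pclass // EN /total_mass.
rewrite (eq_bigr _ (fun a _ => (hNa a).2)).
by rewrite -mulr_sumr invfM mulrACA divff ?mul1r ?gt_eqF // natr_sum.
Qed.

End Projective.

(** * Limits of the stable currents *)

Section StableLimit.
Context {R : realType} {F : groupType} {k : nat} {A : 'I_k.+2 -> F} (A_basis : is_basis A).
Context {c1 c2 : F} {d1 d2 : aut F} {ell1 ell2 : F -> Prop} {rank1 rank2 : F -> nat}.
Context (tw1 : is_twist_rank A_basis c1 d1 ell1 rank1) (tw2 : is_twist_rank A_basis c2 d2 ell2 rank2).
Context (c1_ne : c1 <> 1) (c2_ne : c2 <> 1).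
Context (c1_hyp : (0 < rank2 c1)%N) (c2_hyp : (0 < rank1 c2)%N).
Local Notation nf := (nf A_basis).

Lemma out_classX (f : aut F) n : out_class (f ^+ n) = out_class f ^+ n.
Proof. by elim: n => [|n IH] //; rewrite !expgS -IH -out_classM. Qed.

Lemma out_classV (f : aut F) : out_class f^-1 = (out_class f)^-1.
Proof.
apply: (mulgI (out_class f)); rewrite mulgV.
by rewrite -[LHS]/(out_mul _ _) out_classM mulgV.
Qed.

Lemma out_class_pair_twist n m : out_class (pair_twist (d1 := d1) (d2 := d2) n ^+ m) =
  (out_class d1 ^+ n * out_class d2 ^- n) ^+ m.
Proof.
rewrite out_classX; congr (_ ^+ _); rewrite /pair_twist -out_classM.
by rewrite /itr zpowN out_classV /= !out_classX.
Qed.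

(** For fixed [n] the bound on the ratios is uniform in [m], so it passes to [x_ n] by continuity of
    [ratio]; then [n] tends to infinity. *)
Theorem stable_limit (E : nonzero_Curr R A) (x_ : nat -> PCurr R A) (N : nat) :
  is_counting_current c1 E ->
  (forall n, (N <= n)%N -> (fun m : nat =>
     out_act ((out_class d1 ^+ n * out_class d2 ^- n) ^+ m) (pclass E)) @ \oo --> x_ n) ->
  x_ @ \oo --> pclass E.
Proof.
move=> hE hx; apply: (pclass_cvg A_basis) => u ru u0.
have une : u != [::] by exact/eqP.
have lamP v : reduced v -> v <> [::] -> exists lam : nat,
    homog (fun y => lcount v (nf y)) c1 lam /\ cyl_mass v E = (lam%:R)%R.
  move=> rv v0; have [lam [Elam hlam]] := counting_current_map A_basis 1 hE rv v0.
  exists lam; split=> //; rewrite /cyl_mass.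
  suff <- : line_map A (1 : aut F) @^-1` Cyl A (word_val A v) = Cyl A (word_val A v) by rewrite Elam.
  by apply/seteqP; split=> l /=; rewrite -[aut_fun 1]/id (line_map_id A_basis).
have [lam [hlam Elam]] := lamP u ru u0.
have lamaP a : exists lam : nat,
    homog (fun y => lcount [:: a] (nf y)) c1 lam /\ cyl_mass [:: a] E = (lam%:R)%R by exact: lamP.
pose lama a := projT1 (cid (lamaP a)); have hlama a := projT2 (cid (lamaP a)).
have Etot : total_mass E = ((\sum_a lama a)%N%:R)%R.
  by rewrite /total_mass (eq_bigr _ (fun a _ => (hlama a).2)) natr_sum.
have [Ku [nu hu]] := pair_twist_iterates tw1 tw2 c1_ne c2_ne c1_hyp c2_hyp
  (quasi_add_count A_basis une) hlam.
have exa a : exists Kn : nat * nat, forall n m : nat, (Kn.2 <= n)%N ->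
  forall mu, homog (fun y => lcount [:: a] (nf y))
    ((pair_twist (d1 := d1) (d2 := d2) n ^+ m.+1 : aut F) c1) mu ->
  let r := rank1 (itr d2 (- Posz n)%R ((pair_twist (d1 := d1) (d2 := d2) n ^+ m : aut F) c1)) in
  [/\ 0 < r, mu <= n * r * lama a + Kn.1 * r & n * r * lama a <= mu + Kn.1 * r]%N.
  have [Ka [na ha]] := pair_twist_iterates tw1 tw2 c1_ne c2_ne c1_hyp c2_hyp
    (@quasi_add_count _ _ _ A_basis [:: a] isT) (hlama a).1.
  by exists (Ka, na).
pose Kna a := projT1 (cid (exa a)); have hKna a := projT2 (cid (exa a)).
(* One constant serves for [u] and for the sum over the letters, since [r] is the same for all
   counts. *)
pose K := (Ku + \sum_a (Kna a).1)%N; pose lt := (\sum_a lama a)%N.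
have lt0 : (0 < lt)%N.
  by rewrite -(ltr_nat R) /lt -Etot (total_mass_gt0 A_basis).
(* [2 * K] meets the hypothesis of [ratio_estimate], as [lt] is at least 1; the last summand keeps
   [n] positive. *)
pose n0 := (N + nu + \sum_a (Kna a).2 + 2 * K + 1)%N.
pose C : R := (2 * K%:R * (lt%:R + lam%:R) / lt%:R ^+ 2)%R.
have bound n : (n0 <= n)%N ->
    (`|ratio u (pclass E) - ratio u (x_ n)| <= C / n%:R)%R.
  move=> len; have lN : (N <= n)%N by move: len; rewrite /n0; lia.
  have lnu : (nu <= n)%N by move: len; rewrite /n0; lia.
  have lna a : ((Kna a).2 <= n)%N.
    by have : ((Kna a).2 <= \sum_a (Kna a).2)%N; [rewrite (bigD1 a) //= leq_addr | move: len; rewrite /n0; lia].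
  have l2K : (2 * K <= n)%N by move: len; rewrite /n0; lia.
  have n1 : (0 < n)%N by move: len; rewrite /n0; lia.
  have fin m : (`|ratio u (pclass E) - ratio u
      (out_act ((out_class d1 ^+ n * out_class d2 ^- n) ^+ m.+1)%g (pclass E))| <= C / n%:R)%R.
    have [Nu [Na [hNu hNa ->]]] := ratio_out_act A_basis hE (out_class_pair_twist n m.+1) ru u0.
    have [r0 u1 u2] := hu n m lnu Nu hNu; set r := rank1 _ in r0 u1 u2.
    have a12 a : (Na a <= n * r * lama a + (Kna a).1 * r /\ n * r * lama a <= Na a + (Kna a).1 * r)%N.
      by have [_ a1 a2] := hKna a n m (lna a) (Na a) (hNa a).
    set T := (\sum_a Na a)%N.
    have t1 : (T <= n * r * lt + K * r)%N.
      apply: (@leq_trans (\sum_a (n * r * lama a + (Kna a).1 * r))%N).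
        by apply: leq_sum => a _; case: (a12 a).
      rewrite big_split /= -big_distrr /= -big_distrl /= leq_add2l leq_mul2r.
      by rewrite /K leq_addl orbT.
    have t2 : (n * r * lt <= T + K * r)%N.
      apply: (@leq_trans (\sum_a (Na a + (Kna a).1 * r))%N).
        by rewrite /lt big_distrr /=; apply: leq_sum => a _; case: (a12 a).
      rewrite big_split /= -big_distrl /= leq_add2l leq_mul2r.
      by rewrite /K leq_addl orbT.
    have KuK : (Ku * r <= K * r)%N by rewrite leq_mul2r leq_addr orbT.
    rewrite (ratio_pclass A_basis) // Elam Etot.
    apply: (@ratio_estimate R Nu%:R T%:R lam%:R lt%:R n%:R r%:R K%:R); rewrite ?ltr0n ?ler0n //.
    - rewrite -!natrM ler_norml; apply/andP; split.
        by rewrite lerNl opprB lerBlDl -natrD ler_nat (leq_trans u2) // leq_add2l.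
      by rewrite lerBlDl -natrD ler_nat (leq_trans u1) // leq_add2l.
    - rewrite -!natrM ler_norml; apply/andP; split.
        by rewrite lerNl opprB lerBlDl -natrD ler_nat.
      by rewrite lerBlDl -natrD ler_nat.
    - by rewrite -!natrM ler_nat (leq_trans l2K) // leq_pmulr.
  apply/ler_addgt0Pr => e e0.
  have cr : (fun m : nat => ratio u (out_act ((out_class d1 ^+ n * out_class d2 ^- n) ^+ m) (pclass E)))
      @ \oo --> ratio u (x_ n).
    by move=> U /(ratio_continuous A_basis ru u0) /(hx n lN).
  have /cvgrPdist_le/(_ _ e0)[M _ hM] := cr.
  have := hM M.+1 (leqnSn M); have := fin M; move: (ratio u (out_act _ _)) => y h1 h2.
  rewrite -(subrKA y) (le_trans (ler_normD _ _)) // lerD //.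
  by rewrite distrC.
apply/cvgrPdist_le => e e0; near=> n.
have C0 : (0 <= C)%R by rewrite /C divr_ge0 ?mulr_ge0 ?addr_ge0 ?ler0n.
have n1 : (n0 <= n)%N by near: n; exists n0.
apply: le_trans (bound n n1) _.
have n2 : (C / e <= n%:R)%R by near: n; exact: nbhs_infty_ger.
have n3 : (0 < n%:R :> R)%R by rewrite ltr0n; move: n1; rewrite /n0; lia.
by rewrite ler_pdivrMr // mulrC -ler_pdivrMr.
Unshelve. all: by end_near.
Qed.

End StableLimit.

Theorem theorem5p2 (R : realType) (k : nat) (F : groupType)
    (A : 'I_k.+2 -> F) (A_basis : is_basis A)
    (s1 s2 : splitting F)
    (s1_cyclic : is_cyclic_splitting s1) (s2_cyclic : is_cyclic_splitting s2)
    (s1_very_small : very_small (bass_serre s1))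
    (s2_very_small : very_small (bass_serre s2))
    (s1_s2_fill : fill (bass_serre s1) (bass_serre s2))
    (d1 d2 : aut F)
    (d1_twist : is_dehn_twist s1 d1) (d2_twist : is_dehn_twist s2 d2)
    (eta : F -> nonzero_Curr R A)
    (eta_counting : forall h, h <> 1 -> is_counting_current h (eta h))
    (N : nat)
    (N_hyp : forall n, (N <= n)%N ->
       hyperbolic (out_class d1 ^+ n * out_class d2 ^- n) /\
       fully_irreducible (out_class d1 ^+ n * out_class d2 ^- n))
    (mu_plus mu_minus : nat -> PCurr R A)
    (mu_plus_stable : forall n, (N <= n)%N ->
       is_stable_current (out_class d1 ^+ n * out_class d2 ^- n) (mu_plus n))
    (mu_minus_unstable : forall n, (N <= n)%N ->
       is_unstable_current (out_class d1 ^+ n * out_class d2 ^- n) (mu_minus n)) :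
  mu_plus @ \oo --> pclass (eta (edge_generator s1)) /\
  mu_minus @ \oo --> pclass (eta (edge_generator s2)).
Proof.
have [[c1 _] [c2 _]] := (s1_cyclic, s2_cyclic).
have p1 := maximal_cyclic_prim A_basis c1 (very_small_maximal c1 s1_very_small).
have p2 := maximal_cyclic_prim A_basis c2 (very_small_maximal c2 s2_very_small).
have [rank1 tw1] := splitting_rank A_basis s1_cyclic p1 d1_twist.
have [rank2 tw2] := splitting_rank A_basis s2_cyclic p2 d2_twist.
have h1 : (0 < rank2 (edge_generator s1))%N.
  rewrite lt0n; apply/eqP => /(proj1 tw2).
  exact: fill_not_elliptic s1_cyclic s2_cyclic s1_s2_fill.
have h2 : (0 < rank1 (edge_generator s2))%N.
  rewrite lt0n; apply/eqP => /(proj1 tw1).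
  exact: fill_not_elliptic s2_cyclic s1_cyclic (fill_sym s1_s2_fill).
split.
  apply: (stable_limit tw1 tw2 c1 c2 h1 h2 (N := N) (eta_counting _ c1)) => n Nn.
  by apply: (mu_plus_stable n Nn).2 (eta_counting _ c1).
apply: (stable_limit tw2 tw1 c2 c1 h2 h1 (N := N) (eta_counting _ c2)) => n Nn.
(* The forward iterates for the exchanged twists are thus the backward iterates that define the
   unstable current. *)
have -> : out_class d2 ^+ n * out_class d1 ^- n = (out_class d1 ^+ n * out_class d2 ^- n)^-1.
  by rewrite invgM invgK.
under eq_fun do rewrite expVgn.
by apply: (mu_minus_unstable n Nn).2 (eta_counting _ c2).
Qed.
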